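(* Let $\alpha\in(0,1)$ and let $\xi_0,\xi_1,\ldots$ be i.i.d. nondegenerate real-valued random variables such that $\bar F(t):=\mathbb{P}[\log|\xi_0|>t]$ is regularly varying at $+\infty$ with index $-\alpha$, the limit $c:=\lim_{t\to+\infty}\mathbb{P}[\xi_0>t]/\mathbb{P}[|\xi_0|>t]\in[0,1]$ exists, and $\xi_0\ne0$ a.s. Let $p=\mathbb{P}[\xi_0>0]$, and let $N_n$ be the number of real roots (counted with multiplicities) of $G_n(z)=\sum_{k=0}^n\xi_kz^k$. Then, as $n\to\infty$, the sequence $\{N_{2n}\}_{n\in\mathbb{N}}$ (resp., $\{N_{2n+1}\}_{n\in\mathbb{N}}$) converges in distribution to a (finite) random variable $N^+_{\alpha,c,p}$ (resp., $N^-_{\alpha,c,p}$) whose law depends only on $\alpha,c,p$. *)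

(* Defs.v *)
From HB Require Import structures.
From mathcomp Require Export all_boot all_order all_algebra.
From mathcomp Require Export all_classical all_reals all_analysis.

Set Implicit Arguments.
Unset Strict Implicit.
Unset Printing Implicit Defensive.

Export Order.TTheory GRing.Theory Num.Theory.
Export numFieldNormedType.Exports.

#[global] Open Scope classical_set_scope.
#[global] Open Scope ring_scope.

(* Regular variation at +oo with index [rho], for functions that are measurable
   and positive near +oo. *)
Definition regularly_varying (R : realType) (f : R -> R) (rho : R) : Prop :=
  (exists X : R, measurable_fun `[X, +oo[%classic f /\
                 forall t, X <= t -> 0 < f t) /\
  forall l : R, 0 < l -> f (l * t) / f t @[t --> +oo] --> l `^ rho.

Definition mutually_independent d (T : measurableType d) (R : realType)
    (P : probability T R) (X : nat -> {RV P >-> R}) : Prop :=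
  forall (J : seq nat) (B : nat -> set R), uniq J ->
    (forall j, measurable (B j)) ->
    P (\bigcap_(j in [set` J]) X j @^-1` B j) =
    (\prod_(j <- J) P (X j @^-1` B j))%E.

Definition identically_distributed d (T : measurableType d) (R : realType)
    (P : probability T R) (X : nat -> {RV P >-> R}) : Prop :=
  forall (i j : nat) (B : set R), measurable B ->
    distribution P (X i) B = distribution P (X j) B.

Definition iid d (T : measurableType d) (R : realType)
    (P : probability T R) (X : nat -> {RV P >-> R}) : Prop :=
  mutually_independent X /\ identically_distributed X.

Definition nondegenerate d (T : measurableType d) (R : realType)
    (P : probability T R) (X : {RV P >-> R}) : Prop :=
  ~ exists a : R, {ae P, forall w, X w = a}.

Definition prob d (T : measurableType d) (R : realType)
    (P : probability T R) (A : set T) : R := fine (P A).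

(* Number of real roots counted with multiplicities ([mup x q] is the
   multiplicity of [x] as a root of [q]); by convention it is 0 for [q = 0],
   since [mup x 0 = 0]. *)
Definition nb_real_roots (R : realType) (q : {poly R}) : nat :=
  (\sum_(x \in [set x : R | root q x]) mup x q)%N.

Definition random_poly d (T : measurableType d) (R : realType)
    (P : probability T R) (xi : nat -> {RV P >-> R}) (n : nat) (w : T) :
    {poly R} := \poly_(k < n.+1) xi k w.

(* Convergence in distribution of random variables [X n] to a real-valued
   (hence finite) random variable with law [mu].  That each [X n] is a random
   variable is part of the notion. *)
Definition cvg_in_distribution d (T : measurableType d) (R : realType)
    (P : probability T R) (X : nat -> T -> R)
    (mu : probability R R) : Prop :=
  (forall n, measurable_fun [set: T] (X n)) /\
  forall f : R -> R, continuous f -> bounded_fun f ->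
    ('E_P[f \o X n] @[n --> \oo] --> 'E_mu[f])%E.

(* Main.v *)
Require Import Defs.
From mathcomp Require Import ring lra zify.
From mathcomp Require Import measurable_realfun.
From mathcomp Require polyrcf polyorder.
Set Implicit Arguments.
Unset Strict Implicit.
Unset Printing Implicit Defensive.

(* Plot the points [(k / n, ln |xi_k| / a_n)], where [a_n] is the [1 / n]-quantile of the tail
   of [ln |xi_0|].  They converge to a Poisson process whose intensity is integrable at infinity
   and, since [alpha < 1], only finitely many of them are vertices of the least concave majorant.
   As [a_n / n] grows like a power of [n], along an edge from [i] to [j] all the other terms of
   the polynomial are exponentially smaller, so that the edge carries the real roots of the
   binomial [xi_i + xi_j z^(j - i)].  Hence the number of roots is a function of the signs of
   the vertices and of the parities of their indices.  Rounding the points to a finite grid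
   changes this number only with small probability, and the law of the rounded configuration
   converges because its void probabilities do, to a limit that depends on the parity of [n]
   through the last vertex only.  The resulting limits of [P(N_n = m)] sum to 1 since, up to a
   small probability, [N_n] takes finitely many values. *)

(** * Polynomials with one or two dominant monomials *)

(** The number of roots is discontinuous at degenerate majorants, and points crowd near the axis.
    Two margins deal with this. The points near the ends stay, with high probability, under two
    cones of at most half the slope of the tent from the ends to one high point, so that no low
    point is a vertex; the expected number of violations is a sum of tails dominated by its last
    dyadic block because [alpha < 1]. No three retained nodes are nearly collinear, so that
    orientations survive the rounding. Each margin leaves a domination gap at least of order
    [a_n / n], which has only to beat [4 (n + 1)^2]: one factor [n + 1] counts the terms, the other
    bounds the degrees that enter when the root on an edge is shown simple and unique through
    Rolle's theorem for [f(z) / z^i]. No limiting point process is built: for each [e] the grid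
    gives numbers within [e] of [P(N_n = m)] for large [n] of a given parity. Their existence makes
    these probabilities Cauchy, and their dependence on [alpha], [c], [p] alone makes the limit
    universal. *)

Lemma sum_sub1_bound (R : realType) (n i : nat) (a : nat -> R) (B : R) :
  (i <= n)%N -> 0 <= B -> (forall k, (k <= n)%N -> k != i -> `|a k| <= B) ->
  `|\sum_(k < n.+1) a k - a i| <= n.+1%:R * B.
Proof.
move=> lin B0 hB.
rewrite (bigD1 (inord i : 'I_n.+1)) //= inordK ?ltnS // addrAC subrr add0r.
apply: (le_trans (ler_norm_sum _ _ _)).
apply: (@le_trans _ _ (\sum_(k < n.+1) B)).
  rewrite [leRHS](bigD1 (inord i : 'I_n.+1)) //= -[leLHS]add0r lerD //.
  apply: ler_sum => k kni; apply: hB; first by rewrite -ltnS.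
  by apply: contra kni => /eqP <-; rewrite inord_val.
by rewrite sumr_const card_ord mulr_natl.
Qed.

Lemma sum_sub2_bound (R : realType) (n i j : nat) (a : nat -> R) (B : R) :
  (i <= n)%N -> (j <= n)%N -> i != j -> 0 <= B ->
  (forall k, (k <= n)%N -> k != i -> k != j -> `|a k| <= B) ->
  `|\sum_(k < n.+1) a k - a i - a j| <= n.+1%:R * B.
Proof.
move=> lin ljn ij B0 hB.
pose b k := if k == j then 0 else a k.
have -> : \sum_(k < n.+1) a k - a i - a j = \sum_(k < n.+1) b k - b i.
  rewrite /b (negbTE ij) addrAC; congr (_ - _).
  rewrite (bigD1 (inord j : 'I_n.+1)) //= inordK ?ltnS // addrAC subrr add0r.
  rewrite [RHS](bigD1 (inord j : 'I_n.+1)) //= inordK ?ltnS // eqxx add0r.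
  apply: eq_bigr => k kj; rewrite ifF //; apply/negbTE; apply: contra kj => /eqP <-.
  by rewrite inord_val.
apply: sum_sub1_bound => // k kn ki; rewrite /b; case: eqP => [_|/eqP kj].
  by rewrite normr0.
exact: hB.
Qed.

Definition term_dominates (R : realType) (n : nat) (x : nat -> R) (e z : R) (i : nat) :=
  forall k, (k <= n)%N -> k != i -> `|x k| * z ^+ k <= e * (`|x i| * z ^+ i).

Definition two_terms_dominate (R : realType) (n : nat) (x : nat -> R) (e z : R)
    (i j : nat) :=
  forall k, (k <= n)%N -> k != i -> k != j ->
    `|x k| * z ^+ k <= e * Num.max (`|x i| * z ^+ i) (`|x j| * z ^+ j).

Lemma horner_deriv_poly (R : realType) (n : nat) (x : nat -> R) (z : R) :
  z * (\poly_(k < n.+1) x k)^`().[z] = \sum_(k < n.+1) k%:R * (x k * z ^+ k).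
Proof.
rewrite poly_def raddf_sum /= horner_sum mulr_sumr; apply: eq_bigr => k _.
rewrite derivZ derivXn hornerZ hornerMn hornerXn mulrCA mulrnAr -mulr_natl mulrCA.
case: (val k) => [|m] /=; first by rewrite !mul0r.
by rewrite -exprS.
Qed.

Section DominatedPolynomials.
Variables (R : realType) (n : nat) (x : nat -> R) (e : R).
Hypotheses (e0 : 0 < e) (ne : 4 * n.+1%:R ^+ 2 * e <= 1).
Let f := \poly_(k < n.+1) x k.

Let ne1 : n.+1%:R * e <= 4^-1.
Proof.
have h1 : 1 <= n.+1%:R :> R by rewrite ler1n.
have h2 : (n.+1%:R : R) <= n.+1%:R ^+ 2 by rewrite ler_eXnr.
have : n.+1%:R * e <= n.+1%:R ^+ 2 * e by rewrite ler_pM2r.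
by move: ne; lra.
Qed.

Lemma term_dominates_sg (z : R) (i : nat) : 0 < z -> (i <= n)%N -> x i != 0 ->
  term_dominates n x e z i -> 0 < f.[z] * x i.
Proof.
move=> z0 lin xi0 dom; rewrite /f horner_poly.
have P0 : 0 < `|x i| * z ^+ i by rewrite mulr_gt0 ?normr_gt0 ?exprn_gt0.
have h1 : `|\sum_(k < n.+1) x k * z ^+ k - x i * z ^+ i| <=
    n.+1%:R * e * (`|x i| * z ^+ i).
  rewrite -mulrA; apply: (@sum_sub1_bound R n i (fun k => x k * z ^+ k)) => //.
    by rewrite mulr_ge0 // ltW.
  move=> k kn ki; rewrite normrM (ger0_norm (exprn_ge0 _ (ltW z0))); exact: dom.
have h2 : n.+1%:R * e * (`|x i| * z ^+ i) <= 4^-1 * (`|x i| * z ^+ i) by rewrite ler_pM2r.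
set S := \sum_(_ < _) _ in h1 *.
have h : `|S - x i * z ^+ i| < `|x i| * z ^+ i.
  by apply: (le_lt_trans h1); apply: (le_lt_trans h2); move: P0; lra.
move: h; case: (ltrgt0P (x i)) xi0 => // xi0 _; rewrite ltr_norml => /andP[h3 h4].
  by rewrite mulr_gt0 //; move: h3; lra.
by rewrite nmulr_lgt0 //; move: h4; lra.
Qed.

Let rest (z : R) (i j : nat) : 0 < z -> (i <= n)%N -> (j <= n)%N -> i != j ->
  two_terms_dominate n x e z i j ->
  `|f.[z] - x i * z ^+ i - x j * z ^+ j| <=
  4^-1 * Num.max (`|x i| * z ^+ i) (`|x j| * z ^+ j).
Proof.
move=> z0 lin ljn ij dom; rewrite /f horner_poly.
have P0 : 0 <= `|x i| * z ^+ i by rewrite mulr_ge0 ?exprn_ge0 // ltW.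
set M := Num.max _ _; have M0 : 0 <= M by rewrite le_max P0.
apply: (@le_trans _ _ (n.+1%:R * (e * M))); last by rewrite mulrA ler_wpM2r.
apply: (@sum_sub2_bound R n i j (fun k => x k * z ^+ k)) => //.
  by rewrite mulr_ge0 // ltW.
by move=> k kn ki kj; rewrite normrM (ger0_norm (exprn_ge0 _ (ltW z0))); exact: dom.
Qed.

Lemma two_terms_same_sg (z : R) (i j : nat) : 0 < z -> (i <= n)%N -> (j <= n)%N -> i != j ->
  0 < x i * x j -> two_terms_dominate n x e z i j -> ~~ root f z.
Proof.
move=> z0 lin ljn ij xx dom; apply/negP => /rootP fz.
have zi : 0 < z ^+ i by rewrite exprn_gt0.
have zj : 0 < z ^+ j by rewrite exprn_gt0.
have := rest z0 lin ljn ij dom; rewrite fz sub0r.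
have h2 (u v : R) : 0 < u -> 0 < v -> 4^-1 * Num.max u v < u + v.
  by move=> u0 v0; case: (leP u v) => _; lra.
have : (0 < x i /\ 0 < x j) \/ (x i < 0 /\ x j < 0).
  have [xi0|xi0|xi0] := ltrgt0P (x i); last by move: xx; rewrite xi0 mul0r ltxx.
    by left; split => //; move: xx; rewrite pmulr_rgt0.
  by right; split => //; move: xx; rewrite nmulr_rgt0.
case=> -[xi0 xj0].
  have ui : 0 < x i * z ^+ i by rewrite mulr_gt0.
  have uj : 0 < x j * z ^+ j by rewrite mulr_gt0.
  rewrite -opprD normrN (gtr0_norm (addr_gt0 ui uj)) (gtr0_norm xi0) (gtr0_norm xj0).
  by move=> h; have := h2 _ _ ui uj; rewrite ltNge h.
have ui : 0 < - x i * z ^+ i by rewrite mulr_gt0 ?oppr_gt0.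
have uj : 0 < - x j * z ^+ j by rewrite mulr_gt0 ?oppr_gt0.
rewrite (ltr0_norm xi0) (ltr0_norm xj0) -!mulNr (gtr0_norm (addr_gt0 ui uj)).
by move=> h; have := h2 _ _ ui uj; rewrite ltNge h.
Qed.

(** At a root the two terms cancel up to a quarter of the larger one, hence have comparable sizes.
    Only this direction is kept: it lets the term of index [j] control all the others. *)
Lemma two_terms_opp_sg (z : R) (i j : nat) : 0 < z -> (i <= n)%N -> (j <= n)%N -> i != j ->
  x i * x j < 0 -> two_terms_dominate n x e z i j -> root f z ->
  `|x i| * z ^+ i <= 2 * (`|x j| * z ^+ j).
Proof.
move=> z0 lin ljn ij xx dom /rootP fz.
have zi : 0 < z ^+ i by rewrite exprn_gt0.
have zj : 0 < z ^+ j by rewrite exprn_gt0.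
have := rest z0 lin ljn ij dom; rewrite fz sub0r.
have h (u v : R) : `|u - v| <= 4^-1 * Num.max u v -> 0 < u -> 0 < v -> u <= 2 * v.
  by rewrite ler_norml; case: (leP u v) => _ /andP[]; lra.
have : (0 < x i /\ x j < 0) \/ (x i < 0 /\ 0 < x j).
  have [xi0|xi0|xi0] := ltrgt0P (x i); last by move: xx; rewrite xi0 mul0r ltxx.
    by left; split => //; move: xx; rewrite pmulr_rlt0.
  by right; split => //; move: xx; rewrite nmulr_rlt0.
case=> -[xi0 xj0].
  rewrite (ltr0_norm xj0) (gtr0_norm xi0) -opprD normrN => h1.
  by apply: h; rewrite ?mulr_gt0 ?oppr_gt0 //; move: h1; rewrite !mulNr opprK.
rewrite (ltr0_norm xi0) (gtr0_norm xj0) -mulNr => h1.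
by apply: h; rewrite ?mulr_gt0 ?oppr_gt0.
Qed.

(** The operator [z d/dz - i] kills [z^i], so that the term of index [j], multiplied by
    [j - i >= 1], is left to dominate. The other factors [|k - i|] are at most [n + 1], whence the
    square in [ne]. *)
Lemma two_terms_deriv_sg (z : R) (i j : nat) : 0 < z -> (j <= n)%N -> (i < j)%N ->
  x j != 0 -> two_terms_dominate n x e z i j ->
  `|x i| * z ^+ i <= 2 * (`|x j| * z ^+ j) ->
  0 < (z * f^`().[z] - i%:R * f.[z]) * x j.
Proof.
move=> z0 ljn ij xj0 dom h.
have zj : 0 < z ^+ j by rewrite exprn_gt0.
have lin : (i <= n)%N by rewrite ltnW // (leq_trans ij).
have -> : z * f^`().[z] - i%:R * f.[z] =
    \sum_(k < n.+1) (k%:R - i%:R) * (x k * z ^+ k).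
  rewrite /f horner_deriv_poly horner_poly mulr_sumr -sumrB.
  by apply: eq_bigr => k _; rewrite mulrBl.
set B := `|x j| * z ^+ j in h.
have B0 : 0 < B by rewrite mulr_gt0 ?normr_gt0.
have h1 : `|\sum_(k < n.+1) (k%:R - i%:R) * (x k * z ^+ k) -
     (j%:R - i%:R) * (x j * z ^+ j)| <= n.+1%:R * (n.+1%:R * (e * (2 * B))).
  apply: (@sum_sub1_bound R n j (fun k => (k%:R - i%:R) * (x k * z ^+ k))) => //.
    by rewrite !mulr_ge0 // ltW.
  move=> k kn kj; rewrite !normrM (ger0_norm (exprn_ge0 _ (ltW z0))).
  have [->|ki] := eqVneq k i.
    by rewrite subrr normr0 mul0r !mulr_ge0 // ltW.
  apply: ler_pM; rewrite ?mulr_ge0 ?exprn_ge0 ?normr_ge0 // ?(ltW z0) //.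
    rewrite ler_norml; have hk : (k%:R : R) <= n.+1%:R by rewrite ler_nat ltnW.
    have hi : (i%:R : R) <= n.+1%:R by rewrite ler_nat ltnW.
    have k0 : 0 <= k%:R :> R by []. have i0 : 0 <= i%:R :> R by [].
    by apply/andP; split; lra.
  apply: (le_trans (dom k kn ki kj)); rewrite ler_pM2l // ge_max h /=.
  by rewrite -/B; lra.
set S := \sum_(_ < _) _ in h1 *.
have h2 : `|S - (j%:R - i%:R) * (x j * z ^+ j)| <= 2^-1 * B.
  apply: (le_trans h1).
  have -> : n.+1%:R * (n.+1%:R * (e * (2 * B))) = (4 * n.+1%:R ^+ 2 * e) * (2^-1 * B).
    by field.
  by rewrite -[leRHS]mul1r ler_wpM2r // mulr_ge0 // ltW.
have ji : 1 <= j%:R - i%:R :> R by rewrite -natrB ?(ltnW ij) // ler1n subn_gt0.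
have h3 : B <= (j%:R - i%:R) * B by rewrite ler_peMl // ltW.
move: h2; rewrite /B ler_norml => /andP[h4 h5].
have [x0|x0|x0] := ltrgt0P (x j); last by rewrite x0 eqxx in xj0.
  rewrite mulr_gt0 //; move: h4 h3 B0; rewrite /B (gtr0_norm x0).
  by lra.
rewrite nmulr_lgt0 //; move: h5 h3 B0; rewrite /B (ltr0_norm x0).
have -> : (j%:R - i%:R) * (- x j * z ^+ j) = - ((j%:R - i%:R) * (x j * z ^+ j)) by ring.
by lra.
Qed.

End DominatedPolynomials.

(** Rolle's theorem for [f(z) / z^i], whose derivative is [z f'(z) - i f(z)] divided by
    [z^(i+1)]. *)
Lemma rolle_weighted (R : realType) (f : {poly R}) (i : nat) (a b : R) :
  0 < a -> a < b -> root f a -> root f b ->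
  exists2 z, a < z < b & z * f^`().[z] - i%:R * f.[z] = 0.
Proof.
move=> a0 ab /rootP fa /rootP fb.
pose h (z : R) : R := f.[z] * (z ^+ i)^-1.
have dh (z : R) : 0 < z -> is_derive z 1 h
    (f.[z] *: (- (z ^+ i) ^- 2 *: ('X^i : {poly R})^`().[z]) + (z ^+ i)^-1 *: f^`().[z]).
  move=> z0.
  have -> : h = (horner f) \* (fun y : R => (('X^i : {poly R}).[y])^-1).
    by apply/funext => y; rewrite /h /= hornerXn.
  have zi : ('X^i : {poly R}).[z] = z ^+ i by rewrite hornerXn.
  have -> : z ^- i = ('X^i : {poly R}).[z]^-1 by rewrite zi.
  have -> : (z ^+ i) ^- 2 = ('X^i : {poly R}).[z] ^- 2 by rewrite zi.
  apply: is_deriveM; apply: is_deriveV; rewrite zi gt_eqF // exprn_gt0 //.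
have [|||c cab [_ hc]] := @Rolle R h a b ab.
- by move=> z /itvP zab; have [] := dh z; rewrite ?(lt_trans a0) ?zab.
- apply: derivable_within_continuous => z /itvP zab.
  by have [] := dh z; rewrite ?(lt_le_trans a0) ?zab.
- by rewrite /h fa fb !mul0r.
have c0 : 0 < c by rewrite (lt_trans a0) // (itvP cab).
exists c; first by rewrite !(itvP cab).
have [_] := dh c c0; rewrite hc => /esym.
have -> (u v w t : R) : u *: (v *: w) + t *: f^`().[c] = u * (v * w) + t * f^`().[c] by [].
rewrite derivXn hornerMn hornerXn.
have ci : c ^+ i != 0 by rewrite expf_neq0 ?gt_eqF.
have cn0 : c != 0 by rewrite gt_eqF.
case: i ci {dh h hc} => [|i] ci /=.
  by rewrite mulr0n !mulr0 add0r expr0 invr1 mul1r mul0r subr0 => ->; rewrite mulr0.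
rewrite -mulr_natr => h.
apply: (@mulfI _ ((c ^+ i.+1)^-1)); first by rewrite invr_eq0.
rewrite mulr0 -[RHS](mulr0 c) -h exprS.
have di : c ^+ i != 0 by rewrite expf_neq0.
move: (c ^+ i) (i.+1%:R) (f^`().[c]) (f.[c]) di => d u v w di.
by field; rewrite cn0 di.
Qed.

(** * Roots along a chain of edges of the majorant *)

Section ChainOfEdges.
Variables (R : realType) (n : nat) (x : nat -> R).

(** The signs of [f] at [c] and [c'] are those of [x i] and [x j], which gives a root. A second root
    would give, by [rolle_weighted], a zero of [z f' - i f] beyond the first one; but the ratio of
    term [j] to term [i] increases with [z], so that the balance found at the first root persists
    and [two_terms_deriv_sg] forbids such a zero. At a root the same sign condition reads
    [f' != 0]. *)
Lemma edge_root_unique (e : R) (i j : nat) (c c' : R) :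
  0 < e -> 4 * n.+1%:R ^+ 2 * e <= 1 ->
  (i < j)%N -> (j <= n)%N -> x i * x j < 0 -> 0 < c -> c <= c' ->
  term_dominates n x e c i -> term_dominates n x e c' j ->
  (forall z, c <= z <= c' -> two_terms_dominate n x e z i j) ->
  let f := \poly_(k < n.+1) x k in
  exists z0, [/\ c <= z0 < c', root f z0, f^`().[z0] != 0 &
    forall z, c <= z <= c' -> root f z -> z = z0].
Proof.
move=> e0 ne ij jn xx c0 cc' dc dc' d2 f.
have c'0 : 0 < c' by exact: lt_le_trans cc'.
have iln : (i <= n)%N by rewrite ltnW // (leq_trans ij).
have nij : i != j by rewrite ltn_eqF.
have xi0 : x i != 0 by apply: contraTneq xx => ->; rewrite mul0r ltxx.
have xj0 : x j != 0 by apply: contraTneq xx => ->; rewrite mulr0 ltxx.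
have sc := term_dominates_sg e0 ne c0 iln xi0 dc.
have sc' := term_dominates_sg e0 ne c'0 jn xj0 dc'.
rewrite -/f in sc sc'.
have key z : c <= z <= c' -> root f z -> `|x i| * z ^+ i <= 2 * (`|x j| * z ^+ j).
  move=> zc rz; have z0 : 0 < z by case/andP: zc => /(lt_le_trans c0).
  exact: (two_terms_opp_sg e0 ne z0 iln jn nij xx (d2 _ zc) rz).
have uni z1 z2 : c <= z1 <= c' -> c <= z2 <= c' -> root f z1 -> root f z2 -> z1 < z2 -> False.
  move=> z1c z2c r1 r2 z12; have z10 : 0 < z1 by case/andP: z1c => /(lt_le_trans c0).
  have [z /andP[z1z zz2] hz] := rolle_weighted i z10 z12 r1 r2.
  have z0 : 0 < z by exact: lt_trans z1z.
  have zc : c <= z <= c'.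
    by case/andP: z1c => h1 _; case/andP: z2c => _ h2; rewrite !ltW ?(le_lt_trans h1) ?(lt_le_trans zz2).
  have h1 : `|x i| * z1 ^+ i <= 2 * (`|x j| * z1 ^+ j) by exact: key.
  have h : `|x i| * z ^+ i <= 2 * (`|x j| * z ^+ j).
    have zE (t : R) : t ^+ j = t ^+ i * t ^+ (j - i) by rewrite -exprD subnKC // ltnW.
    move: h1; rewrite !zE.
    have : 0 < `|x j| by rewrite normr_gt0.
    move: `|x i| `|x j| => u v v0.
    rewrite !(mulrCA v) !(mulrCA 2) !(mulrC u).
    rewrite ler_pM2l ?exprn_gt0 // ler_pM2l ?exprn_gt0 // => /le_trans; apply.
    by rewrite ler_pM2l // ler_pM2l // lerXn2r ?nnegrE ?ltW.
  by have := two_terms_deriv_sg e0 ne z0 jn ij xj0 (d2 z zc) h; rewrite hz mul0r ltxx.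
have [z0 z0c r0] : exists2 z0, c <= z0 <= c' & root f z0.
  have [xj|xj|xj] := ltrgt0P (x j); last by rewrite xj eqxx in xj0.
    have xi : x i < 0 by move: xx; rewrite pmulr_llt0.
    apply: poly_ivt cc' _; move: sc sc'; rewrite (pmulr_lgt0 _ xj) (nmulr_lgt0 _ xi).
    by move=> h1 h2; rewrite !ltW.
  have xi : 0 < x i by move: xx; rewrite nmulr_llt0.
  have [|z zc rz] := @poly_ivt R (- f) c c' cc'.
    by move: sc sc'; rewrite !hornerN (pmulr_lgt0 _ xi) (nmulr_lgt0 _ xj) oppr_le0 oppr_ge0 => h1 h2; rewrite !ltW.
  by exists z => //; rewrite rootN in rz.
have z00 : 0 < z0 by case/andP: z0c => /(lt_le_trans c0).
exists z0; split => //.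
- case/andP: z0c => -> h /=; rewrite lt_neqAle h andbT.
  by apply: contraTneq sc' => <-; rewrite (rootP r0) mul0r ltxx.
- have := two_terms_deriv_sg e0 ne z00 jn ij xj0 (d2 z0 z0c) (key _ z0c r0).
  by rewrite -/f (rootP r0) mulr0 subr0; apply: contraTneq => ->; rewrite mulr0 mul0r ltxx.
- move=> z zc rz; have [h|h|//] := ltgtP z z0.
    by case: (uni z z0).
  by case: (uni z0 z).
Qed.

Definition log_abs (k : nat) : R := ln `|x k|.

(** At [ln z = - s] the terms [i] and [j] have equal modulus, and [D] is the logarithm of the factor
    by which they exceed all the others. *)
Definition strict_edge (y : nat -> R) (D : R) (i j : nat) : Prop :=
  [/\ (i < j)%N, (j <= n)%N & exists2 s : R, y j = y i + s * (j%:R - i%:R) &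
    forall k, (k <= n)%N -> k != i -> k != j -> y k + D <= y i + s * (k%:R - i%:R)].

Fixpoint is_chain (E : nat -> nat -> Prop) (i : nat) (p : seq nat) : Prop :=
  if p is j :: q then E i j /\ is_chain E j q else True.

Variable D : R.
Hypotheses (D0 : 0 < D) (nD : 4 * n.+1%:R ^+ 2 <= expR (D / 2)).
Hypothesis xn0 : forall k, (k <= n)%N -> x k != 0.
Let y := log_abs.
Let e := expR (- (D / 2)).
Let f := \poly_(k < n.+1) x k.

Let e0 : 0 < e. Proof. exact: expR_gt0. Qed.

Let ne : 4 * n.+1%:R ^+ 2 * e <= 1.
Proof. by rewrite /e expRN ler_pdivrMr ?expR_gt0 // mul1r. Qed.

Let termE k t : (k <= n)%N -> `|x k| * expR t ^+ k = expR (y k + k%:R * t).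
Proof.
move=> kn; rewrite expRD expRM_natl; congr (_ * _).
by rewrite /y /log_abs lnK // posrE normr_gt0 xn0.
Qed.

Let dominates_log t i : (i <= n)%N ->
  (forall k, (k <= n)%N -> k != i -> y k + k%:R * t <= y i + i%:R * t - D / 2) ->
  term_dominates n x e (expR t) i.
Proof.
move=> iln h k kn ki; rewrite !termE // /e -expRD ler_expR.
by rewrite (addrC (- _)); exact: h.
Qed.

Let two_dominate_log t i j : (i <= n)%N -> (j <= n)%N ->
  (forall k, (k <= n)%N -> k != i -> k != j -> y k + k%:R * t <= y i + i%:R * t - D / 2)
  \/ (forall k, (k <= n)%N -> k != i -> k != j -> y k + k%:R * t <= y j + j%:R * t - D / 2) ->
  two_terms_dominate n x e (expR t) i j.
Proof.
move=> iln jn h k kn ki kj; rewrite !termE //.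
case: h => /(_ k kn ki kj) h.
  apply: (@le_trans _ _ (e * expR (y i + i%:R * t))).
    by rewrite /e -expRD ler_expR (addrC (- _)).
  by rewrite ler_pM2l // le_max lexx.
apply: (@le_trans _ _ (e * expR (y j + j%:R * t))).
  by rewrite /e -expRD ler_expR (addrC (- _)).
by rewrite ler_pM2l // le_max lexx orbT.
Qed.

Let dominated_no_root t i : (i <= n)%N ->
  (forall k, (k <= n)%N -> k != i -> y k + k%:R * t <= y i + i%:R * t - D / 2) ->
  ~~ root f (expR t).
Proof.
move=> iln h.
have := term_dominates_sg e0 ne (expR_gt0 t) iln (xn0 iln) (dominates_log iln h).
by apply: contraL => /rootP; rewrite -/f => ->; rewrite mul0r ltxx.
Qed.

(** With [t = ln z], term [k] has logarithm [y k + k t], and vertex [j] leads when [- t] lies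
    between the slopes [s' < s] of its two edges. Halfway, the far end of either edge is on one of
    the two lines and at least [D] below the other: this is why only [D / 2] is left. *)
Let next_cut j s p :
  (j <= n)%N -> is_chain (strict_edge y D) j p -> last j p = n ->
  (exists2 i, (i < j)%N & y j = y i + s * (j%:R - i%:R) /\
     forall k, (k <= n)%N -> k != i -> k != j -> y k + D <= y i + s * (k%:R - i%:R)) ->
  exists2 t', - s <= t' & forall k, (k <= n)%N -> k != j ->
     y k + k%:R * t' <= y j + j%:R * t' - D / 2.
Proof.
move=> jn; case: p => [_ /= jE|j' p /= [[jj' j'n [s' yj' h']] _] _] [i ij [yj h]].
  (* Beyond the last edge, a shift of the cut by [D] favours [j] over each [k < j] by at least
     [D]. *)
  exists (- s + D); first by move: D0; lra.
  move=> k kn kj.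
  have kj1 : (k%:R : R) + 1 <= j%:R by rewrite natr1 ler_nat ltn_neqAle kj jE.
  have : y k <= y j + s * (k%:R - j%:R).
    have [->|ki] := eqVneq k i; first by rewrite yj; lra.
    by have := h k kn ki kj; move: D0; rewrite yj; lra.
  have := ler_wpM2r (ltW D0) kj1.
  by move: D0; lra.
have jj'1 : (j%:R : R) + 1 <= j'%:R by rewrite natr1 ler_nat.
have ij1 : (i%:R : R) + 1 <= j%:R by rewrite natr1 ler_nat.
have ss' : s' < s.
  have := h j' j'n; rewrite yj' yj => h1.
  have {h1} : s' * (j'%:R - j%:R) + D <= s * (j'%:R - j%:R).
    have h2 : (j' != i) by rewrite gtn_eqF // (ltn_trans ij).
    have h3 : (j' != j) by rewrite gtn_eqF.
    by have := h1 h2 h3; lra.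
  move=> h1; have h2 : 0 < (j'%:R : R) - j%:R by lra.
  by rewrite -(ltr_pM2r h2); move: D0; lra.
exists (- ((s + s') / 2)); first by lra.
move=> k kn kj.
have hk : y k <= y j + s * (k%:R - j%:R).
  have [->|ki] := eqVneq k i; first by rewrite yj; lra.
  by have := h k kn ki kj; move: D0; rewrite yj; lra.
have hk' : y k <= y j + s' * (k%:R - j%:R).
  have [->|ki] := eqVneq k j'; first by rewrite yj'; lra.
  by have := h' k kn kj ki; move: D0; lra.
have [ki|ki] := eqVneq k i.
  have h2 : k != j' by rewrite ki ltn_eqF // (ltn_trans ij).
  by have := h' k kn kj h2; move: hk; lra.
by have := h k kn ki kj; move: hk'; rewrite yj; lra.
Qed.

Definition sign_change (i j : nat) : nat := (x i * x j < 0)%R.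

(** Induction along the chain. At the cut [t] vertex [i] leads, at the next cut [t'] vertex [j]
    does: between them only these two terms matter, and beyond [t'] the induction hypothesis
    applies. *)
Lemma chain_roots_above p i t :
  (i <= n)%N -> is_chain (strict_edge y D) i p -> last i p = n ->
  (forall k, (k <= n)%N -> k != i -> y k + k%:R * t <= y i + i%:R * t - D / 2) ->
  exists s : seq R, [/\ uniq s, forall z, (z \in s) = (expR t <= z) && root f z,
    forall z, z \in s -> f^`().[z] != 0 &
    size s = sumn (pairmap sign_change i p)].
Proof.
elim: p i t => [|j p IH] i t iln.
  move=> _ /= iE h; exists [::]; split => // z; rewrite in_nil; apply/esym/negbTE.
  rewrite negb_and -implybE; apply/implyP => tz.
  have z0 : 0 < z by exact: lt_le_trans (expR_gt0 t) tz.
  rewrite -(lnK z0); apply: (dominated_no_root iln) => k kn ki.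
  have htl : t <= ln z by rewrite -ler_expR lnK.
  have := h k kn ki.
  have : (i%:R - k%:R) * t <= (i%:R - k%:R) * ln z :> R.
    by rewrite ler_wpM2l // subr_ge0 ler_nat iE.
  by lra.
move=> /= [[ij jn [s yj h]] ch] lst hi.
have [t' st' hj] : exists2 t', - s <= t' & forall k, (k <= n)%N -> k != j ->
     y k + k%:R * t' <= y j + j%:R * t' - D / 2.
  by apply: next_cut ch lst _ => //; exists i.
have [s1 [us1 s1E s1d s1s]] := IH j t' jn ch lst hj.
have nij : i != j by rewrite ltn_eqF.
have ij1 : (i%:R : R) + 1 <= j%:R by rewrite natr1 ler_nat.
have ts : t <= - s.
  have := hi j jn; rewrite eq_sym nij => /(_ isT); rewrite yj => h1.
  have h2 : 0 < (j%:R - i%:R : R) by lra.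
  have : (j%:R - i%:R) * t <= (j%:R - i%:R) * - s by move: D0; lra.
  by rewrite ler_pM2l.
have tt' : expR t <= expR t' by rewrite ler_expR; lra.
have d2 z : expR t <= z <= expR t' -> two_terms_dominate n x e z i j.
  move=> /andP[tz zt'].
  have z0 : 0 < z by exact: lt_le_trans (expR_gt0 t) tz.
  have h1 : t <= ln z by rewrite -ler_expR lnK.
  have h2 : ln z <= t' by rewrite -ler_expR lnK.
  rewrite -(lnK z0); move: (ln z) h1 h2 => u tu ut'.
  (* Before [u = - s] term [i] is the larger of the two, after it term [j]. The other terms are
     controlled by the cut for indices on one side and by the edge for indices on the other. *)
  apply: two_dominate_log => //; case: (leP u (- s)) => us; [left|right] => k kn ki kj.
    have g1 := hi k kn ki; have g2 := h k kn ki kj.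
    case: (leqP i k) => ik.
      have : (k%:R - i%:R) * u <= (k%:R - i%:R) * - s.
        by rewrite ler_wpM2l // subr_ge0 ler_nat.
      by move: D0; lra.
    have : (i%:R - k%:R) * t <= (i%:R - k%:R) * u.
      by rewrite ler_wpM2l // subr_ge0 ler_nat ltnW.
    by lra.
  have g1 := hj k kn kj; have g2 := h k kn ki kj.
  case: (leqP j k) => jk.
    have : (k%:R - j%:R) * u <= (k%:R - j%:R) * t'.
      by rewrite ler_wpM2l // subr_ge0 ler_nat.
    by lra.
  have : (j%:R - k%:R) * - s <= (j%:R - k%:R) * u.
    by rewrite ler_wpM2l ?(ltW us) // subr_ge0 ler_nat ltnW.
  by rewrite yj; move: D0; lra.
have nr' := dominated_no_root jn hj.
case: (boolP (x i * x j < 0)) => xx.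
  have [z0 [/andP[tz0 z0t'] rz0 dz0 uz0]] :=
    edge_root_unique e0 ne ij jn xx (expR_gt0 t) tt'
      (dominates_log iln hi) (dominates_log jn hj) d2.
  exists (z0 :: s1); split.
  - by rewrite /= us1 andbT s1E negb_and -ltNge z0t'.
  - move=> z; rewrite inE s1E.
    have [->|zz0] := eqVneq z z0; first by rewrite tz0 rz0.
    case: (leP (expR t') z) => t'z /=; first by rewrite (le_trans tt' t'z).
    apply/esym/negbTE; rewrite negb_and -implybE; apply/implyP => tz.
    by apply: contra zz0 => rz; apply/eqP; apply: uz0 => //; rewrite tz ltW.
  - by move=> z; rewrite inE => /predU1P[->//|]; apply: s1d.
  - by rewrite /= s1s /sign_change xx.
exists s1; split => //; last by rewrite /= s1s /sign_change (negbTE xx).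
move=> z; rewrite s1E.
case: (leP (expR t') z) => t'z /=; first by rewrite (le_trans tt' t'z).
apply/esym/negbTE; rewrite negb_and -implybE; apply/implyP => tz.
have z0 : 0 < z by exact: lt_le_trans (expR_gt0 t) tz.
apply: (two_terms_same_sg e0 ne z0 iln jn nij _ (d2 z _)); last by rewrite tz ltW.
by rewrite lt_neqAle eq_sym mulf_neq0 ?xn0 //= leNgt.
Qed.

Lemma chain_positive_roots p : is_chain (strict_edge y D) 0 p -> last 0%N p = n ->
  exists s : seq R, [/\ uniq s, forall z, (z \in s) = (0 < z) && root f z,
    forall z, z \in s -> f^`().[z] != 0 &
    size s = sumn (pairmap sign_change 0 p)].
Proof.
move=> ch lst.
(* Far to the left the constant term leads. This is asked for all [u <= t] in order to exclude roots
   in the whole of []0, exp t[]. *)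
have [t ht] : exists t, forall u, u <= t -> forall k, (k <= n)%N -> k != 0%N ->
    y k + k%:R * u <= y 0%N + 0%:R * u - D / 2.
  case: p ch lst => [_ /= n0|j p /= [[j0 jn [s yj h]] _] _].
    by exists 0 => u _ k; rewrite -n0 leqn0 => ->.
  exists (- s - D) => u ut k kn k0; rewrite mul0r addr0.
  have k1 : 1 <= k%:R :> R by rewrite ler1n lt0n.
  have hk : y k <= y 0%N + s * k%:R.
    have [->|kj] := eqVneq k j; first by rewrite yj; lra.
    by have := h k kn k0 kj; move: D0; lra.
  have : k%:R * u <= k%:R * (- s - D) by rewrite ler_wpM2l.
  have : 1 * D <= k%:R * D by rewrite ler_pM2r.
  by move: D0; lra.
have [s [us sE sd ss]] := chain_roots_above (leq0n n) ch lst (ht t (lexx t)).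
exists s; split => // z; rewrite sE.
case: (leP (expR t) z) => tz /=; first by rewrite (lt_le_trans (expR_gt0 t) tz).
apply/esym/negbTE; rewrite negb_and -implybE; apply/implyP => z0.
rewrite -(lnK z0); apply: (dominated_no_root (leq0n n)); apply: ht.
by rewrite -ler_expR lnK // ltW.
Qed.

End ChainOfEdges.

Lemma nb_real_roots_simple (R : realType) (f : {poly R}) (s : seq R) : f != 0 ->
  uniq s -> (forall z, (z \in s) = root f z) ->
  (forall z, z \in s -> f^`().[z] != 0) -> nb_real_roots f = size s.
Proof.
move=> f0 us sE sd; rewrite /nb_real_roots.
have -> : [set z : R | root f z] = [set` s].
  by apply/seteqP; split => z /=; rewrite sE.
rewrite -fsbig_seq // (eq_big_seq (fun=> 1%N)); first by rewrite sum1_size.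
move=> z zs; apply/eqP; rewrite eqn_leq mup_leq // mup_geq //.
rewrite expr1 dvdp_XsubCl -sE zs andbT.
apply/negP => /dvdpP[q fE]; move/negP: (sd _ zs); apply.
by rewrite fE expr2 mulrA derivM derivXsubC mulr1 hornerD !hornerM !hornerXsubC subrr !mulr0 addr0.
Qed.

Lemma poly_alternate (R : realType) (n : nat) (x : nat -> R) :
  \poly_(k < n.+1) ((-1) ^+ k * x k) = (\poly_(k < n.+1) x k) \Po (- 'X).
Proof.
rewrite !poly_def raddf_sum; apply: eq_bigr => k _ /=.
rewrite comp_polyZ comp_Xn_poly (_ : (- 'X) ^+ k = (-1) ^+ k *: 'X^k :> {poly R}).
  by rewrite !scalerA mulrC.
by rewrite -scaleN1r exprZn.
Qed.

Lemma log_abs_alternate (R : realType) (x : nat -> R) :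
  log_abs (fun k => (-1) ^+ k * x k) = log_abs x.
Proof. by apply/funext => k; rewrite /log_abs normrM normrX normrN1 expr1n mul1r. Qed.

(* An edge [(i, j)] of the majorant carries the real roots of the binomial
   [x i + x j * z ^ (j - i)]: one per sign change, for [z > 0] and [z < 0]. *)
Definition edge_roots (R : realType) (x : nat -> R) (i j : nat) : nat :=
  addn (sign_change x i j) (sign_change (fun k => (-1) ^+ k * x k) i j).

Lemma sumn_pairmapD (T : Type) (f g : T -> T -> nat) i p :
  sumn (pairmap (fun a b => f a b + g a b)%N i p) =
  (sumn (pairmap f i p) + sumn (pairmap g i p))%N.
Proof. by elim: p i => //= j p IH i; rewrite IH addnACA. Qed.

(** Negative roots are positive roots of [f(- z)], whose coefficients differ from those of [f] by
    signs only; hence the same chain serves twice. Zero is not a root because [x 0 != 0]. *)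
Lemma nb_real_roots_chain (R : realType) (n : nat) (x : nat -> R) (D : R) (p : seq nat) :
  0 < D -> 4 * n.+1%:R ^+ 2 <= expR (D / 2) ->
  (forall k, (k <= n)%N -> x k != 0) ->
  is_chain (strict_edge n (log_abs x) D) 0 p -> last 0%N p = n ->
  nb_real_roots (\poly_(k < n.+1) x k) = sumn (pairmap (edge_roots x) 0 p).
Proof.
move=> D0 nD x0 ch lst; set f := \poly_(k < n.+1) x k.
have [s1 [us1 s1E s1d s1s]] := chain_positive_roots D0 nD x0 ch lst.
have x0' k : (k <= n)%N -> (-1) ^+ k * x k != 0.
  by move=> kn; rewrite mulf_neq0 ?x0 // signr_eq0.
have ch' := ch; rewrite -log_abs_alternate in ch'.
have [s2 [us2 s2E s2d s2s]] := chain_positive_roots D0 nD x0' ch' lst.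
rewrite -/f poly_alternate -/f in s1E s1d s2E s2d.
have f00 : f.[0] != 0 by rewrite horner_coef0 coef_poly x0.
have f0 : f != 0 by apply: contraNneq f00 => ->; rewrite horner0.
have rN z : root (f \Po - 'X) z = root f (- z) by rewrite /root horner_comp !hornerE.
rewrite sumn_pairmapD -s1s -s2s -(size_map -%R s2) -size_cat.
apply: nb_real_roots_simple => //.
- rewrite cat_uniq us1 (map_inj_uniq (@oppr_inj R)) us2 /= andbT.
  apply/hasPn => _ /mapP[z zs2 ->]; move: zs2; rewrite s2E s1E => /andP[z0 _].
  by rewrite oppr_gt0 ltNge (ltW z0).
- move=> z; rewrite mem_cat s1E.
  rewrite -[X in X \in [seq _ | _ <- s2]]opprK (mem_map (@oppr_inj R)) s2E rN opprK oppr_gt0.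
  have [z0|z0|->] := ltrgt0P z => //=; rewrite ?orbF //.
  by apply/esym/negbTE.
- move=> z; rewrite mem_cat => /orP[/s1d//|/mapP[u us ->]].
  have := s2d u us; rewrite deriv_comp derivN derivX hornerM horner_comp !hornerE.
  by rewrite mulrN1 oppr_eq0.
Qed.

(** * The least concave majorant as a chain *)

Definition weak_edge (R : realType) (n : nat) (y : nat -> R) (i j : nat) : Prop :=
  [/\ (i < j)%N, (j <= n)%N & exists2 s : R, y j = y i + s * (j%:R - i%:R) &
    forall k, (k <= n)%N -> y k <= y i + s * (k%:R - i%:R)].

(** Gift wrapping: from [i] go to an index [j > i] of largest slope. The edge that ends at [i] is
    carried through the induction because its slope bounds the new one, so that the new line also
    passes above the points to the left of [i]. *)
Lemma weak_chain (R : realType) (n : nat) (y : nat -> R) :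
  exists2 p, is_chain (weak_edge n y) 0 p & last 0%N p = n.
Proof.
suff H m i : (n - i <= m)%N -> (i <= n)%N ->
    (i = 0%N \/ exists h, weak_edge n y h i) ->
    exists2 p, is_chain (weak_edge n y) i p & last i p = n.
  by apply: (H n 0%N) => //; [rewrite subn0|left].
elim: m i => [|m IH] i nim iln hi.
  by exists [::] => //=; apply/eqP; rewrite eqn_leq iln -subn_eq0 -leqn0.
have [->|ni] := eqVneq i n; first by exists [::].
have {}ni : (i < n)%N by rewrite ltn_neqAle ni.
pose F (k : 'I_n.+1) : R := (y k - y i) / (k%:R - i%:R).
have [j ij jmax] := @arg_maxP _ _ 'I_n.+1 ord_max (fun k : 'I_n.+1 => (i < k)%N) F ni.
have jn : (j <= n)%N by rewrite -ltnS.
have ijp : 0 < (j%:R - i%:R : R) by rewrite subr_gt0 ltr_nat.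
have yj : y j = y i + F j * (j%:R - i%:R) by rewrite /F divfK ?gt_eqF //; lra.
have Eij : weak_edge n y i j.
  split => //; exists (F j) => // k kn.
  have [ki|ik|->] := ltngtP k i; last by rewrite subrr mulr0 addr0.
    case: hi => [i0|[h [hi _ [s yi hs]]]]; first by rewrite i0 in ki.
    have sF : F j <= s.
      have := hs j jn; rewrite yj => hj.
      have : F j * (j%:R - i%:R) <= s * (j%:R - i%:R) by rewrite yi in hj; lra.
      by rewrite ler_pM2r.
    have := hs k kn; rewrite yi => hk.
    have ik0 : 0 <= (i%:R - k%:R : R) by rewrite subr_ge0 ler_nat ltnW.
    by have := ler_wpM2r ik0 sF; lra.
  have ikp : 0 < (k%:R - i%:R : R) by rewrite subr_gt0 ltr_nat.
  have := jmax (inord k); rewrite inordK ?ltnS // => /(_ ik).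
  rewrite /F inordK ?ltnS // -/(F j) => h.
  have : y k - y i <= F j * (k%:R - i%:R) by rewrite -ler_pdivrMr.
  by lra.
have [|p ch lst] := IH j _ jn (or_intror (ex_intro _ i Eij)).
  by rewrite -ltnS (leq_trans _ nim) // ltn_sub2l.
by exists (val j :: p).
Qed.

(** * Measurability of the number of real roots *)

(** In characteristic zero each derivation lowers the order of a root by exactly one. *)
Lemma leq_mup_derivn (R : realType) (j : nat) (q : {poly R}) (x : R) : q != 0 ->
  (j <= mup x q)%N = [forall i : 'I_j, root q^`(i) x].
Proof.
elim: j q => [|j IH] q q0; first by apply/esym/forallP => -[].
have mupE (r : {poly R}) : r != 0 -> mup x r = polyorder.multiplicity x r.
  move=> r0; apply/eqP; rewrite eqn_leq mup_leq // mup_geq //.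
  by rewrite polyorder.root_muN // polyorder.root_mu.
have [rx|nrx] := boolP (root q x); last first.
  rewrite mupNroot //; apply/esym/negbTE.
  by apply: contra nrx => /forallP/(_ ord0).
have dq0 : q^`() != 0.
  apply: contraTneq rx => dq.
  have sq : (size q <= 1)%N.
    rewrite leqNgt; apply/negP => sq.
    have := congr1 (fun p : {poly R} => p`_(size q).-2) dq.
    rewrite coef_deriv coef0 => /eqP; rewrite mulrn_eq0 /= prednK ?ltn_predRL //.
    by rewrite -lead_coefE lead_coef_eq0 (negbTE q0).
  move: q0; rewrite (size1_polyC sq) => q0.
  by rewrite rootC -polyC_eq0.
rewrite mupE // -(@subnK 1 (polyorder.multiplicity _ _)) ?polyorder.mu_gt0 //.
rewrite -polyorder.mu_deriv // addn1 ltnS -mupE // IH //.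
apply/forallP/forallP => h.
  by move=> -[[|i] ij] //; have := h (Ordinal (ij : i < j)%N); rewrite -derivSn.
by move=> i; rewrite -derivSn; exact: h (Ordinal (ltn_ord i : (i.+1 < j.+1)%N)).
Qed.

Definition has_multiple_root (R : realType) (q : {poly R}) (a b : R) (j : nat) : Prop :=
  exists2 x, a <= x <= b & forall i, (i < j)%N -> q^`(i).[x] = 0.

(** The sum of the [|q^(i)|] is continuous and nonnegative, so that it vanishes somewhere on the
    compact interval as soon as its infimum over the rational points is zero. An uncountable union
    over real points is thus replaced by countable operations. *)
Lemma has_multiple_rootP (R : realType) (q : {poly R}) (a b : rat) (j : nat) :
  a < b -> has_multiple_root q (ratr a) (ratr b) j <->
  forall k : nat, exists2 r : rat, a <= r <= b &
    \sum_(i < j) `|q^`(i).[ratr r]| < k.+1%:R^-1 :> R.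
Proof.
move=> ab; pose phi (x : R) : R := \sum_(i < j) `|q^`(i).[x]|.
have cphi : continuous phi.
  move=> x; rewrite /phi; elim: (index_enum _) => [|i s IH].
    rewrite /continuous_at; under eq_fun do rewrite big_nil.
    by rewrite big_nil; exact: cvg_cst.
  rewrite /continuous_at; under eq_fun do rewrite big_cons.
  rewrite big_cons; apply: cvgD => //.
  by apply: cvg_norm; exact: continuous_horner.
have abR : (ratr a : R) < ratr b by rewrite ltr_rat.
split.
  move=> [x /andP[ax xb] hx] k.
  have phix : phi x = 0 by rewrite /phi big1 // => i _; rewrite hx // normr0.
  have k0 : 0 < k.+1%:R^-1 :> R by rewrite invr_gt0.
  have := cphi x => /cvgrPdist_lt /(_ _ k0); rewrite phix /=.
  move=> [e /= e0 he].
  have [r] : exists r : rat, ratr r \in `](Num.max (ratr a) (x - e)), (Num.min (ratr b) (x + e))[.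
    apply: rat_in_itvoo; rewrite gt_max !lt_min abR /=.
    by apply/and3P; split; move: ax xb abR e0; lra.
  rewrite in_itv /= gt_max lt_min => /andP[/andP[ar xr] /andP[rb rx]].
  exists r; first by move: ar rb; rewrite !ltr_rat => ar rb; rewrite !ltW.
  have := he (ratr r); rewrite /ball_ /= sub0r normrN => h.
  apply: le_lt_trans (ler_norm _) _; apply: h.
  by rewrite ltr_norml; apply/andP; split; lra.
move=> h.
have [c cab hc] := @EVT_min R phi _ _ (ltW abR) (continuous_subspaceT cphi).
exists c; first by rewrite in_itv in cab.
suff phic : phi c = 0.
  have : \sum_(i < j) `|q^`(i).[c]| == 0 by apply/eqP.
  rewrite psumr_eq0 => [/allP hi i ij|i _]; last exact: normr_ge0.
  have := hi (Ordinal ij); rewrite mem_index_enum => /(_ isT) /= /eqP.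
  exact: normr0_eq0.
apply/eqP; rewrite eq_le sumr_ge0 // andbT leNgt; apply/negP => c0.
have [k _ kc] : exists2 k : nat, true & k.+1%:R^-1 < phi c.
  exists (Num.truncn (phi c)^-1) => //.
  rewrite invf_plt ?posrE //; exact: truncnS_gt.
have [r rab hr] := h k.
have := hc (ratr r); rewrite in_itv /= !ler_rat => /(_ rab) h2.
by have := lt_trans (le_lt_trans h2 hr) kc; rewrite ltxx.
Qed.

(* A certificate for [m <= nb_real_roots q]: separated rational intervals,
   each with a multiplicity to be found inside. *)
Definition separated (l : seq (rat * rat * nat)) : bool :=
  all (fun u => u.1.1 < u.1.2) l &&
  pairwise (fun u v => (u.1.2 < v.1.1) || (v.1.2 < u.1.1)) l.

Lemma nb_real_rootsE (R : realType) (q : {poly R}) : q != 0 ->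
  exists rs : seq R, [/\ uniq rs, forall x, (x \in rs) = root q x &
    nb_real_roots q = \sum_(x <- rs) mup x q].
Proof.
move=> q0; exists (polyrcf.rootsR q); split.
- exact: polyrcf.uniq_roots.
- by move=> x; have := polyrcf.roots_on_rootsR q0 x; rewrite in_itv.
- rewrite /nb_real_roots (_ : [set x | root q x] = [set` polyrcf.rootsR q]).
    by rewrite -fsbig_seq // polyrcf.uniq_roots.
  by apply/seteqP; split => x /=; have := polyrcf.roots_on_rootsR q0 x; rewrite in_itv /= => ->.
Qed.

Lemma separating_radius (R : realType) (rs : seq R) : uniq rs ->
  exists2 e : R, 0 < e & forall x y, x \in rs -> y \in rs -> x != y -> 2 * e < `|x - y|.
Proof.
elim: rs => [|z rs IH] /=; first by exists 1.
case/andP => zrs /IH[e e0 he].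
have [d d0 hd] : exists2 d : R, 0 < d & forall y, y \in rs -> 2 * d < `|z - y|.
  elim: rs zrs {IH he} => [_|y rs IH]; first by exists 1.
  rewrite inE negb_or => /andP[zy /IH[d d0 hd]].
  have zy0 : 0 < `|z - y| by rewrite normr_gt0 subr_eq0.
  exists (Num.min d (`|z - y| / 4)); first by rewrite lt_min d0 divr_gt0.
  have m1 : Num.min d (`|z - y| / 4) <= d by rewrite ge_min lexx.
  have m2 : Num.min d (`|z - y| / 4) <= `|z - y| / 4 by rewrite ge_min lexx orbT.
  move=> u; rewrite inE => /predU1P[->|/hd]; last by move: m1; lra.
  by move: m2; lra.
have m1 : Num.min e d <= e by rewrite ge_min lexx.
have m2 : Num.min e d <= d by rewrite ge_min lexx orbT.
exists (Num.min e d); first by rewrite lt_min e0.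
move=> x y; rewrite !inE => /predU1P[->|xs] /predU1P[->|ys].
- by rewrite eqxx.
- by move=> _; have := hd y ys; move: m2; lra.
- by move=> _; have := hd x xs; rewrite distrC; move: m2; lra.
- by move=> /(he _ _ xs ys); move: m1; lra.
Qed.

(** Points in separated intervals are distinct, so that their multiplicities add up; conversely,
    short rational intervals around the roots form a certificate. Certificates are countably many,
    which is what measurability requires. *)
Lemma leq_nb_real_roots (R : realType) (q : {poly R}) (m : nat) : q != 0 ->
  (m <= nb_real_roots q)%N <->
  exists l, [/\ separated l, (m <= \sum_(u <- l) u.2)%N &
    forall u, u \in l -> has_multiple_root q (ratr u.1.1) (ratr u.1.2) u.2].
Proof.
move=> q0; have [rs [urs rsE ->]] := nb_real_rootsE q0; split; last first.
  move=> [l [/andP[lall ldis] ml lroot]]; apply: leq_trans ml _.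
  pose F (u : rat * rat * nat) := xget (0 : R) [set x | (ratr u.1.1 <= x <= ratr u.1.2) /\
       forall i, (i < u.2)%N -> q^`(i).[x] = 0].
  have FP u : u \in l -> (ratr u.1.1 <= F u <= ratr u.1.2) /\
       forall i, (i < u.2)%N -> q^`(i).[F u] = 0.
    by move=> /lroot[x h1 h2]; rewrite /F; case: xgetP => [y ->//|/(_ x)[]].
  have uF : uniq (map F l).
    elim: l ldis FP {lall lroot} => //= u l IH /andP[ul ldis] FP.
    rewrite IH ?andbT => [|//|v vl]; last by apply: FP; rewrite inE vl orbT.
    apply/mapP => -[v vl Fuv]; move/allP: ul => /(_ v vl).
    have [/andP[h1 h2] _] := FP u (mem_head _ _).
    have [|/andP[h3 h4] _] := FP v; first by rewrite inE vl orbT.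
    rewrite -(@ltr_rat R) -(@ltr_rat R v.1.2) => /orP[]; rewrite ltNge => /negP; apply.
      by rewrite (le_trans h3) // -Fuv.
    by rewrite (le_trans h1) // Fuv.
  apply: (@leq_trans (\sum_(x <- map F l) mup x q)).
    rewrite big_map big_seq [leqRHS]big_seq; apply: leq_sum => u ul.
    rewrite leq_mup_derivn //; apply/forallP => i.
    by apply/rootP; have [_] := FP u ul; apply.
  (* Where the certificate asks for multiplicity 0 the chosen point need not be a root; such points
     contribute nothing. *)
  rewrite (bigID (fun x => root q x)) /= [X in (_ + X)%N]big1 ?addn0; last first.
    by move=> x nx; rewrite mupNroot.
  rewrite -big_filter; apply: uniq_sub_le_big => //.
  - by move=> x y; rewrite leq_addr.
  - by rewrite filter_uniq.
  - by move=> x; rewrite mem_filter rsE => /andP[].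
move=> mN; have [e e0 he] := separating_radius urs.
have near (x : R) : {u : rat * rat * nat | [/\ x - e < ratr u.1.1, ratr u.1.1 < x,
    x < ratr u.1.2 & ratr u.1.2 < x + e] & u.2 = mup x q}.
  apply: cid2.
  have [|a] := @rat_in_itvoo R (x - e) x; first by move: e0; lra.
  have [|b] := @rat_in_itvoo R x (x + e); first by move: e0; lra.
  by rewrite !in_itv /= => /andP[h1 h2] /andP[h3 h4]; exists (a, b, mup x q).
exists [seq s2val (near x) | x <- rs]; split.
- apply/andP; split.
    apply/allP => _ /mapP[x xs ->]; case: (near x) => u [] /= h1 h2 h3 h4 _.
    by rewrite -(ltr_rat R) (lt_trans h2).
  rewrite pairwise_map; elim: rs urs he {rsE mN} => //= x rs IH /andP[xrs urs] he.
  rewrite IH // ?andbT => [|y z ys zs]; last by apply: he; rewrite inE ?ys ?zs orbT.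
  apply/allP => y ys.
  have xy : x != y by apply: contraNneq xrs => ->.
  have := he x y; rewrite !inE eqxx ys orbT => /(_ isT isT xy) /=.
  case: (near x) => u [] /= h1 h2 h3 h4 _; case: (near y) => v [] /= g1 g2 g3 g4 _.
  rewrite -(ltr_rat R) -[X in _ || X](ltr_rat R).
  case: (ltP x y) => cxy; [rewrite ltr0_norm|rewrite ger0_norm]; rewrite ?subr_lt0 ?subr_ge0 // => h.
    by apply/orP; left; lra.
  by apply/orP; right; lra.
- by rewrite big_map; under eq_bigr do rewrite (s2valP' (near _)).
- move=> _ /mapP[x xs ->]; case: (near x) => u [] /= h1 h2 h3 h4 u2.
  exists x; first by rewrite !ltW.
  move=> i; rewrite u2 => iu.
  have := leq_mup_derivn (mup x q) x q0; rewrite leqnn => /esym/forallP/(_ (Ordinal iu)).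
  by move/rootP.
Qed.

Lemma measurable_fun_natr d (T : measurableType d) (R : realType) (N : T -> nat) :
  (forall m, measurable [set w | (m <= N w)%N]) ->
  measurable_fun [set: T] (fun w => (N w)%:R : R).
Proof.
move=> h _ B mB; rewrite setTI.
have -> : (fun w => (N w)%:R : R) @^-1` B =
    \bigcup_m ((if `[< B m%:R >] then setT else set0) `&`
      ([set w | (m <= N w)%N] `\` [set w | (m.+1 <= N w)%N])).
  apply/seteqP; split => w /=.
    move=> Bw; exists (N w) => //=; rewrite asboolT //; split => //.
    by split => //=; apply/negP; rewrite ltnn.
  move=> [m _ /= [+ [h1 /negP h2]]]; case: asboolP => // Bm _.
  by have -> : N w = m by apply/eqP; rewrite eqn_leq h1 leqNgt h2.
apply: bigcup_measurable => m _; apply: measurableI; first by case: ifP.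
exact: measurableD.
Qed.

Lemma countType_bigcup_measurable d (T : measurableType d) (I : countType)
    (P : set I) (F : I -> set T) :
  (forall i, measurable (F i)) -> measurable (\bigcup_(i in P) F i).
Proof.
move=> mF; rewrite bigcup_mkcond; apply: countable_bigcupT_measurable => //.
by move=> i; case: ifP.
Qed.

(** The event that the count is at least [m + 1] is a countable union over certificates. The zero
    polynomial, for which every separated list would be a certificate, is set apart: its count is 0
    by convention. *)
Lemma measurable_nb_real_roots d (T : measurableType d) (R : realType) (n : nat)
    (x : nat -> T -> R) :
  (forall k, measurable_fun [set: T] (x k)) ->
  measurable_fun [set: T]
    (fun w => (nb_real_roots (\poly_(k < n.+1) x k w))%:R : R).
Proof.
move=> mx; apply: measurable_fun_natr => m.
pose q w : {poly R} := \poly_(k < n.+1) x k w.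
have derivE i w r : (q w)^`(i).[r] = \sum_(k < n.+1) x k w * ('X^k : {poly R})^`(i).[r].
  rewrite /q poly_def linear_sum horner_sum; apply: eq_bigr => k _ /=.
  by rewrite derivnZ hornerZ.
have mder i r : measurable_fun [set: T] (fun w => (q w)^`(i).[r]).
  under eq_fun do rewrite derivE.
  by apply: measurable_sum => k; apply: measurable_funM => //; exact: measurable_cst.
have q0E : [set w | q w = 0] = \bigcap_(k in [set k | (k <= n)%N]) (x k @^-1` [set 0]).
  apply/seteqP; split => w /=.
    by move=> qw k /= kn; have := congr1 (fun p : {poly R} => p`_k) qw; rewrite coef_poly ltnS kn coef0.
  move=> h; apply/polyP => k; rewrite coef_poly coef0; case: ifP => // kn.
  by apply: h; rewrite /= -ltnS.
have mq0 : measurable [set w | q w = 0].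
  rewrite q0E; apply: bigcap_measurable => [|k _]; first by exists 0%N.
  by rewrite -[X in measurable X]setTI; apply: mx => //; exact: measurable_set1.
case: m => [|m]; first by rewrite (_ : [set _ | _] = setT) //; apply/seteqP.
pose hasroot (u : rat * rat * nat) := \bigcap_(k : nat) \bigcup_(r in [set r : rat | u.1.1 <= r <= u.1.2])
  [set w | \sum_(i < u.2) `|(q w)^`(i).[ratr r]| < k.+1%:R^-1].
have mhas u : measurable (hasroot u).
  apply: bigcap_measurable => [|k _]; first by exists 0%N.
  apply: countType_bigcup_measurable => r.
  rewrite -[X in measurable X]setTI.
  have -> : [set w | \sum_(i < u.2) `|(q w)^`(i).[ratr r]| < k.+1%:R^-1] =
     (fun w => \sum_(i < u.2) `|(q w)^`(i).[ratr r]|) @^-1` `]-oo, k.+1%:R^-1[.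
    by apply/seteqP; split => w /=; rewrite in_itv.
  have : measurable_fun [set: T] (fun w => \sum_(i < u.2) `|(q w)^`(i).[ratr r]|).
    by apply: measurable_sum => i; apply: measurableT_comp => //; exact: mder.
  by apply => //; exact: measurable_itv.
rewrite (_ : [set _ | _] = [set w | q w <> 0] `&`
  \bigcup_(l in [set l | separated l /\ (m.+1 <= \sum_(u <- l) u.2)%N])
     \big[setI/setT]_(u <- l) hasroot u).
  apply: measurableI.
    by rewrite (_ : [set w | q w <> 0] = ~` [set w | q w = 0]) //; exact: measurableC.
  by apply: countType_bigcup_measurable => l; apply: bigsetI_measurable.
have nz w : (m < nb_real_roots (q w))%N -> q w <> 0.
  move=> + qw; rewrite qw /nb_real_roots fsbig1 // => z _.
  rewrite /mup; move: (arg_max _ _ _) => a; have := ltn_ord a.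
  by rewrite [X in (_ < X.+1)%N]size_poly0 ltnS leqn0 => /eqP.
apply/seteqP; split => w /=.
  move=> h; have qw := nz _ h; split => //.
  have q0 : q w != 0 by exact/eqP.
  have [l [sl ml hl]] := (leq_nb_real_roots m.+1 q0).1 h.
  exists l => //; rewrite -bigcap_seq => u /= ul k _.
  move/andP: sl => [/allP/(_ _ ul) uu _].
  have [r h1 h2] := (has_multiple_rootP _ _ uu).1 (hl _ ul) k.
  by exists r.
move=> [/eqP qw [l [sl ml]]]; rewrite -bigcap_seq => hl.
apply/(leq_nb_real_roots m.+1 qw); exists l; split => // u ul.
move/andP: sl => [/allP/(_ _ ul) uu _].
apply/(has_multiple_rootP _ _ uu) => k; have [r h1 h2] := hl _ ul k I.
by exists r.
Qed.

(** * Regularly varying tails *)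

Section RegularVariation.
Variables (R : realType) (alpha : R).
Hypothesis alpha01 : 0 < alpha < 1.

Let alpha0 : 0 < alpha. Proof. by case/andP: alpha01. Qed.

Let alpha1 : alpha < 1. Proof. by case/andP: alpha01. Qed.

Lemma powR2_lt (u v : R) : u < v -> (2 : R) `^ u < 2 `^ v.
Proof.
move=> uv; rewrite /powR gt_eqF // ltr_expR ltr_pM2r // ln_gt0 //.
by rewrite ltr1n.
Qed.

Lemma powRN_le (x y : R) : 0 < x -> x <= y -> y `^ (- alpha) <= x `^ (- alpha).
Proof.
move=> x0 xy; have y0 : 0 < y by exact: lt_le_trans xy.
rewrite !powRN lef_pV2 ?posrE ?powR_gt0 //.
by apply: ge0_ler_powR => //; rewrite ?nnegrE; exact: ltW.
Qed.

Lemma powRN_near (t e : R) : 0 < t -> 0 < e ->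
  exists2 l : R, 1 < l & (t * l) `^ (- alpha) > t `^ (- alpha) - e /\
                        (t / l) `^ (- alpha) < t `^ (- alpha) + e.
Proof.
move=> t0 e0.
have : {for t, continuous (fun x => x `^ (- alpha))}.
  apply: differentiable_continuous; apply/derivable1_diffP.
  by have [] := is_derive1_powR (- alpha) t0.
move=> /cvgrPdist_lt /(_ _ e0) [d /= d0 hd].
pose l := 1 + Num.min (d / (2 * t)) 1.
have m0 : 0 < Num.min (d / (2 * t)) 1 by rewrite lt_min ltr01 divr_gt0 ?mulr_gt0.
have l1 : 1 < l by rewrite /l; lra.
have ml : t * Num.min (d / (2 * t)) 1 < d.
  apply: (@le_lt_trans _ _ (t * (d / (2 * t)))).
    by rewrite ler_pM2l // ge_min lexx.
  have -> : t * (d / (2 * t)) = d / 2 by field; rewrite gt_eqF.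
  by lra.
exists l => //; split.
  have := hd (t * l); rewrite /ball_ /= => h.
  suff : `|t `^ (- alpha) - (t * l) `^ (- alpha)| < e by rewrite ltr_norml; lra.
  apply: h; rewrite /l mulrDr mulr1 opprD addNKr normrN gtr0_norm ?mulr_gt0 //.
have := hd (t / l); rewrite /ball_ /= => h.
suff : `|t `^ (- alpha) - (t / l) `^ (- alpha)| < e by rewrite ltr_norml; lra.
apply: h; have l0 : 0 < l by lra.
have tl : t / l <= t by rewrite ler_pdivrMr // ler_peMr ?ltW.
rewrite ger0_norm ?subr_ge0 //.
apply: le_lt_trans ml; rewrite lerBlDr -lerBlDl ler_pdivlMr //.
have -> : l = 1 + Num.min (d / (2 * t)) 1 by [].
move: (Num.min _ _) m0 => m m0.
have : 0 <= t * m ^+ 2 by rewrite mulr_ge0 ?ltW // exprn_gt0.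
by lra.
Qed.

(** With [v = w / x] and [alpha < 1], the power [(1 + v)^(- alpha)] is at least the inverse of
    [1 + v], hence at least [1 - v]. The bound depends on [x] through [b] only. *)
Lemma powRN_window (b x w : R) : 0 < b -> b <= x -> 0 < w ->
  x `^ (- alpha) - (x + w) `^ (- alpha) <= b `^ (- alpha) * (w / b).
Proof.
move=> b0 bx w0; have x0 : 0 < x by exact: lt_le_trans bx.
have xw : x + w = x * (1 + w / x) by field; rewrite gt_eqF.
have wx0 : 0 < w / x by rewrite divr_gt0.
have h0 : 0 <= 1 + w / x by move: wx0; lra.
rewrite xw powRM ?(ltW x0) // -[X in X - _]mulr1 -mulrBr.
have xb : x `^ (- alpha) <= b `^ (- alpha) by exact: powRN_le.
have h1 : 1 - (1 + w / x) `^ (- alpha) <= w / x.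
  have : (1 + w / x)^-1 <= (1 + w / x) `^ (- alpha).
    rewrite -(powR_inv1 h0); apply: ler_powR; first by move: wx0; lra.
    by move: alpha1; lra.
  have : 1 - w / x <= (1 + w / x)^-1.
    rewrite -[leRHS]mul1r ler_pdivlMr ?addr_gt0 //.
    have : 0 <= (w / x) ^+ 2 by rewrite exprn_ge0 // ltW.
    by lra.
  by lra.
have h2 : w / x <= w / b by rewrite ler_pM2l // lef_pV2 ?posrE.
apply: le_trans (_ : x `^ (- alpha) * (w / b) <= _).
  by rewrite ler_wpM2l ?powR_ge0 // (le_trans h1).
by rewrite ler_wpM2r // ltW // divr_gt0.
Qed.

Lemma powRN_small (e : R) : 0 < e -> exists2 t : R, 0 < t & t `^ (- alpha) <= e.
Proof.
move=> e0; exists (e `^ (- alpha^-1)); first by rewrite powR_gt0.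
rewrite -powRrM mulrN mulNr opprK mulVf ?gt_eqF // powRr1 //; exact: ltW.
Qed.

(** The product [k k^(- alpha) = k^(1 - alpha)] tends to 0 with [k]; this makes the neighbourhoods
    of the two ends harmless. *)
Lemma powRN_steep (C e : R) : 0 < C -> 0 < e ->
  exists2 k : R, 0 < k < 1 & C * k * k `^ (- alpha) <= e.
Proof.
move=> C0 e0; pose g := 1 - alpha; have g0 : 0 < g by rewrite subr_gt0.
pose k := Num.min (2^-1) ((e / C) `^ (g^-1)).
have k0 : 0 < k by rewrite lt_min invr_gt0 ltr0n powR_gt0 // divr_gt0.
exists k.
  rewrite k0 /=; apply: (@le_lt_trans _ _ (2^-1)); first by rewrite ge_min lexx.
  by lra.
rewrite -mulrA -{1}(powRr1 (ltW k0)) -powRD ?gt_eqF ?implybT //.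
rewrite mulrC -ler_pdivlMr // -/g.
have eC0 : 0 <= e / C by rewrite ltW // divr_gt0.
have -> : e / C = ((e / C) `^ g^-1) `^ g by rewrite -powRrM mulVf ?gt_eqF // powRr1.
apply: ge0_ler_powR; rewrite ?nnegrE ?powR_ge0 ?(ltW g0) ?(ltW k0) //.
by rewrite ge_min lexx orbT.
Qed.

Variable F : R -> R.
Hypotheses (F0 : forall t, 0 < F t) (Fni : forall s t, s <= t -> F t <= F s).
Hypothesis Frv : forall l, 0 < l -> F (l * t) / F t @[t --> +oo] --> l `^ (- alpha).

(** The ratio [F (2 t) / F t] tends to [2^(- alpha)], which exceeds [1 / rho]. With [rho < 2] the
    quantities [2^J F(2^J r)] then grow geometrically, and a sum of tails is dominated by its last
    dyadic block. *)
Lemma rv_doubling (rho : R) : 2 `^ alpha < rho ->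
  exists2 X : R, 0 < X & forall t, X <= t -> F t <= rho * F (2 * t).
Proof.
move=> hrho; have p0 : 0 < (2 : R) `^ alpha by rewrite powR_gt0.
have rho0 : 0 < rho by exact: lt_trans hrho.
have h : rho^-1 < 2 `^ (- alpha) by rewrite powRN ltf_pV2 ?posrE.
have e0 : 0 < 2 `^ (- alpha) - rho^-1 by rewrite subr_gt0.
have := Frv (ltr0Sn R 1); move=> /cvgrPdist_lt /(_ _ e0) [X [_ hX]].
exists (Num.max (X + 1) 1); first by rewrite lt_max ltr01 orbT.
move=> t; rewrite ge_max => /andP[Xt t1].
have Xt' : X < t by lra.
have := hX t Xt'; rewrite /= ltr_norml => /andP[_ h1].
have : rho^-1 <= F (2 * t) / F t by lra.
by rewrite ler_pdivlMr // mulrC -ler_pdivlMr ?invr_gt0 // invrK mulrC.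
Qed.

Lemma rv_vanishes (e : R) : 0 < e -> exists2 t : R, 0 < t & F t <= e.
Proof.
(* Any ratio strictly between [2^(- alpha)] and 1 would do. *)
move=> e0; pose r : R := (1 + 2 `^ (- alpha)) / 2.
have h2 : (2 : R) `^ (- alpha) < 1.
  by rewrite -[ltRHS](@powRr0 _ 2) powR2_lt // oppr_lt0.
have p0 : 0 < (2 : R) `^ (- alpha) by rewrite powR_gt0.
have d0 : 0 < r - 2 `^ (- alpha) by rewrite /r; lra.
have := Frv (ltr0Sn R 1); move=> /cvgrPdist_lt /(_ _ d0) [X [_ hX]].
pose Y := Num.max (X + 1) 1; have Y1 : 1 <= Y by rewrite le_max lexx orbT.
have XY : X < Y by rewrite lt_max; apply/orP; left; lra.
have step t : Y <= t -> F (2 * t) <= r * F t.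
  move=> Yt; have := hX t (lt_le_trans XY Yt); rewrite /= ltr_norml => /andP[h1 _].
  by rewrite -ler_pdivrMr //; lra.
have it i : F (2 ^+ i * Y) <= r ^+ i * F Y.
  elim: i => [|i IH]; first by rewrite !expr0 !mul1r.
  rewrite exprS -mulrA; apply: le_trans (step _ _) _.
    by rewrite ler_peMl ?exprn_ege1 ?ler1n // ltW // (lt_le_trans ltr01).
  by rewrite exprS -mulrA ler_pM2l // /r; lra.
have r01 : `|r| < 1 by rewrite ger0_norm /r; lra.
have := cvg_expr r01 => /cvgrPdist_lt /(_ (e / F Y)) [|N _ hN]; first by rewrite divr_gt0.
exists (2 ^+ N * Y); first by rewrite mulr_gt0 ?exprn_gt0 // (lt_le_trans ltr01).
apply: le_trans (it N) _; have := hN N (leqnn N); rewrite /= sub0r normrN => h.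
by rewrite -ler_pdivlMr // ltW // (le_lt_trans (ler_norm _) h).
Qed.

(** As [F] may jump, [F (a n)] need not equal [1 / n]; what remains are bounds at points strictly
    beyond or strictly before [a n]. *)
Definition tail_quantile (n : nat) : R :=
  inf [set t | 0 <= t /\ F t <= n%:R^-1].

Let a := tail_quantile.

Let level_has_inf n : (0 < n)%N -> has_inf [set t | 0 <= t /\ F t <= n%:R^-1].
Proof.
move=> n0; split.
  have [|t t0 ht] := @rv_vanishes n%:R^-1; first by rewrite invr_gt0 ltr0n.
  by exists t; split => //; exact: ltW.
by exists 0 => t [].
Qed.

Lemma tail_quantile_above n t : (0 < n)%N -> a n < t -> F t <= n%:R^-1.
Proof.
move=> n0 hat; have := level_has_inf n0 => hi.
have e0 : 0 < t - a n by rewrite subr_gt0.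
have [s [s0 hs] st] := inf_adherent e0 hi.
by apply: le_trans hs; apply: Fni; rewrite ltW //; move: st; rewrite -/(a n); lra.
Qed.

Lemma tail_quantile_below n t : (0 < n)%N -> 0 <= t -> t < a n -> n%:R^-1 < F t.
Proof.
move=> n0 t0 ta; rewrite ltNge; apply/negP => h.
have := ge_inf (level_has_inf n0).2 (conj t0 h).
by rewrite -/(tail_quantile n) -/(a n) leNgt ta.
Qed.

Lemma tail_quantile_cvgy : a n @[n --> \oo] --> +oo.
Proof.
apply/cvgryPge => K.
have : (n%:R : R) @[n --> \oo] --> +oo by exact: cvgr_idn.
move=> /cvgryPgt /(_ (F K)^-1) h; near=> n.
have nF : (F K)^-1 < n%:R by near: n.
have n0 : (0 < n)%N by rewrite -(ltr0n R) (lt_trans _ nF) // invr_gt0.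
have [ne _] := level_has_inf n0.
apply: lb_le_inf => // t [t0 ht]; rewrite leNgt; apply/negP => tK.
have := Fni (ltW tK); rewrite leNgt => /negP; apply.
apply: le_lt_trans ht _; rewrite invf_plt ?posrE ?ltr0n //.
Unshelve. all: by end_near.
Qed.

(** For [l > 1], [1 / n] lies between [F (l a n)] and [F (a n / l)], so that [n F (t a n)] lies
    between two ratios of tails. These tend to the powers of [t l] and [t / l], which are close to
    that of [t] when [l] is close to 1. *)
Lemma tail_quantile_rv t : 0 < t -> n%:R * F (t * a n) @[n --> \oo] --> t `^ (- alpha).
Proof.
move=> t0; apply/cvgrPdist_lt => e e0.
have e20 : 0 < e / 2 by lra.
have [l l1 [hl1 hl2]] := powRN_near t0 e20.
have l0 : 0 < l by lra.
have ay := tail_quantile_cvgy.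
have scale m : 0 < m -> m * a n @[n --> \oo] --> +oo.
  move=> m0; apply/cvgryPge => A; move/cvgryPge : ay => /(_ (A / m)).
  by apply: filterS => n; rewrite ler_pdivrMr // mulrC.
have al : l^-1 * a n @[n --> \oo] --> +oo by apply: scale; rewrite invr_gt0.
have al' : l * a n @[n --> \oo] --> +oo by exact: scale.
have tl0 : 0 < t * l by rewrite mulr_gt0.
have tl'0 : 0 < t / l by rewrite divr_gt0.
have /cvgrPdist_lt /(_ _ e20) c1 := cvg_comp _ _ al (Frv tl0).
have /cvgrPdist_lt /(_ _ e20) c2 := cvg_comp _ _ al' (Frv tl'0).
near=> n.
have n0 : (0 < n)%N by near: n; exists 1%N.
have n0R : 0 < n%:R :> R by rewrite ltr0n.
have an0 : 0 < a n by near: n; move/cvgryPgt : ay; apply.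
have d1 : `|(t * l) `^ (- alpha) - F (t * l * (l^-1 * a n)) / F (l^-1 * a n)| < e / 2.
  by near: n; exact: c1.
have d2 : `|(t / l) `^ (- alpha) - F (t / l * (l * a n)) / F (l * a n)| < e / 2.
  by near: n; exact: c2.
have E1 : t * l * (l^-1 * a n) = t * a n by field; rewrite gt_eqF.
have E2 : t / l * (l * a n) = t * a n by field; rewrite gt_eqF.
rewrite E1 in d1; rewrite E2 in d2.
have g1 : n%:R^-1 < F (l^-1 * a n).
  apply: tail_quantile_below => //; first by rewrite mulr_ge0 ?invr_ge0 // ltW.
  by rewrite gtr_pMl // invf_lt1.
have g2 : F (l * a n) <= n%:R^-1.
  by apply: tail_quantile_above => //; rewrite ltr_pMl.
have k1 : F (t * a n) / F (l^-1 * a n) <= n%:R * F (t * a n).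
  rewrite mulrC ler_pM2r // -[leRHS]invrK lef_pV2 ?posrE ?invr_gt0 //; exact: ltW.
have k2 : n%:R * F (t * a n) <= F (t * a n) / F (l * a n).
  by rewrite mulrC ler_pM2l // -[leLHS]invrK lef_pV2 ?posrE ?invr_gt0.
move: d1 d2; rewrite !ltr_norml => /andP[d11 d12] /andP[d21 d22].
by apply/andP; split; lra.
Unshelve. all: by end_near.
Qed.

(** The constant [C = rho / (2 - rho)] is the solution of [(C + 1) rho = 2 C], which is what lets
    the bound pass from [J] to [J + 1]. *)
Lemma rv_dyadic_sum (rho X : R) : rho < 2 -> 0 < X ->
  (forall t, X <= t -> F t <= rho * F (2 * t)) ->
  forall J r, X <= r ->
  \sum_(1 <= k < 2 ^ J) F (r * k%:R) <= rho / (2 - rho) * (2 ^ J)%:R * F (r * (2 ^ J)%:R).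
Proof.
move=> rho2 X0 hX J r Xr; have r0 : 0 < r by exact: lt_le_trans Xr.
have rho0 : 0 < rho.
  have h1 := F0 r; have h2 := F0 (2 * r); have := hX r Xr => h3.
  by rewrite -(pmulr_lgt0 _ h2) (lt_le_trans h1).
have d0 : 0 < 2 - rho by lra.
set C := rho / (2 - rho); have C0 : 0 < C by rewrite divr_gt0.
have CE : (C + 1) * rho = 2 * C by rewrite /C; field; rewrite gt_eqF.
elim: J => [|J IH].
  by rewrite expn0 big_geq // mulr1 mulr_ge0 // ltW.
have J1 : (1 <= 2 ^ J)%N by rewrite expn_gt0.
rewrite (@big_cat_nat _ _ _ (2 ^ J)) //=; last by rewrite leq_exp2l.
have h1 : \sum_(2 ^ J <= k < 2 ^ J.+1) F (r * k%:R) <= (2 ^ J)%:R * F (r * (2 ^ J)%:R).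
  rewrite big_nat; apply: (@le_trans _ _ (\sum_(2 ^ J <= k < 2 ^ J.+1 | (2 ^ J <= k < 2 ^ J.+1)%N) F (r * (2 ^ J)%:R))).
    apply: ler_sum => k /andP[k1 k2]; apply: Fni.
    by rewrite ler_pM2l // ler_nat.
  rewrite -big_nat sumr_const_nat expnS mul2n -addnn addnK mulr_natl //.
have h2 : F (r * (2 ^ J)%:R) <= rho * F (r * (2 ^ J.+1)%:R).
  rewrite expnS natrM mulrCA; apply: hX; apply: le_trans Xr _.
  by rewrite ler_peMr ?(ltW r0) // ler1n.
have P0 : 0 < (2 ^ J)%:R :> R by rewrite ltr0n.
have h3 : (2 ^ J)%:R * F (r * (2 ^ J)%:R) <= (2 ^ J)%:R * (rho * F (r * (2 ^ J.+1)%:R)).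
  by rewrite ler_pM2l.
have h4 : (C + 1) * ((2 ^ J)%:R * F (r * (2 ^ J)%:R)) <=
    (C + 1) * ((2 ^ J)%:R * (rho * F (r * (2 ^ J.+1)%:R))).
  by rewrite ler_pM2l //; lra.
apply: le_trans (_ : (C + 1) * ((2 ^ J)%:R * F (r * (2 ^ J)%:R)) <= _).
  by rewrite mulrDl mul1r; apply: lerD => //; rewrite mulrA.
apply: le_trans h4 _; rewrite le_eqVlt; apply/orP; left; apply/eqP.
rewrite [RHS](_ : _ = (2 * C) * ((2 ^ J)%:R * F (r * (2 ^ J.+1)%:R))).
  by rewrite -CE; ring.
by rewrite expnS natrM; ring.
Qed.

(** The midpoint of [alpha] and 1; any exponent strictly between them gives a doubling constant
    larger than [2^alpha] and smaller than 2. *)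
Definition potter_exponent : R := (1 + alpha) / 2.
Definition potter_const : R := 2 `^ potter_exponent.

Let pe0 : 0 < potter_exponent. Proof. by rewrite /potter_exponent; move: alpha0; lra. Qed.

Let pe1 : potter_exponent < 1. Proof. by rewrite /potter_exponent; move: alpha1; lra. Qed.

Lemma potter_const_lt2 : potter_const < 2.
Proof. by rewrite -[ltRHS]powRr1 // powR2_lt. Qed.

Let potter_X : exists2 X : R, 0 < X & forall t, X <= t -> F t <= potter_const * F (2 * t).
Proof. by apply: rv_doubling; apply: powR2_lt; rewrite /potter_exponent; move: alpha1; lra. Qed.

(** One half of Potter's bounds: [X] is doubled until it exceeds [t], each doubling costing a factor
    [potter_const]. *)
Lemma rv_power_bound : exists2 cX : R * R, 0 < cX.1 /\ 0 < cX.2 &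
  forall t, cX.2 <= t -> cX.1 * t `^ (- potter_exponent) <= F t.
Proof.
have [X X0 hX] := potter_X.
set rho := potter_const in hX; have rho0 : 0 < rho by rewrite powR_gt0.
have it i : F X <= rho ^+ i * F (2 ^+ i * X).
  elim: i => [|i IH]; first by rewrite !expr0 !mul1r.
  apply: le_trans IH _; rewrite exprSr -mulrA ler_pM2l ?exprn_gt0 // exprS -mulrA.
  by apply: hX; rewrite ler_peMl ?(ltW X0) // exprn_ege1 // ler1n.
exists (F X / rho * X `^ potter_exponent, X) => /=.
  by split; rewrite // mulr_gt0 ?divr_gt0 ?powR_gt0.
move=> t Xt; have t0 : 0 < t by exact: lt_le_trans Xt.
have tX1 : 1 <= t / X by rewrite ler_pdivlMr // mul1r.
have tX0 : 0 <= t / X by rewrite ltW // divr_gt0.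
pose m := Num.truncn (t / X).
have m0 : (0 < m)%N by rewrite truncn_gt0.
have /andP[mt tm] : m%:R <= t / X < m.+1%:R by exact: truncn_itv.
pose i := trunc_log 2 m.
have i1 : (2 : R) ^+ i <= t / X.
  by apply: le_trans mt; rewrite -natrX ler_nat trunc_logP.
have i2 : t / X < (2 : R) ^+ i.+1.
  by apply: lt_le_trans tm _; rewrite -natrX ler_nat trunc_log_ltn.
have h1 : F (2 ^+ i.+1 * X) <= F t by apply: Fni; rewrite ltW // -ltr_pdivrMr.
have h2 := it i.+1.
have h3 : rho ^+ i <= (t / X) `^ potter_exponent.
  rewrite /rho /potter_const -powR_mulrn ?powR_ge0 // -powRrM mulrC powRrM.
  rewrite powR_mulrn //; apply: ge0_ler_powR; rewrite ?nnegrE ?(ltW pe0) ?exprn_ge0 //.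
have h4 : F X <= rho * (t / X) `^ potter_exponent * F t.
  apply: le_trans h2 _; rewrite exprS; apply: ler_pM => //.
  - by rewrite mulr_ge0 ?exprn_ge0 // ltW.
  - by rewrite ltW.
  - by rewrite ler_pM2l.
have tXE : (t / X) `^ potter_exponent = t `^ potter_exponent / X `^ potter_exponent.
  rewrite powRM ?(ltW t0) ?invr_ge0 ?(ltW X0) //; congr (_ * _).
  by rewrite -powR_inv1 ?(ltW X0) // -powRrM mulN1r powRN.
have tp : 0 < t `^ potter_exponent by rewrite powR_gt0.
have Xp : 0 < X `^ potter_exponent by rewrite powR_gt0.
rewrite powRN ler_pdivrMr // mulrAC ler_pdivrMr // .
move: h4; rewrite tXE => h4.
have : F X * X `^ potter_exponent <=
  rho * (t `^ potter_exponent / X `^ potter_exponent) * F t * X `^ potter_exponent.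
  by rewrite ler_pM2r.
move/le_trans; apply; rewrite le_eqVlt; apply/orP; left; apply/eqP.
by field; rewrite gt_eqF.
Qed.

(** The power bound is inverted at [2 a n], a point strictly beyond [a n], where the tail is at most
    [1 / n]. The exponent is positive because [potter_exponent < 1]. *)
Lemma tail_quantile_growth : exists2 c : R, 0 < c &
  \forall n \near \oo, c * n%:R `^ (potter_exponent^-1 - 1) <= a n / n%:R.
Proof.
have [[c X] /= [c0 X0] hc] := rv_power_bound.
exists (c `^ potter_exponent^-1 / 2); first by rewrite divr_gt0 ?powR_gt0.
have ay := tail_quantile_cvgy; near=> n.
have n0 : (0 < n)%N by near: n; exists 1%N.
have n0R : 0 < n%:R :> R by rewrite ltr0n.
have Xa : X <= a n by near: n; move/cvgryPge : ay; apply.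
have a0 : 0 < a n by exact: lt_le_trans Xa.
have h1 : F (2 * a n) <= n%:R^-1.
  by apply: tail_quantile_above => //; rewrite -/(a n); lra.
have := hc (2 * a n); have -> : X <= 2 * a n by lra.
move=> /(_ isT) h2; have h3 := le_trans h2 h1.
have p2 : 0 < (2 * a n) `^ potter_exponent by rewrite powR_gt0 // mulr_gt0.
have h4 : c * n%:R <= (2 * a n) `^ potter_exponent.
  by move: h3; rewrite powRN ler_pdivrMr // mulrC ler_pdivlMr // .
have h5 : (c * n%:R) `^ potter_exponent^-1 <= 2 * a n.
  have -> : 2 * a n = ((2 * a n) `^ potter_exponent) `^ potter_exponent^-1.
    by rewrite -powRrM mulfV ?lt0r_neq0 // powRr1 // mulr_ge0 // ltW.
  apply: ge0_ler_powR; rewrite ?nnegrE ?invr_ge0 ?(ltW pe0) ?powR_ge0 //.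
  by rewrite mulr_ge0 // ltW.
have h6 : n%:R `^ (potter_exponent^-1 - 1) = n%:R `^ potter_exponent^-1 / n%:R :> R.
  by rewrite powRB ?powRr1 // (lt0r_neq0 n0R) implybT.
move: h5; rewrite powRM ?(ltW c0) ?ler0n // h6 mulrA ler_pM2r ?invr_gt0 // => h5.
by move: h5; lra.
Unshelve. all: by end_near.
Qed.

Let gamma0 : 0 < potter_exponent^-1 - 1.
Proof. by rewrite subr_gt0 invf_gt1 ?pe1 // pe0. Qed.

Lemma near_powR_large (g Z : R) : 0 < g -> \forall n \near \oo, Z <= n%:R `^ g.
Proof.
move=> g0; pose Y := Num.max Z 1.
have Y0 : 0 < Y by rewrite lt_max ltr01 orbT.
have /cvgryPge /(_ (Y `^ g^-1)) : (n%:R : R) @[n --> \oo] --> +oo by exact: cvgr_idn.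
apply: filterS => n hn; apply: (@le_trans _ _ Y); first by rewrite le_max lexx.
have -> : Y = (Y `^ g^-1) `^ g.
  by rewrite -powRrM mulVf ?lt0r_neq0 // powRr1 // ltW.
by apply: ge0_ler_powR => //; rewrite ?nnegrE ?(ltW g0) ?powR_ge0.
Qed.

Lemma tail_quantile_slope_large (K : R) : \forall n \near \oo, K <= a n / n%:R.
Proof.
have [c c0 hc] := tail_quantile_growth.
have h := near_powR_large (K / c) gamma0; near=> n.
have h1 : c * n%:R `^ (potter_exponent^-1 - 1) <= a n / n%:R by near: n.
apply: le_trans h1; rewrite mulrC -ler_pdivrMr //.
by near: n.
Unshelve. all: by end_near.
Qed.

(** [a n / n] is at least of order [n^g], whereas [ln n] is at most of order [n^(g / 2)]; the
    constant [L] collects [ln 16], from [4 (n + 1)^2 <= 16 n^2], and the constant of the second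
    comparison. *)
Lemma tail_quantile_slope_exp (d : R) : 0 < d ->
  \forall n \near \oo, 4 * n.+1%:R ^+ 2 <= expR (d * (a n / n%:R)).
Proof.
move=> d0; have [c c0 hc] := tail_quantile_growth.
set g := potter_exponent^-1 - 1 in hc; have g0 : 0 < g by exact: gamma0.
pose L : R := ln (16 : R) + 4 / g.
have h := @near_powR_large (g / 2) (Num.max 1 (L / (d * c))) (divr_gt0 g0 (ltr0Sn R 1)).
near=> n.
have n0 : (0 < n)%N by near: n; exists 1%N.
have n0R : 0 < n%:R :> R by rewrite ltr0n.
have h1 : c * n%:R `^ g <= a n / n%:R by near: n.
have : Num.max 1 (L / (d * c)) <= n%:R `^ (g / 2) by near: n.
set z := n%:R `^ (g / 2); rewrite ge_max => /andP[z1 zL].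
have zz : n%:R `^ g = z * z.
  rewrite -powRD ?(lt0r_neq0 n0R) ?implybT //.
  by congr (_ `^ _); lra.
have h2 : 4 * n.+1%:R ^+ 2 <= expR (ln (16 : R) + 2 * ln n%:R).
  rewrite expRD lnK ?posrE // (expRM_natl 2) lnK ?posrE //.
  have n1R : 1 <= n%:R :> R by rewrite ler1n.
  have : (n.+1%:R : R) <= 2 * n%:R by rewrite -natr1; lra.
  have : 0 <= (n.+1%:R : R) by [].
  move: (n.+1%:R : R) (n%:R : R) => u v u0 uv.
  have : u ^+ 2 <= (2 * v) ^+ 2 by rewrite lerXn2r ?nnegrE // (le_trans u0).
  by lra.
apply: le_trans h2 _; rewrite ler_expR.
have z0 : 0 < z by lra.
have h3 : g / 2 * ln n%:R <= z by rewrite -ln_powR ltW // ln_sublinear.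
have h4 : 2 * ln n%:R <= 4 / g * z.
  rewrite mulrAC ler_pdivlMr //; move: h3; lra.
have h5 : L * z <= d * c * (z * z).
  have : L <= d * c * z by move: zL; rewrite ler_pdivrMr ?mulr_gt0 // mulrC.
  by rewrite mulrA => /(ler_wpM2r (ltW z0)).
have h6 : d * (c * n%:R `^ g) <= d * (a n / n%:R) by rewrite ler_pM2l.
have l0 : 0 <= ln (16 : R) by rewrite ln_ge0 // ler1n.
have h7 : ln (16 : R) <= ln 16 * z by rewrite ler_peMr.
apply: le_trans h6; rewrite zz mulrA; apply: le_trans h5.
by rewrite /L mulrDl; lra.
Unshelve. all: by end_near.
Qed.

(** The sum is the expected number of indices below [kappa n] whose points lie above the line of
    slope [eta a n / n]. For a power of two between [kappa n] and [2 kappa n], the dyadic bound is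
    at most a constant times [2 kappa n F (eta kappa a n)], whose limit is the quantity assumed
    small. *)
Lemma rv_start_sum (eta kappa e : R) : 0 < eta -> 0 < kappa ->
  potter_const / (2 - potter_const) * (2 * kappa) * (eta * kappa) `^ (- alpha) < e ->
  \forall n \near \oo,
    \sum_(1 <= k < n | k%:R < kappa * n%:R) F (eta * (a n / n%:R) * k%:R) <= e.
Proof.
move=> eta0 k0 he; have [X X0 hX] := potter_X.
have rho2 := potter_const_lt2; set rho := potter_const in hX he rho2 *.
have rho0 : 0 < rho by rewrite powR_gt0.
have C0 : 0 < rho / (2 - rho) by rewrite divr_gt0 // subr_gt0.
have ek0 : 0 < eta * kappa by rewrite mulr_gt0.
have hs := tail_quantile_slope_large (X / eta).
have hq := tail_quantile_rv ek0.
have hq' : \forall n \near \oo, rho / (2 - rho) * (2 * kappa) *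
    (n%:R * F (eta * kappa * a n)) < e.
  apply: (@cvgr_lt _ _ _ _ _ (rho / (2 - rho) * (2 * kappa) * (eta * kappa) `^ (- alpha))) => //.
  exact: cvgMr.
have hn : \forall n \near \oo, kappa^-1 <= n%:R :> R.
  by move/cvgryPge : (@cvgr_idn R); apply.
near=> n.
have n1 : 1 <= kappa * n%:R by rewrite mulrC -ler_pdivrMr // div1r; near: n.
have n0R : 0 < n%:R :> R by rewrite -(pmulr_rgt0 _ k0); lra.
have hr : X / eta <= a n / n%:R by near: n.
set r := eta * (a n / n%:R).
have Xr : X <= r by rewrite /r mulrC -ler_pdivrMr.
have r0 : 0 < r by exact: lt_le_trans Xr.
pose m := Num.truncn (kappa * n%:R).
have m0 : (0 < m)%N by rewrite truncn_gt0.
have /andP[mk km] : m%:R <= kappa * n%:R < m.+1%:R by apply: truncn_itv; lra.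
pose J := (trunc_log 2 m).+1.
have J1 : (2 ^ J)%:R <= 2 * (kappa * n%:R).
  apply: (@le_trans _ _ (2 * m%:R)); last by rewrite ler_pM2l.
  by rewrite -natrM ler_nat /J expnS leq_mul2l /= trunc_logP.
have J2 : (m < 2 ^ J)%N by rewrite trunc_log_ltn.
have J3 : kappa * n%:R <= (2 ^ J)%:R by apply: (le_trans (ltW km)); rewrite ler_nat.
apply: (@le_trans _ _ (\sum_(1 <= k < 2 ^ J) F (r * k%:R))).
  rewrite (big_nat_widen _ _ _ _ _ (leq_maxl n (2 ^ J))).
  rewrite [leRHS](big_nat_widen _ _ _ _ _ (leq_maxr n (2 ^ J))).
  rewrite big_mkcond [leRHS]big_mkcond; apply: ler_sum => k _ /=.
  case: ifP => [/andP[kn _]|_]; last by case: ifP => // _; exact: ltW.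
  by rewrite ifT // -(ltr_nat R) (lt_le_trans kn).
apply: le_trans (rv_dyadic_sum rho2 X0 hX J Xr) _.
apply: (@le_trans _ _ (rho / (2 - rho) * (2 * (kappa * n%:R)) * F (eta * kappa * a n))).
  apply: ler_pM; [exact: mulr_ge0 (ltW C0) _|exact: ltW|by rewrite ler_pM2l|].
  apply: Fni.
  have -> : eta * kappa * a n = r * (kappa * n%:R) by rewrite /r; field; rewrite gt_eqF.
  by rewrite ler_pM2l.
have hqn : rho / (2 - rho) * (2 * kappa) * (n%:R * F (eta * kappa * a n)) < e.
  by near: n; exact: hq'.
apply: ltW; apply: le_lt_trans hqn.
by rewrite le_eqVlt; apply/orP; left; apply/eqP; ring.
Unshelve. all: by end_near.
Qed.

(** Uniformity in [x] comes from a grid of step [w]: a window of width [3 w] starting anywhere is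
    covered by four steps, and beyond the last grid point the whole tail is small. *)
Lemma rv_window (b e w : R) : 0 < b -> 0 < e -> 0 < w ->
  b `^ (- alpha) * (4 * w / b) < e ->
  \forall n \near \oo, forall x, b <= x ->
    n%:R * (F (x * a n) - F ((x + 3 * w) * a n)) <= e.
Proof.
move=> b0 e0 w0 hw; have [H H0 hH] := @powRN_small (e / 2) (divr_gt0 e0 (ltr0Sn R 1)).
pose q := Num.truncn (H / w); pose g (i : nat) := b + i%:R * w.
have g0 i : 0 < g i by rewrite /g ltr_pwDl // mulr_ge0 // ltW.
have gH : g q.+1 `^ (- alpha) <= e / 2.
  apply: le_trans hH; apply: powRN_le => //.
  have : H / w <= q.+1%:R by rewrite ltW // truncnS_gt.
  by rewrite ler_pdivrMr // /g; move: b0; lra.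
have c1 (i : 'I_q.+2) : \forall n \near \oo,
    n%:R * F (g i * a n) - n%:R * F (g (i + 4)%N * a n) < e.
  apply: (@cvgr_lt _ _ _ _ _ (g i `^ (- alpha) - g (i + 4)%N `^ (- alpha))).
    by apply: cvgB; exact: tail_quantile_rv.
  apply: le_lt_trans hw; have -> : g (i + 4)%N = g i + 4 * w by rewrite /g natrD; ring.
  by apply: powRN_window; rewrite ?mulr_gt0 // /g lerDl mulr_ge0 // ltW.
have c1' := @filter_forall _ _ _ _ _ c1.
have c2 : \forall n \near \oo, n%:R * F (g q.+1 * a n) < e.
  apply: (@cvgr_lt _ _ _ _ _ (g q.+1 `^ (- alpha))); first exact: tail_quantile_rv.
  by move: gH e0; lra.
have ay := tail_quantile_cvgy; near=> n => x bx.
have an0 : 0 < a n by near: n; move/cvgryPgt : ay; apply.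
pose i := Num.truncn ((x - b) / w).
have i0 : 0 <= (x - b) / w by rewrite divr_ge0 ?subr_ge0 // ltW.
have /andP[i1 i2] := truncn_itv i0.
rewrite -/i ler_pdivlMr // in i1; rewrite -/i ltr_pdivrMr // -natr1 in i2.
have gx : g i <= x by rewrite /g; lra.
have [iq|iq] := ltnP i q.+2.
  have h : forall i : 'I_q.+2, n%:R * F (g i * a n) - n%:R * F (g (i + 4)%N * a n) < e.
    by near: n; exact: c1'.
  apply: (@le_trans _ _ (n%:R * F (g i * a n) - n%:R * F (g (i + 4)%N * a n))); last first.
    by apply: ltW; exact: h (Ordinal iq).
  rewrite -mulrBr ler_wpM2l // lerB //; apply: Fni; rewrite ler_pM2r //.
  by rewrite /g natrD; lra.
apply: (@le_trans _ _ (n%:R * F (g q.+1 * a n))); last by apply: ltW; near: n.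
rewrite ler_wpM2l // -[leRHS]subr0 lerB ?(ltW (F0 _)) //; apply: Fni; rewrite ler_pM2r //.
apply: le_trans gx; rewrite /g lerD2l ler_pM2r // ler_nat; exact: ltnW.
Unshelve. all: by end_near.
Qed.

End RegularVariation.

(** * Rounding to a finite grid *)

(** Twice the signed area of the triangle: when [u1 < u2], it is negative exactly if the third point
    is below the line through the first two. *)
Definition orient (R : pzRingType) (u1 v1 u2 v2 u3 v3 : R) : R :=
  (u2 - u1) * (v3 - v1) - (v2 - v1) * (u3 - u1).

(* Column, level, parity of the index and positivity of the coefficient. *)
Definition node (M L : nat) : finType := ('I_M.+1 * 'I_L * bool * bool)%type.

Section Nodes.
Variables (R : realType) (M L : nat) (eta : R).
Implicit Types (a b c : node M L) (Z : {set node M L}).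

Definition node_col a : nat := a.1.1.1.
Definition node_lev a : nat := a.1.1.2.
Definition node_odd a : bool := a.1.2.
Definition node_pos a : bool := a.2.

Definition node_u a : R := (node_col a)%:R / M%:R.
Definition node_v a : R := (node_lev a)%:R * eta.

Definition node_orient a b c : R :=
  orient (node_u a) (node_v a) (node_u b) (node_v b) (node_u c) (node_v c).

Definition pattern_edge Z : rel (node M L) := fun a b =>
  [&& (node_col a < node_col b)%N &
    [forall c in Z, (c != a) && (c != b) ==> (node_orient a b c < 0)]] && (b \in Z).

Definition node_roots a b : nat :=
  ((node_pos a != node_pos b) +
   (node_pos a (+) node_odd a != node_pos b (+) node_odd b))%N.

(** A relation, since a set of nodes need not contain a path from column 0 to column [M]; in that
    case [pattern_roots] takes the default value 0. *)
Definition pattern_value Z (m : nat) : Prop :=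
  exists a p, [/\ a \in Z, node_col a = 0%N, path (pattern_edge Z) a p,
    node_col (last a p) = M & m = sumn (pairmap node_roots a p)].

Definition pattern_roots Z : nat := xget 0%N [set m | pattern_value Z m].

(** The orientation changes sign when [b] and [c] are exchanged, so that neither can be strictly
    below the line through [a] and the other while the converse holds too. *)
Lemma pattern_edge_functional Z a b c : a \in Z ->
  pattern_edge Z a b -> pattern_edge Z a c -> b = c.
Proof.
move=> aZ /andP[/andP[ab /forallP hb] bZ] /andP[/andP[ac /forallP hc] cZ].
apply/eqP/negPn/negP => bc.
have ca : c != a by apply: contraTneq ac => ->; rewrite ltnn.
have ba : b != a by apply: contraTneq ab => ->; rewrite ltnn.
have := hb c; rewrite cZ ca eq_sym bc /= => h1.
have := hc b; rewrite bZ ba bc /= => h2.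
by move: h1 h2; rewrite /node_orient /orient; lra.
Qed.

Lemma pattern_path_unique Z a p q : a \in Z ->
  path (pattern_edge Z) a p -> path (pattern_edge Z) a q ->
  node_col (last a p) = M -> node_col (last a q) = M -> p = q.
Proof.
have sink c d : node_col c = M -> ~~ pattern_edge Z c d.
  move=> cM; rewrite /pattern_edge cM; apply/negP => /andP[/andP[h _] _].
  by have := ltn_ord d.1.1.1; rewrite ltnS leqNgt -/(node_col d) h.
elim: p a q => [|b p IH] a [|c q] //= aZ.
- by move=> _ /andP[h _] aM; rewrite (negbTE (sink _ _ aM)) in h.
- by move=> /andP[h _] _ _ aM; rewrite (negbTE (sink _ _ aM)) in h.
move=> /andP[ab pp] /andP[ac pq] lp lq.
have bc := pattern_edge_functional aZ ab ac; rewrite -bc in pq lq *.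
have bZ : b \in Z by case/andP: ab.
by rewrite (IH _ _ bZ pp pq lp lq).
Qed.

Lemma pattern_rootsE Z m :
  (forall a b, a \in Z -> b \in Z -> node_col a = 0%N -> node_col b = 0%N -> a = b) ->
  pattern_value Z m -> pattern_roots Z = m.
Proof.
move=> uZ hm; apply: xget_unique => // m' [b [q [bZ b0 pq lq ->]]].
move: hm => [a [p [aZ a0 pp lp ->]]].
have ab := uZ _ _ aZ bZ a0 b0; rewrite -ab in pq lq *.
by rewrite (pattern_path_unique aZ pp pq lp lq).
Qed.

Variables (lb n : nat) (A : R).

(* Interior columns are blocks of the even length [2 * column_half], so that each of them
   contains as many even as odd indices. *)
Definition column_half : nat := (n %/ (2 * M))%N.

Definition column (k : nat) : nat :=
  if k == 0%N then 0%N else if k == n then M else (k %/ (2 * column_half))%N.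

(** The two end coefficients are negligible on the scale [A] and get level 0. An interior index has
    no class if its coefficient is low, or if it lies in the first block or after the last full one;
    hence the interior classes use the columns 1 to [M - 1] only. *)
Definition level (k : nat) (a : node M L) (r : R) : bool :=
  if (k == 0%N) || (k == n) then node_lev a == 0%N else
  [&& (2 * column_half <= k < 2 * column_half * M)%N, (lb <= node_lev a)%N &
     (node_lev a)%:R * eta * A < ln `|r| <= (node_lev a).+1%:R * eta * A].

Definition in_class (k : nat) (a : node M L) (r : R) : bool :=
  [&& node_odd a == odd k, node_pos a == (0 < r), node_col a == column k & level k a r].

Definition pattern (x : nat -> R) : {set node M L} :=
  [set a | [exists k : 'I_n.+1, in_class k a (x k)]].

Lemma in_class_unique k a a' r : 0 < eta -> 0 < A ->
  in_class k a r -> in_class k a' r -> a = a'.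
Proof.
move=> eta0 A0; case: a => [[[c l] o] p]; case: a' => [[[c' l'] o'] p'].
rewrite /in_class /node_odd /node_pos /node_col /=.
move=> /and4P[/eqP-> /eqP-> /eqP hc hl] /and4P[/eqP-> /eqP-> /eqP hc' hl'].
have -> : c = c' by apply/val_inj; rewrite /= hc hc'.
suff -> : l = l' by [].
apply/val_inj; move: hl hl'; rewrite /level /node_lev /=.
case: ifP => _; first by move=> /eqP-> /eqP->.
move=> /and3P[_ _ /andP[h1 h2]] /and3P[_ _ /andP[h3 h4]].
have eA : 0 < eta * A by rewrite mulr_gt0.
have g1 : (l < l'.+1)%N by rewrite -(ltr_nat R) -(ltr_pM2r eA) !mulrA (lt_le_trans h1 h4).
have g2 : (l' < l.+1)%N by rewrite -(ltr_nat R) -(ltr_pM2r eA) !mulrA (lt_le_trans h3 h2).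
by apply/eqP; rewrite eqn_leq; apply/andP.
Qed.

End Nodes.

(** In the bilinear expansion, errors in [u] are paired with differences of [v], at most [h], and
    errors in [v] with differences of [U], at most 1. *)
Lemma orient_perturbation (R : realFieldType) (d e h u1 v1 u2 v2 u3 v3 U1 V1 U2 V2 U3 V3 : R) :
  0 <= h ->
  `|u1 - U1| <= d -> `|u2 - U2| <= d -> `|u3 - U3| <= d ->
  `|v1 - V1| <= e -> `|v2 - V2| <= e -> `|v3 - V3| <= e ->
  0 <= U1 <= 1 -> 0 <= U2 <= 1 -> 0 <= U3 <= 1 ->
  `|v3 - v1| <= h -> `|v2 - v1| <= h ->
  `|orient u1 v1 u2 v2 u3 v3 - orient U1 V1 U2 V2 U3 V3| <= 4 * d * h + 4 * e.
Proof.
move=> h0 du1 du2 du3 dv1 dv2 dv3 hU1 hU2 hU3 hv3 hv2.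
have -> : orient u1 v1 u2 v2 u3 v3 - orient U1 V1 U2 V2 U3 V3 =
  ((u2 - U2) - (u1 - U1)) * (v3 - v1) + (U2 - U1) * ((v3 - V3) - (v1 - V1))
  - ((v2 - v1) * ((u3 - U3) - (u1 - U1)) + ((v2 - V2) - (v1 - V1)) * (U3 - U1)).
  by rewrite /orient; ring.
have hB (p q r s : R) : `|p| <= r -> `|q| <= s -> `|p * q| <= r * s.
  by move=> hp hq; rewrite normrM ler_pM.
have hD (p q r s : R) : `|p| <= r -> `|q| <= s -> `|p - q| <= r + s.
  by move=> hp hq; rewrite (le_trans (ler_normB _ _)) // lerD.
have hU (p q : R) : 0 <= p <= 1 -> 0 <= q <= 1 -> `|p - q| <= 1.
  by move=> /andP[? ?] /andP[? ?]; rewrite ler_norml; apply/andP; split; lra.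
have t1 := hB _ _ _ _ (hD _ _ _ _ du2 du1) hv3.
have t2 := hB _ _ _ _ (hU _ _ hU2 hU1) (hD _ _ _ _ dv3 dv1).
have t3 := hB _ _ _ _ hv2 (hD _ _ _ _ du3 du1).
have t4 := hB _ _ _ _ (hD _ _ _ _ dv2 dv1) (hU _ _ hU3 hU1).
have -> : 4 * d * h + 4 * e = ((d + d) * h + 1 * (e + e)) + (h * (d + d) + (e + e) * 1) by ring.
apply: hD; apply: le_trans (ler_normD _ _) _; exact: lerD.
Qed.

Lemma grid_level (R : realType) (y s : R) (i j : nat) : 0 < s ->
  i%:R * s < y -> y <= j%:R * s ->
  exists2 l : nat, (i <= l < j)%N & l%:R * s < y <= l.+1%:R * s.
Proof.
move=> s0; elim: j => [|j IH] iy yj.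
  have := lt_le_trans iy yj; rewrite mul0r ltNge mulr_ge0 // ltW //.
have [jy|jy] := ltP (j%:R * s) y.
  exists j; last by rewrite jy yj.
  by rewrite ltnSn andbT -ltnS -(ltr_nat R) -(ltr_pM2r s0) (lt_le_trans iy).
have [l /andP[il lj] hl] := IH iy jy.
by exists l => //; rewrite il ltnW.
Qed.

(** * Good configurations, on which the grid pattern determines the number of roots *)

Section GoodConfiguration.
Variables (R : realType) (M L lb n : nat) (eta A D h kappa lambda delta : R).
Variable x : nat -> R.

Let y := log_abs x.
Let s := A / n%:R.
Let b := lb%:R * eta.
Let u (k : nat) : R := k%:R / n%:R.
Let v (k : nat) : R := y k / A.

Notation in_cls := (@in_class R M L eta lb n A).
Notation nodeu := (@node_u R M L).
Notation nodev := (@node_v R M L eta).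

(* The grid has [M] columns and [L] levels of height [eta]; the heights above [lb * eta] are the
   relevant ones, [lambda] separates the relevant columns, [delta] is the margin in the
   orientation of triples of nodes, and [D] the resulting domination gap. *)
Record good_scale : Prop := GoodScale {
  gs_eta : 0 < eta;
  gs_A : 0 < A;
  gs_n : (0 < n)%N;
  gs_M : (0 < M)%N;
  gs_L : (0 < L)%N;
  gs_h : 0 < h;
  gs_kappa : 0 < kappa < 1;
  gs_b : b = h / 2 * kappa;
  gs_lambda : 0 < lambda <= kappa;
  gs_delta : 0 < delta;
  gs_M2 : 4 / M%:R <= lambda;
  gs_nM : 2 * M%:R ^+ 2 <= n%:R :> R;
  gs_nM2 : 2 * M%:R <= kappa * n%:R;
  gs_end : h / 4 / n%:R <= eta;
  gs_pert : 4 * (M%:R^-1) * ((L%:R + 1) * eta) + 4 * eta <= delta / 2;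
  gs_D0 : 0 < D;
  gs_D1 : D <= h / 4 * s;
  gs_D2 : D <= delta / 2 * A;
  gs_nD : 4 * n.+1%:R ^+ 2 <= expR (D / 2)
}.

(** With [s = A / n], the two ends near 0 and a point above [h A] force the majorant above a tent of
    slope [h s], while [gc_left] and [gc_right] keep the points near the ends under cones of half
    this slope. [gc_sep] and [gc_generic] let the remaining points be rounded without changing their
    relative position. *)
Record good_configuration : Prop := GoodConfiguration {
  gc_nz : forall k, (k <= n)%N -> x k != 0;
  gc_ends : `|y 0%N| <= h / 4 * s /\ `|y n| <= h / 4 * s;
  gc_high : exists2 k, (0 < k < n)%N & h * A < y k;
  gc_left : forall k, (0 < k < n)%N -> k%:R < kappa * n%:R -> y k <= h / 2 * s * k%:R;
  gc_right : forall k, (0 < k < n)%N -> (n - k)%:R < kappa * n%:R ->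
    y k <= h / 2 * s * (n - k)%:R;
  gc_top : forall k, (0 < k < n)%N -> y k <= L%:R * eta * A;
  gc_sep : forall i j, (0 < i)%N -> (i < j < n)%N -> b * A < y i -> b * A < y j ->
    lambda * n%:R <= (j - i)%:R;
  gc_generic : forall i j k a1 a2 a3, (i < j)%N -> (j < k)%N -> (k <= n)%N ->
    in_cls i a1 (x i) -> in_cls j a2 (x j) -> in_cls k a3 (x k) ->
    lambda / 2 <= nodeu a3 - nodeu a1 -> delta <= `|node_orient eta a1 a2 a3|
}.

Hypotheses (gs : good_scale) (gc : good_configuration).

Let A0 := gs_A gs.
Let n0 := gs_n gs.
Let M0 := gs_M gs.
Let eta0 := gs_eta gs.
Let h0 := gs_h gs.
Let n0R : 0 < n%:R :> R. Proof. by rewrite ltr0n n0. Qed.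

Let M0R : 0 < M%:R :> R. Proof. by rewrite ltr0n M0. Qed.

Let s0 : 0 < s. Proof. by rewrite divr_gt0 ?A0 ?n0R. Qed.

Let As : A = s * n%:R. Proof. by rewrite /s divfK // gt_eqF // n0R. Qed.

(** These indices contain all the vertices of the majorant, and are sparse enough for the columns to
    tell them apart. *)
Definition peak (k : nat) : Prop := (k <= n)%N /\ (k = 0%N \/ k = n \/ b * A < y k).

(** As [b = h / 2 kappa], the cones reach the height [b A] exactly at distance [kappa n] from the
    ends. *)
Lemma peak_middle k : (0 < k < n)%N -> b * A < y k ->
  kappa * n%:R <= k%:R /\ kappa * n%:R <= (n - k)%:R.
Proof.
move=> kn yk; have bA : b * A = h / 2 * s * (kappa * n%:R).
  by rewrite (gs_b gs) As; ring.
have hs0 : 0 < h / 2 * s by rewrite mulr_gt0 ?divr_gt0 ?h0 ?s0.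
split; rewrite leNgt; apply/negP => kk.
  have := gc_left gc kn kk; rewrite leNgt => /negP; apply.
  by apply: lt_trans yk; rewrite bA ltr_pM2l.
have := gc_right gc kn kk; rewrite leNgt => /negP; apply.
by apply: lt_trans yk; rewrite bA ltr_pM2l.
Qed.

Let halfle : (2 * column_half M n * M <= n)%N.
Proof. by rewrite /column_half mulnAC mulnC leq_divM. Qed.

Let halfgt : (n < 2 * column_half M n * M + 2 * M)%N.
Proof.
rewrite /column_half mulnAC [X in (_ < X + _)%N]mulnC {1}(divn_eq n (2 * M)) ltn_add2l.
by rewrite ltn_mod muln_gt0 M0.
Qed.

Let half0 : (0 < column_half M n)%N.
Proof.
rewrite divn_gt0 ?muln_gt0 ?M0 // -(ler_nat R) natrM.
apply: le_trans (gs_nM gs); rewrite ler_pM2l // expr2 ler_peMl ?ler1n ?M0 //.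
Qed.

Let class_exists k : peak k -> exists a, in_cls k a (x k).
Proof.
case: (gs) => _ _ _ _ L0 _ _ _ _ _ _ _ nM2 _ _ _ _ _ _.
move=> [kn hk].
have [k0|k0] := posnP k.
  exists (ord0, Ordinal L0, odd k, 0 < x k); rewrite /in_class /level !eqxx /=.
  by rewrite /node_col /node_lev /column k0.
have [kn'|kn'] := eqVneq k n.
  exists (inord M, Ordinal L0, odd k, 0 < x k); rewrite /in_class /level !eqxx /=.
  by rewrite /node_col /node_lev /column kn' eqxx /= inordK // (negbTE (lt0n_neq0 n0)) orbT eqxx.
have {}kn' : (k < n)%N by rewrite ltn_neqAle kn'.
have yk : b * A < y k.
  by case: hk => [k1|[k1|//]]; [rewrite k1 in k0|rewrite k1 ltnn in kn'].
have k0n : (0 < k < n)%N by rewrite k0.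
have [m1 m2] := peak_middle k0n yk.
(* The first block has length at most [n / M], so that it ends before [kappa n]. *)
have c1 : (2 * column_half M n <= k)%N.
  rewrite -(ler_nat R); apply: le_trans m1.
  have : ((2 * column_half M n * M)%:R : R) <= n%:R by rewrite ler_nat halfle.
  rewrite natrM => h1.
  have : (2 * column_half M n)%:R <= n%:R / M%:R :> R by rewrite ler_pdivlMr.
  move=> /le_trans; apply; rewrite mulrC ler_pM2r //.
  have := gs_M2 gs; have := gs_lambda gs => /andP[l0 lk].
  have : (M%:R^-1 : R) > 0 by rewrite invr_gt0.
  by lra.
(* The last full block ends less than [2 M <= kappa n] before [n]. *)
have c2 : (k < 2 * column_half M n * M)%N.
  have : (n < 2 * column_half M n * M + (n - k))%N.
    apply: leq_trans halfgt _; rewrite leq_add2l -(ler_nat R) natrM.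
    exact: le_trans nM2 m2.
  by rewrite -{1}(subnK (ltnW kn')) addnC ltn_add2r.
have [l /andP[l1 l2] l3] : exists2 l : nat, (lb <= l < L)%N & l%:R * (eta * A) < y k <= l.+1%:R * (eta * A).
  apply: grid_level; first by rewrite mulr_gt0 ?eta0 ?A0.
    by rewrite mulrA.
  by rewrite mulrA; exact: (gc_top gc k0n).
have c3 : (k %/ (2 * column_half M n) < M.+1)%N.
  by rewrite ltnS ltnW // ltn_divLR ?muln_gt0 ?half0 // mulnC.
exists (Ordinal c3, Ordinal l2, odd k, 0 < x k); rewrite /in_class /level !eqxx /=.
rewrite /node_col /node_lev /column (negbTE (lt0n_neq0 k0)) (ltn_eqF kn') /= eqxx /=.
by rewrite c1 c2 l1 /= -!mulrA.
Qed.

Let class_peak k a : (k <= n)%N -> in_cls k a (x k) -> peak k.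
Proof.
move=> kn /and4P[_ _ _]; rewrite /level; split => //.
have [->|k0] := eqVneq k 0%N; first by left.
have [->|kn'] := eqVneq k n; first by right; left.
right; right; move: p; rewrite (negbTE k0) (negbTE kn') /= => /and3P[_ lba /andP[yk _]].
apply: le_lt_trans yk; rewrite /b ler_pM2r ?A0 // ler_pM2r ?eta0 //.
by rewrite ler_nat.
Qed.

(** Blocks have length [2 (n %/ (2 M))] instead of [n / M]. Over at most [M] blocks the drift is at
    most [2 M] indices, which [gs_nM] bounds by the width [n / M] of one column. *)
Let u_error k a : (k <= n)%N -> in_cls k a (x k) -> `|u k - nodeu a| <= M%:R^-1.
Proof.
move=> kn ha; have := ha => /and4P[_ _ /eqP hc]; rewrite /node_u hc /column /level /u.
case: (posnP k) => [->|k0] /=; first by rewrite !mul0r subrr normr0 invr_ge0 ltW // M0R.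
case: eqVneq => [->|kn'] /=.
  have -> : n%:R / n%:R = 1 :> R by rewrite divff // gt_eqF // n0R.
  have -> : M%:R / M%:R = 1 :> R by rewrite divff // gt_eqF // M0R.
  by rewrite subrr normr0 invr_ge0 ltW // M0R.
move=> /and3P[/andP[c1 c2] _ _]; set m := (2 * column_half M n)%N in c1 c2 *.
have m0 : (0 < m)%N by rewrite muln_gt0 half0.
set i := (k %/ m)%N.
have i1 : (i * m <= k)%N by exact: leq_divM.
have i2 : (k < i.+1 * m)%N by rewrite ltn_ceil.
have iM : (i <= M)%N by rewrite ltnW // ltn_divLR // mulnC.
have mM : (m * M <= n)%N := halfle.
have nM : (n < m * M + 2 * M)%N := halfgt.
have i1R : (i%:R : R) * m%:R <= k%:R by rewrite -natrM ler_nat.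
have i2R : (k%:R : R) <= (i%:R + 1) * m%:R by rewrite natr1 -natrM ler_nat ltnW.
have iMR : (i%:R : R) <= M%:R by rewrite ler_nat.
have mMR : (m%:R : R) * M%:R <= n%:R by rewrite -natrM ler_nat.
have nMR : (n%:R : R) <= m%:R * M%:R + 2 * M%:R by rewrite -!natrM -natrD ler_nat ltnW.
have n2 := gs_nM gs.
have i0 : 0 <= i%:R :> R by [].
have m0R : 0 <= m%:R :> R by [].
have P : 0 < n%:R * M%:R :> R by rewrite mulr_gt0 ?n0R ?M0R.
have -> : k%:R / n%:R - i%:R / M%:R = (k%:R * M%:R - i%:R * n%:R) / (n%:R * M%:R) :> R.
  by field; rewrite !gt_eqF ?n0R ?M0R.
have -> : M%:R^-1 = n%:R / (n%:R * M%:R) :> R by field; rewrite !gt_eqF ?n0R ?M0R.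
rewrite normrM [`|_^-1|]gtr0_norm ?invr_gt0 // ler_pM2r ?invr_gt0 // ler_norml.
have g1 := ler_wpM2r (ltW M0R) i1R.
have g2 := ler_wpM2r (ltW M0R) i2R.
have g3 := ler_wpM2l i0 nMR.
have g4 := ler_wpM2l i0 mMR.
have g5 := ler_wpM2r (ltW M0R) iMR.
by apply/andP; split; move: g1 g2 g3 g4 g5 n2 mMR; rewrite ?expr2; lra.
Qed.

Let v_error k a : (k <= n)%N -> in_cls k a (x k) -> `|v k - nodev a| <= eta.
Proof.
move=> kn /and4P[_ _ _]; rewrite /level /node_v /v.
have ends : `|y k| <= h / 4 * s -> `|y k / A - 0%:R * eta| <= eta.
  move=> hk; rewrite mul0r subr0 normrM [`|A^-1|]gtr0_norm ?invr_gt0 ?A0 //.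
  rewrite ler_pdivrMr ?A0 //; apply: le_trans hk _.
  have -> : h / 4 * s = h / 4 / n%:R * A by rewrite As; field; rewrite gt_eqF ?n0R.
  by rewrite ler_pM2r ?A0 // (gs_end gs).
have [e1 e2] := gc_ends gc.
case: ifP => [kk /eqP->|_ /and3P[_ _ /andP[l1 l2]]].
  by apply: ends; move: kk => /orP[/eqP->|/eqP->].
rewrite ler_norml -/y in l1 l2 *; have := l1; have := l2.
rewrite -ltr_pdivlMr ?A0 // -ler_pdivrMr ?A0 // -natr1 => g1 g2.
have := eta0; move: g1 g2; rewrite -/(log_abs x k) -/y => g1 g2 e0.
by apply/andP; split; lra.
Qed.

Let nodeu01 a : 0 <= nodeu a <= 1.
Proof.
rewrite /node_u divr_ge0 //= ler_pdivrMr ?M0R // mul1r ler_nat.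
by rewrite -ltnS; exact: ltn_ord.
Qed.

Let peak_sep i k : peak i -> peak k -> (i < k)%N -> lambda <= u k - u i.
Proof.
move=> [iln hi] [kn hk] ik; have /andP[l0 lk] := gs_lambda gs.
have /andP[k0 k1] := gs_kappa gs.
rewrite /u -mulrBl ler_pdivlMr ?n0R // -natrB ?(ltnW ik) //.
have l2 : lambda * n%:R <= kappa * n%:R by rewrite ler_pM2r ?n0R.
have l3 : kappa * n%:R <= n%:R by rewrite ler_piMl ?(ltW n0R) // ltW.
have i_n : (i < n)%N by exact: leq_trans kn.
have k_0 : (0 < k)%N by exact: leq_ltn_trans ik.
have [i0|i0] := posnP i.
  rewrite i0 subn0; apply: (le_trans l2).
  have [->//|kn'] := eqVneq k n.
  have kn2 : (k < n)%N by rewrite ltn_neqAle kn'.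
  have [||m1 _] := @peak_middle k; first by rewrite k_0.
    by case: hk => [k2|[k2|//]]; [rewrite k2 in k_0|rewrite k2 ltnn in kn2].
  exact: m1.
have yi : b * A < y i.
  by case: hi => [i2|[i2|//]]; [rewrite i2 in i0|rewrite i2 ltnn in i_n].
have [->|kn'] := eqVneq k n.
  have [|_ m2] := @peak_middle i _ yi; first by rewrite i0.
  exact: le_trans l2 m2.
have kn2 : (k < n)%N by rewrite ltn_neqAle kn'.
apply: (gc_sep gc) => //; first by rewrite ik.
by case: hk => [k2|[k2|//]]; [rewrite k2 in k_0|rewrite k2 ltnn in kn2].
Qed.

Let node_sep i k a c : peak i -> peak k -> (i < k)%N ->
  in_cls i a (x i) -> in_cls k c (x k) -> lambda / 2 <= nodeu c - nodeu a.
Proof.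
move=> pi pk ik ha hc; have := peak_sep pi pk ik.
have := u_error pi.1 ha; have := u_error pk.1 hc; have := gs_M2 gs.
rewrite !ler_norml => g1 /andP[g2 g3] /andP[g4 g5] g6; lra.
Qed.

Let class_col_lt i k a c : peak i -> peak k -> (i < k)%N ->
  in_cls i a (x i) -> in_cls k c (x k) -> (node_col a < node_col c)%N.
Proof.
move=> pi pk ik ha hc; have := node_sep pi pk ik ha hc.
have /andP[l0 _] := gs_lambda gs => h1.
have : nodeu a < nodeu c by lra.
by rewrite /node_u ltr_pM2r ?invr_gt0 ?M0R // ltr_nat.
Qed.

Let v_range k : peak k -> - eta <= v k <= L%:R * eta.
Proof.
move=> [kn hk]; have [e1 e2] := gc_ends gc.
have L1 : 1 <= L%:R :> R by rewrite ler1n (gs_L gs).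
have eL : eta <= L%:R * eta by rewrite ler_peMl // ltW ?eta0.
have ends : `|y k| <= h / 4 * s -> - eta <= v k <= L%:R * eta.
  rewrite /v => g; have : `|y k / A| <= eta.
    rewrite normrM [`|A^-1|]gtr0_norm ?invr_gt0 ?A0 // ler_pdivrMr ?A0 //.
    apply: le_trans g _; have -> : h / 4 * s = h / 4 / n%:R * A by rewrite As; field; rewrite gt_eqF ?n0R.
    by rewrite ler_pM2r ?A0 // (gs_end gs).
  by rewrite ler_norml => /andP[-> g2] /=; exact: le_trans eL.
have [k0|k0] := posnP k; first by apply: ends; rewrite k0.
have [kn'|kn'] := eqVneq k n; first by apply: ends; rewrite kn'.
have kn2 : (k < n)%N by rewrite ltn_neqAle kn'.
have yk : b * A < y k.
  by case: hk => [k2|[k2|//]]; [rewrite k2 in k0|rewrite k2 ltnn in kn2].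
rewrite /v ler_pdivrMr ?A0 // (gc_top gc) ?k0 // andbT ler_pdivlMr ?A0 //.
apply: le_trans (ltW yk); rewrite ler_pM2r ?A0 // /b.
by apply: (@le_trans _ _ 0); rewrite ?oppr_le0 ?mulr_ge0 // ltW ?eta0.
Qed.

Let orient_close i j k a1 a2 a3 : peak i -> peak j -> peak k ->
  in_cls i a1 (x i) -> in_cls j a2 (x j) -> in_cls k a3 (x k) ->
  `|orient (u i) (v i) (u j) (v j) (u k) (v k) - node_orient eta a1 a2 a3| <= delta / 2.
Proof.
move=> pi pj pk h1 h2 h3; apply: le_trans (gs_pert gs).
have e0 := eta0; have r1 := v_range pi; have r2 := v_range pj; have r3 := v_range pk.
apply: orient_perturbation.
- by rewrite mulr_ge0 ?addr_ge0 // ltW.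
- exact: u_error pi.1 h1.
- exact: u_error pj.1 h2.
- exact: u_error pk.1 h3.
- exact: v_error pi.1 h1.
- exact: v_error pj.1 h2.
- exact: v_error pk.1 h3.
- exact: nodeu01.
- exact: nodeu01.
- exact: nodeu01.
- by rewrite ler_norml; move: r1 r3 => /andP[? ?] /andP[? ?]; apply/andP; split; lra.
- by rewrite ler_norml; move: r1 r2 => /andP[? ?] /andP[? ?]; apply/andP; split; lra.
Qed.

Let node_orient_generic i j k a1 a2 a3 : peak i -> peak j -> peak k ->
  i != j -> i != k -> j != k ->
  in_cls i a1 (x i) -> in_cls j a2 (x j) -> in_cls k a3 (x k) ->
  delta <= `|node_orient eta a1 a2 a3|.
Proof.
have key i' j' k' b1 b2 b3 : peak i' -> peak j' -> peak k' -> (i' < j')%N -> (j' < k')%N ->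
    in_cls i' b1 (x i') -> in_cls j' b2 (x j') -> in_cls k' b3 (x k') ->
    delta <= `|node_orient eta b1 b2 b3|.
  move=> pi pj pk ij jk c1 c2 c3; apply: (gc_generic gc ij jk pk.1 c1 c2 c3).
  exact: node_sep pi pk (ltn_trans ij jk) c1 c3.
have s12 b1 b2 b3 : `|node_orient eta b1 b2 b3| = `|node_orient eta b2 b1 b3|.
  by rewrite -normrN; congr `|_|; rewrite /node_orient /orient; ring.
have s23 b1 b2 b3 : `|node_orient eta b1 b2 b3| = `|node_orient eta b1 b3 b2|.
  by rewrite -normrN; congr `|_|; rewrite /node_orient /orient; ring.
move=> pi pj pk ij ik jk c1 c2 c3.
have [ij'|ij'] := ltnP i j; have [jk'|jk'] := ltnP j k; have [ik'|ik'] := ltnP i k.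
- exact: key pi pj pk ij' jk' c1 c2 c3.
- exact: key pi pj pk ij' jk' c1 c2 c3.
- rewrite s23; apply: (key i k j) => //; by rewrite ltn_neqAle eq_sym jk.
- rewrite s23 s12; apply: (key k i j) => //; by rewrite ltn_neqAle eq_sym ik.
- rewrite s12; apply: (key j i k) => //; by rewrite ltn_neqAle eq_sym ij.
- rewrite s12 s23; apply: (key j k i) => //; by rewrite ltn_neqAle eq_sym ik.
- have {}ij' : (j < i)%N by rewrite ltn_neqAle eq_sym ij.
  have {}jk' : (k < j)%N by rewrite ltn_neqAle eq_sym jk.
  by have := ltn_trans jk' (ltn_trans ij' ik'); rewrite ltnn.
- have {}ij' : (j < i)%N by rewrite ltn_neqAle eq_sym ij.
  have {}jk' : (k < j)%N by rewrite ltn_neqAle eq_sym jk.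
  by rewrite s12 s23 s12; apply: (key k j i).
Qed.

(** A line above all the points is above the ends and the high point [t], hence above
    [- h s / 4 + h s k] when [k <= t], and symmetrically on the other side. A low point is under
    [h s k / 2], and [k >= 1] leaves the gap [h s / 4]. *)
Let below_gap i sg k : (k <= n)%N -> ~ peak k ->
  (forall j, (j <= n)%N -> y j <= y i + sg * (j%:R - i%:R)) ->
  y k + h / 4 * s <= y i + sg * (k%:R - i%:R).
Proof.
move=> kn npk hl.
have k0 : (0 < k)%N by rewrite lt0n; apply/eqP => k0; apply: npk; split => //; left.
have kn' : (k < n)%N.
  by rewrite ltn_neqAle kn andbT; apply/eqP => k1; apply: npk; split => //; right; left.
have yk : y k <= b * A by rewrite leNgt; apply/negP => yk; apply: npk; split => //; right; right.
have k0n : (0 < k < n)%N by rewrite k0.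
have bA : b * A = h / 2 * s * (kappa * n%:R) by rewrite (gs_b gs) As; ring.
have hs0 : 0 < h / 2 * s by rewrite mulr_gt0 ?divr_gt0 ?h0 ?s0.
have y1 : y k <= h / 2 * s * k%:R.
  have [kk|kk] := ltP (k%:R : R) (kappa * n%:R); first exact: (gc_left gc k0n kk).
  by apply: le_trans yk _; rewrite bA ler_pM2l.
have y2 : y k <= h / 2 * s * (n - k)%:R.
  have [kk|kk] := ltP ((n - k)%:R : R) (kappa * n%:R); first exact: (gc_right gc k0n kk).
  by apply: le_trans yk _; rewrite bA ler_pM2l.
have [e1 e2] := gc_ends gc.
move: e1 e2; rewrite !ler_norml => /andP[e1 _] /andP[e2 _].
have [t /andP[t0 tn] yt] := gc_high gc.
have l0 := hl 0%N (leq0n n); have lt := hl t (ltnW tn); have ln := hl n (leqnn n).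
have t0R : 0 < t%:R :> R by rewrite ltr0n.
have tnR : (t%:R : R) < n%:R by rewrite ltr_nat.
have k1R : 1 <= k%:R :> R by rewrite ler1n.
have nkR : ((n - k)%:R : R) = n%:R - k%:R by rewrite natrB // ltnW.
have k1R' : 1 <= (n%:R : R) - k%:R by rewrite -nkR ler1n subn_gt0.
have yt' : h * s * n%:R < y t by rewrite -mulrA -As.
have hs : 0 < h * s by rewrite mulr_gt0 ?h0 ?s0.
set Lk := y i + sg * (k%:R - i%:R).
have [kt|tk] := leqP k t.
  have ktR : (k%:R : R) <= t%:R by rewrite ler_nat.
  suff : - (h / 4 * s) + h * s * k%:R <= Lk.
    have := ler_wpM2l (ltW hs) k1R; move: y1; lra.
  rewrite -(ler_pM2l t0R).
  have E : t%:R * Lk = (t%:R - k%:R) * (y i + sg * (0%:R - i%:R)) + k%:R * (y i + sg * (t%:R - i%:R)).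
    by rewrite /Lk; ring.
  have tk0 : 0 <= (t%:R : R) - k%:R by lra.
  have g1 := ler_wpM2l tk0 (le_trans e1 l0).
  have k00 : 0 <= (k%:R : R) by lra.
  have g2 := ler_wpM2l k00 (le_trans (ltW yt') lt).
  have hsk : 0 <= h * s * k%:R by rewrite mulr_ge0 // ltW.
  have g3 := ler_wpM2l hsk (ltW tnR).
  have g4 : 0 <= k%:R * (h / 4 * s) by rewrite mulr_ge0 //; move: hs; lra.
  by rewrite E; move: g1 g2 g3 g4; lra.
have tkR : (t%:R : R) <= k%:R by rewrite ler_nat ltnW.
suff : - (h / 4 * s) + h * s * (n%:R - k%:R) <= Lk.
  have := ler_wpM2l (ltW hs) k1R'; move: y2; rewrite nkR; lra.
have nt0 : 0 < (n%:R : R) - t%:R by lra.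
rewrite -(ler_pM2l nt0).
have E : (n%:R - t%:R) * Lk = (k%:R - t%:R) * (y i + sg * (n%:R - i%:R)) + (n%:R - k%:R) * (y i + sg * (t%:R - i%:R)).
  by rewrite /Lk; ring.
have tk0 : 0 <= (k%:R : R) - t%:R by lra.
have g1 := ler_wpM2l tk0 (le_trans e2 ln).
have k00 : 0 <= (n%:R : R) - k%:R by lra.
have g2 := ler_wpM2l k00 (le_trans (ltW yt') lt).
have hsk : 0 <= h * s * (n%:R - k%:R) by rewrite mulr_ge0 // ltW.
have g3 : h * s * (n%:R - k%:R) * (n%:R - t%:R) <= h * s * (n%:R - k%:R) * n%:R.
  by rewrite ler_wpM2l //; lra.
have g4 : 0 <= (n%:R - k%:R) * (h / 4 * s) by rewrite mulr_ge0 //; move: hs; lra.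
by rewrite E; move: g1 g2 g3 g4; lra.
Qed.

Let weak_edge_peaks i j : weak_edge n y i j -> peak i /\ peak j.
Proof.
move=> [ij jn [sg yj hl]]; have iln : (i <= n)%N by rewrite ltnW // (leq_trans ij).
have hs : 0 < h / 4 * s by rewrite mulr_gt0 ?divr_gt0 ?h0 ?s0.
split; apply: contrapT => np.
  by have := below_gap iln np hl; rewrite subrr; lra.
by have := below_gap jn np hl; rewrite -yj; lra.
Qed.

(** Concavity makes the true orientation nonpositive, rounding moves it by at most [delta / 2], and
    genericity keeps the rounded one at least [delta] away from 0: hence it is at most [- delta],
    and the true one at most [- (delta / 2)]. *)
Let weak_orient i j k a1 a2 a3 : weak_edge n y i j -> peak k -> k != i -> k != j ->
  in_cls i a1 (x i) -> in_cls j a2 (x j) -> in_cls k a3 (x k) ->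
  node_orient eta a1 a2 a3 < 0 /\ orient (u i) (v i) (u j) (v j) (u k) (v k) <= - (delta / 2).
Proof.
move=> wij pk ki kj h1 h2 h3; have [pi pj] := weak_edge_peaks wij.
have [ij jn [sg yj hl]] := wij.
have ijn : i != j by rewrite ltn_eqF.
have := node_orient_generic pi pj pk ijn _ _ h1 h2 h3; rewrite eq_sym ki eq_sym kj => /(_ isT isT) hd.
have := orient_close pi pj pk h1 h2 h3.
have o0 : orient (u i) (v i) (u j) (v j) (u k) (v k) <= 0.
  have -> : orient (u i) (v i) (u j) (v j) (u k) (v k) =
    (j%:R - i%:R) * (y k - (y i + sg * (k%:R - i%:R))) / (n%:R * A).
    by rewrite /orient /u /v yj; field; rewrite !gt_eqF ?n0R ?A0.
  rewrite ler_pdivrMr ?mulr_gt0 ?n0R ?A0 // mul0r mulr_ge0_le0 //.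
    by rewrite subr_ge0 ler_nat ltnW.
  by rewrite subr_le0; exact: hl pk.1.
have d0 := gs_delta gs.
move: hd; rewrite ler_norml; case: (ltP (node_orient eta a1 a2 a3) 0) => hn.
  by rewrite ltr0_norm // => g1 /andP[g2 g3]; split => //; lra.
rewrite ger0_norm // => g1 /andP[g2 g3].
by exfalso; lra.
Qed.

(** For low points the gap comes from [below_gap]. For peaks the orientation equals [j - i] times
    the signed distance to the line, divided by [n A]; as [j - i <= n], the distance is at least
    [delta / 2 A]. *)
Let weak_edge_strict i j : weak_edge n y i j -> strict_edge n y D i j.
Proof.
move=> wij; have [ij jn [sg yj hl]] := wij; split => //; exists sg => // k kn ki kj.
have [pk|npk] := pselect (peak k); last first.
  have := below_gap kn npk hl; have := gs_D1 gs; lra.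
have [pi pj] := weak_edge_peaks wij.
have [[a1 h1] [a2 h2] [a3 h3]] := And3 (class_exists pi) (class_exists pj) (class_exists pk).
have [_ ho] := weak_orient wij pk ki kj h1 h2 h3.
have E : orient (u i) (v i) (u j) (v j) (u k) (v k) =
    (j%:R - i%:R) * (y k - (y i + sg * (k%:R - i%:R))) / (n%:R * A).
  by rewrite /orient /u /v yj; field; rewrite !gt_eqF ?n0R ?A0.
have nA : 0 < n%:R * A by rewrite mulr_gt0 ?n0R ?A0.
move: ho; rewrite E ler_pdivrMr //.
have ji : 0 < (j%:R : R) - i%:R by rewrite subr_gt0 ltr_nat.
have jin : (j%:R : R) - i%:R <= n%:R by rewrite lerBlDr -natrD ler_nat (leq_trans jn) // leq_addr.
set g := y i + sg * (k%:R - i%:R) - y k => ho.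
have gE : (j%:R - i%:R) * (y k - (y i + sg * (k%:R - i%:R))) = - ((j%:R - i%:R) * g) by rewrite /g; ring.
rewrite gE mulNr lerN2 in ho.
have D2 := gs_D2 gs.
have g0 : 0 < g.
  rewrite -(pmulr_rgt0 _ ji); apply: lt_le_trans ho.
  by rewrite mulr_gt0 // divr_gt0 // (gs_delta gs).
have : (j%:R - i%:R) * g <= n%:R * g by rewrite ler_wpM2r // ltW.
move=> /(le_trans ho); rewrite mulrCA ler_pM2l ?n0R // => hg.
have : D <= g by exact: le_trans D2 hg.
by rewrite /g; lra.
Qed.

Let edge_roots_class i j a c : (i <= n)%N -> (j <= n)%N ->
  in_cls i a (x i) -> in_cls j c (x j) -> edge_roots x i j = node_roots a c.
Proof.
move=> iln jn /and4P[/eqP oa /eqP pa _ _] /and4P[/eqP oc /eqP pc _ _].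
have sg (p q : R) : p != 0 -> q != 0 -> (p * q < 0) = ((0 < p) != (0 < q)).
  move=> p0 q0; have [p1|p1|p1] := ltgtP p 0; last by rewrite p1 eqxx in p0.
    by rewrite nmulr_rlt0 //; case: (0 < q).
  by rewrite pmulr_rlt0 // ltNge le_eqVlt eq_sym (negbTE q0) /=; case: (0 < q).
have tw k : x k != 0 -> (0 < (-1) ^+ k * x k) = (0 < x k) (+) odd k.
  move=> xk; rewrite -signr_odd; case: (odd k); rewrite ?expr1 ?expr0 ?mul1r ?addbF //.
  by rewrite mulN1r oppr_gt0 addbT -leNgt lt_neqAle xk.
have xi := gc_nz gc iln; have xj := gc_nz gc jn.
rewrite /edge_roots /sign_change /node_roots sg // sg ?mulf_neq0 ?signr_eq0 // !tw //.
by rewrite pa pc oa oc.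
Qed.

Let pattern_class c : c \in pattern M L eta lb n A x ->
  exists2 k, peak k & @in_class R M L eta lb n A k c (x k).
Proof.
rewrite inE => /existsP[k hk]; exists (val k) => //.
by apply: class_peak hk; rewrite -ltnS.
Qed.

Let class_pattern k a : (k <= n)%N -> in_cls k a (x k) -> a \in pattern M L eta lb n A x.
Proof.
move=> kn ha; rewrite inE; apply/existsP; exists (inord k).
by rewrite inordK // ltnS.
Qed.

Let weak_pattern_edge i j a c : weak_edge n y i j ->
  in_cls i a (x i) -> in_cls j c (x j) -> pattern_edge eta (pattern M L eta lb n A x) a c.
Proof.
move=> wij ha hc; have [pi pj] := weak_edge_peaks wij; have [ij jn _] := wij.
rewrite /pattern_edge (class_pattern jn hc) andbT (class_col_lt pi pj ij ha hc) /=.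
apply/forallP => e; apply/implyP => eZ; apply/implyP => /andP[ea ec].
have [k pk he] := pattern_class eZ.
have ki : k != i by apply: contraNneq ea => ki; rewrite ki in he; apply/eqP; exact: (in_class_unique eta0 A0 he ha).
have kj : k != j by apply: contraNneq ec => kj; rewrite kj in he; apply/eqP; exact: (in_class_unique eta0 A0 he hc).
by have [] := weak_orient wij pk ki kj ha hc he.
Qed.

Let chain_pattern p i a : is_chain (weak_edge n y) i p -> last i p = n -> (i <= n)%N ->
  in_cls i a (x i) ->
  exists q, [/\ path (pattern_edge eta (pattern M L eta lb n A x)) a q,
    node_col (last a q) = M & sumn (pairmap (edge_roots x) i p) = sumn (pairmap (@node_roots M L) a q)].
Proof.
elim: p i a => [|j p IH] i a /=.
  move=> _ iE iln ha; exists [::]; split => //=.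
  by move: ha => /and4P[_ _ /eqP-> _]; rewrite /column iE eqxx gtn_eqF ?n0.
move=> [wij ch] lst iln ha; have [pi pj] := weak_edge_peaks wij.
have [c hc] := class_exists pj.
have [q [pq lq sq]] := IH j c ch lst pj.1 hc.
exists (c :: q); split => //=; first by rewrite (weak_pattern_edge wij ha hc).
by rewrite sq (edge_roots_class iln pj.1 ha hc).
Qed.

(** The majorant is read twice: as a chain of strict edges it gives the number of roots, as a path
    of nodes it gives the value of the pattern, and the two sums agree edge by edge. *)
Theorem nb_real_roots_pattern :
  nb_real_roots (\poly_(k < n.+1) x k) = pattern_roots eta (pattern M L eta lb n A x).
Proof.
have [p ch lst] := weak_chain n y.
have chs : is_chain (strict_edge n y D) 0 p.
  elim: p 0%N ch {lst} => //= j p IH i [wij ch]; split; last exact: IH.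
  exact: weak_edge_strict.
rewrite (nb_real_roots_chain (gs_D0 gs) (gs_nD gs) (gc_nz gc) chs lst).
have p0 : peak 0 by split => //; left.
have [a ha] := class_exists p0.
have [q [pq lq ->]] := chain_pattern ch lst (leq0n n) ha.
have col0 c k : peak k -> in_cls k c (x k) -> node_col c = 0%N -> k = 0%N.
  move=> pk hc c0; apply/eqP; rewrite -leqn0 leqNgt; apply/negP => k0.
  by have := class_col_lt p0 pk k0 ha hc; rewrite c0.
symmetry; apply: pattern_rootsE.
  move=> c e cZ eZ c0 e0; have [k pk hc] := pattern_class cZ; have [k' pk' he] := pattern_class eZ.
  have k0 := col0 _ _ pk hc c0; have k'0 := col0 _ _ pk' he e0.
  by rewrite k0 in hc; rewrite k'0 in he; exact: (in_class_unique eta0 A0 hc he).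
exists a, q; split => //; first exact: class_pattern ha.
by move: ha => /and4P[_ _ /eqP].
Qed.

End GoodConfiguration.

(** * Probability of a bad configuration *)

Section ProbabilityBounds.
Variables (d : measure_display) (T : measurableType d) (R : realType).
Variable P : probability T R.
Implicit Types A B E : set T.

Lemma probE A : measurable A -> P A = (prob P A)%:E.
Proof. by move=> mA; rewrite /prob fineK // fin_num_measure. Qed.

Lemma prob_ge0 A : 0 <= prob P A.
Proof. by rewrite /prob fine_ge0. Qed.

Lemma prob_le1 A : measurable A -> prob P A <= 1.
Proof. by move=> mA; rewrite -lee_fin -probE // probability_le1. Qed.

Lemma le_prob A B : measurable A -> measurable B -> A `<=` B -> prob P A <= prob P B.
Proof. by move=> mA mB AB; rewrite -lee_fin -!probE // le_measure ?inE. Qed.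

Lemma prob_setC A : measurable A -> prob P (~` A) = 1 - prob P A.
Proof.
move=> mA; apply: EFin_inj; rewrite -probE; last exact: measurableC.
by rewrite probability_setC // probE.
Qed.

Lemma prob_setU_le A B : measurable A -> measurable B ->
  prob P (A `|` B) <= prob P A + prob P B.
Proof.
move=> mA mB; rewrite -lee_fin EFinD -!probE //; last exact: measurableU.
exact: measureU2.
Qed.

Lemma prob_setDI A B : measurable A -> measurable B ->
  prob P A = prob P (A `&` B) + prob P (A `\` B).
Proof.
move=> mA mB; have mI := measurableI _ _ mA mB; have mD := measurableD mA mB.
apply: EFin_inj; rewrite EFinD -!probE //.
by rewrite -measureU // ?setUIDK // setDE setIACA setICr setI0.
Qed.

Lemma prob_set0 : prob P set0 = 0.
Proof. by rewrite /prob measure0. Qed.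

Lemma prob_setT : prob P setT = 1.
Proof. by rewrite /prob probability_setT. Qed.

Lemma prob_bigsetU_le (I : Type) (s : seq I) (Q : pred I) (A : I -> set T) :
  (forall i, measurable (A i)) ->
  prob P (\big[setU/set0]_(i <- s | Q i) A i) <= \sum_(i <- s | Q i) prob P (A i).
Proof.
move=> mA; elim: s => [|i s IH]; first by rewrite !big_nil prob_set0.
rewrite !big_cons; case: ifP => // _; apply: le_trans (prob_setU_le _ _) _ => //.
  exact: bigsetU_measurable.
by rewrite lerD2l.
Qed.

Lemma prob_disjoint_le (I : eqType) (s : seq I) (A : I -> set T) E :
  uniq s -> (forall i, measurable (A i)) -> measurable E ->
  (forall i, i \in s -> A i `<=` E) ->
  (forall i j w, A i w -> A j w -> i = j) ->
  \sum_(i <- s) prob P (A i) <= prob P E.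
Proof.
move=> + mA + + Adis; elim: s E => [|i s IH] E /=; first by rewrite big_nil prob_ge0.
move=> /andP[is_ us] mE AE; rewrite big_cons (prob_setDI mE (mA i)).
have -> : E `&` A i = A i by apply/setIidPr; apply: AE; exact: mem_head.
rewrite lerD2l; apply: IH => //; first exact: measurableD.
move=> j js w Ajw; split; first by apply: AE Ajw; rewrite inE js orbT.
by move=> Aiw; rewrite (Adis _ _ _ Aiw Ajw) js in is_.
Qed.

End ProbabilityBounds.

Section IidSequence.
Variables (d : measure_display) (T : measurableType d) (R : realType).
Variables (P : probability T R) (X : nat -> {RV P >-> R}).
Hypothesis iidX : iid X.

Definition common_law (B : set R) : R := prob P (X 0%N @^-1` B).

Lemma measurable_RV k (B : set R) : measurable B -> measurable (X k @^-1` B).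
Proof. exact: measurable_funPTI. Qed.

Lemma prob_common_law k (B : set R) : measurable B -> prob P (X k @^-1` B) = common_law B.
Proof.
by move=> mB; rewrite /common_law /prob; congr fine; exact: iidX.2 k 0%N B mB.
Qed.

Lemma prob_bigcap_law (J : seq nat) (B : nat -> set R) : uniq J ->
  (forall j, measurable (B j)) ->
  prob P (\bigcap_(j in [set` J]) X j @^-1` B j) = \prod_(j <- J) common_law (B j).
Proof.
move=> uJ mB; rewrite /prob (iidX.1 _ _ uJ mB).
rewrite (eq_bigr (fun j => (common_law (B j))%:E)) ?prodEFin //.
by move=> j _; rewrite -(prob_common_law j) // -probE //; exact: measurable_RV.
Qed.

Lemma prob_indep2 i j (A B : set R) : i != j -> measurable A -> measurable B ->
  prob P (X i @^-1` A `&` X j @^-1` B) = common_law A * common_law B.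
Proof.
move=> ij mA mB; pose F k := if k == i then A else B.
have uJ : uniq [:: i; j] by rewrite /= inE ij.
have mF k : measurable (F k) by rewrite /F; case: ifP.
have := prob_bigcap_law uJ mF; rewrite !big_cons big_nil mulr1 /F eqxx eq_sym (negbTE ij) => <-.
congr (prob P _); apply/seteqP; split => w /=.
  by move=> [wA wB] k /=; rewrite !inE => /orP[]/eqP->; rewrite ?eqxx // eq_sym (negbTE ij).
move=> h; split; first by have := h i; rewrite /= eqxx mem_head; apply.
by have := h j; rewrite /= eq_sym (negbTE ij) !inE eqxx orbT; apply.
Qed.

Lemma prob_indep3 i j k (A B C : set R) : (i < j)%N -> (j < k)%N ->
  measurable A -> measurable B -> measurable C ->
  prob P (X i @^-1` A `&` X j @^-1` B `&` X k @^-1` C) =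
  common_law A * common_law B * common_law C.
Proof.
move=> ij jk mA mB mC; pose F l := if l == i then A else if l == j then B else C.
have ik := ltn_trans ij jk.
have ji : (j == i) = false by rewrite gtn_eqF.
have ki : (k == i) = false by rewrite gtn_eqF.
have kj : (k == j) = false by rewrite gtn_eqF.
have uJ : uniq [:: i; j; k] by rewrite /= !inE eq_sym ji eq_sym ki eq_sym kj.
have mF l : measurable (F l) by rewrite /F; do 2?case: ifP.
have := prob_bigcap_law uJ mF; rewrite !big_cons big_nil mulr1 mulrA /F !eqxx ji ki kj => <-.
congr (prob P _); apply/seteqP; split => w /=.
  move=> [[wA wB] wC] l /=; rewrite !inE => /or3P[]/eqP->; rewrite ?eqxx ?ji ?ki ?kj ?eqxx //.
move=> h; split; first split.
- by have := h i; rewrite /= eqxx mem_head; apply.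
- by have := h j; rewrite /= ji eqxx !inE eqxx orbT; apply.
- by have := h k; rewrite /= ki kj !inE eqxx !orbT; apply.
Qed.

Lemma common_law_ge0 B : 0 <= common_law B. Proof. exact: prob_ge0. Qed.

Lemma common_law_le1 B : measurable B -> common_law B <= 1.
Proof. by move=> mB; apply: prob_le1; exact: measurable_RV. Qed.

Lemma le_common_law A B : measurable A -> measurable B -> A `<=` B ->
  common_law A <= common_law B.
Proof. by move=> mA mB AB; apply: le_prob; [exact: measurable_RV..|move=> w; exact: AB]. Qed.

Lemma common_law_setC B : measurable B -> common_law (~` B) = 1 - common_law B.
Proof. by move=> mB; rewrite /common_law preimage_setC prob_setC //; exact: measurable_RV. Qed.

End IidSequence.

Section LogTail.
Variable R : realType.

Lemma measurable_ln_norm : measurable_fun [set: R] (fun r : R => ln `|r|).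
Proof. exact: measurableT_comp (@measurable_ln R) (@normr_measurable R setT). Qed.

Lemma measurable_ln_norm_gt (t : R) : measurable [set r : R | t < ln `|r|].
Proof.
have := measurable_ln_norm measurableT (measurable_itv `]t, +oo[); rewrite setTI.
by congr measurable; apply/seteqP; split => r /=; rewrite in_itv /= andbT.
Qed.

Lemma measurable_ln_norm_in (s t : R) : measurable [set r : R | s < ln `|r| <= t].
Proof.
have := measurable_ln_norm measurableT (measurable_itv `]s, t]); rewrite setTI.
by congr measurable; apply/seteqP; split => r /=; rewrite in_itv.
Qed.

Lemma measurable_ln_norm_large (t : R) : measurable [set r : R | r = 0 \/ t < `|ln `|r| |].
Proof.
rewrite (_ : [set _ | _] = [set 0] `|` [set r | t < `|ln `|r| |]); last first.
  by apply/seteqP; split => r /=.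
apply: measurableU; first exact: measurable_set1.
have mf : measurable_fun [set: R] (fun r : R => `|ln `|r| |).
  exact: measurableT_comp (@normr_measurable R setT) measurable_ln_norm.
have := mf measurableT _ (measurable_itv `]t, +oo[); rewrite setTI.
by congr measurable; apply/seteqP; split => r /=; rewrite in_itv /= andbT.
Qed.

Lemma measurable_pos : measurable [set r : R | 0 < r].
Proof.
have := measurable_itv `](0 : R), +oo[.
by congr measurable; apply/seteqP; split => r /=; rewrite in_itv /= andbT.
Qed.

Variables (d : measure_display) (T : measurableType d).
Variables (P : probability T R) (X : nat -> {RV P >-> R}).
Notation law := (common_law X).

Definition log_tail (t : R) : R := law [set r | t < ln `|r|].

Lemma log_tail_ni s t : s <= t -> log_tail t <= log_tail s.
Proof.
move=> st; apply: le_common_law; [exact: measurable_ln_norm_gt..|].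
by move=> r /=; exact: le_lt_trans.
Qed.

Lemma law_ln_norm_in s t : s <= t ->
  law [set r | s < ln `|r| <= t] = log_tail s - log_tail t.
Proof.
move=> st; apply/eqP; rewrite eq_sym subr_eq; apply/eqP.
rewrite /log_tail /common_law (prob_setDI P _ (measurable_RV X 0 (measurable_ln_norm_gt t))).
  rewrite addrC; congr (_ + _); congr (prob P _); apply/seteqP; split => w /=.
  - by move=> [-> /negP]; rewrite -leNgt.
  - by move=> /andP[-> h]; split => //; apply/negP; rewrite -leNgt.
  - by move=> [].
  - by move=> h; split => //; exact: le_lt_trans h.
by apply: measurable_RV; exact: measurable_ln_norm_gt.
Qed.

(** The events decrease to the null event that the coefficient is 0. That value is listed apart
    because [ln 0 = 0] would hide it. *)
Lemma law_ends_small (e : R) : law [set 0 : R] = 0 -> 0 < e ->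
  exists t : R, forall t' : R, t <= t' -> law [set r | r = 0 \/ t' < `|ln `|r| |] <= e.
Proof.
move=> law0 e0; pose D (m : nat) := [set r : R | r = 0 \/ m%:R < `|ln `|r| |].
have mD m : measurable (D m) := measurable_ln_norm_large m%:R.
have capD : \bigcap_m D m = [set 0].
  apply/seteqP; split => r /=; last by move=> -> m _; left.
  move=> h; apply: contrapT => r0.
  pose m := (Num.truncn `|ln `|r| |).+1.
  have [//|] := h m I; rewrite ltNge => /negP; apply.
  by apply: ltW; exact: truncnS_gt.
pose D' (m : nat) : set T := X 0%N @^-1` D m.
have mD' m : measurable (D' m) by exact: measurable_RV.
have capD' : \bigcap_m D' m = X 0%N @^-1` [set 0] by rewrite -capD preimage_bigcap.
have h1 : (P (D' 0%N) < +oo)%E by rewrite probE // ltry.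
have h3 : measurable (\bigcap_m D' m).
  by rewrite capD'; apply: measurable_RV; exact: measurable_set1.
have h4 : {homo D' : n m / (n <= m)%N >-> (m <= n)%O}.
  move=> n m nm; apply/subsetPset => r [r0|r0]; first by left.
  by right; apply: le_lt_trans r0; rewrite ler_nat.
have cap0 : P (\bigcap_m D' m) = 0%:E by rewrite probE // capD'; congr EFin; exact: law0.
have : (P \o D') m @[m --> \oo] --> 0%:E.
  by rewrite -cap0; exact: (nonincreasing_cvg_mu h1 mD' h3 h4).
move=> /fine_cvgP[_].
move=> /(@cvgr_lt _ _ _ _ _ _) /(_ _ e0) [N _ /(_ N (leqnn N))] /= hN.
exists N%:R => t' Nt'; apply: le_trans (ltW hN).
apply: le_common_law; [exact: measurable_ln_norm_large..|].
by move=> r [r0|r0]; [left|right; exact: le_lt_trans r0].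
Qed.

End LogTail.

Lemma mem_bigsetU (T : Type) (I : eqType) (s : seq I) (Q : pred I) (A : I -> set T) i w :
  i \in s -> Q i -> A i w -> (\big[setU/set0]_(j <- s | Q j) A j) w.
Proof.
elim: s => // j s IH; rewrite inE big_cons => /predU1P[<-|js] Qi Aiw.
  by rewrite Qi; left.
by case: ifP => _; [right|]; exact: IH.
Qed.

Lemma count_lt_le (R : realType) (N : nat) (c : R) : 0 <= c ->
  \sum_(1 <= m < N | m%:R < c) 1 <= c.
Proof.
move=> c0; apply: (@le_trans _ _ (\sum_(1 <= m < (Num.truncn c).+1) (1 : R))).
  rewrite (big_nat_widen _ _ _ _ _ (leq_maxl N (Num.truncn c).+1)).
  rewrite [leRHS](big_nat_widen _ _ _ _ _ (leq_maxr N (Num.truncn c).+1)).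
  rewrite big_mkcond [leRHS]big_mkcond; apply: ler_sum => k _ /=.
  case: ifP => [/andP[kn _]|_]; last by case: ifP.
  rewrite ifT // ltnS -(ler_nat R).
  have [//|] := leqP k (Num.truncn c); rewrite ?ler_nat // => h.
  have : c < k%:R by apply: lt_le_trans (truncnS_gt c) _; rewrite ler_nat.
  by move/(lt_trans kn); rewrite ltxx.
rewrite sumr_const_nat subn1 /=.
by have /andP[] := truncn_itv c0.
Qed.

(** * The bad events and bounds on their probabilities *)

Section BadEvents.
Variables (R : realType) (d : measure_display) (T : measurableType d).
Variables (P : probability T R) (X : nat -> {RV P >-> R}).
Hypothesis iidX : iid X.
Hypothesis law0 : common_law X [set 0 : R] = 0.
Variables (M L lb n : nat) (eta A h kappa lambda delta w0 : R).
Hypotheses (A0 : 0 < A) (n0 : (0 < n)%N) (eta0 : 0 < eta).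

Local Notation law := (common_law X).
Local Notation F := (log_tail X).
Let s := A / n%:R.
Let b := lb%:R * eta.
Local Notation cls k a := [set r : R | @in_class R M L eta lb n A k a r].
Local Notation nodeu := (@node_u R M L).
Local Notation nodev := (@node_v R M L eta).

Let F0 t : 0 <= F t. Proof. exact: common_law_ge0. Qed.

Lemma measurable_cls k a : measurable (cls k a).
Proof.
have -> : cls k a = (if (node_odd a == odd k) && (node_col a == column M n k) then setT else set0) `&`
   (if node_pos a then [set r | 0 < r] else ~` [set r | 0 < r]) `&`
   (if (k == 0%N) || (k == n) then (if node_lev a == 0%N then setT else set0) else
     (if (2 * column_half M n <= k < 2 * column_half M n * M)%N && (lb <= node_lev a)%N then
     [set r | (node_lev a)%:R * eta * A < ln `|r| <= (node_lev a).+1%:R * eta * A] else set0)).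
  apply/seteqP; split => r /=; rewrite /in_class /level.
    move=> /and4P[-> /eqP hp -> /= hl]; split; first split => //.
      by rewrite hp; case: (boolP (0 < r)) => // /negP h1; exact: h1.
    by case: ifP hl => [_ ->|_ /and3P[-> -> ?]].
  move=> [[+ hp]]; case: ifP => // /andP[-> ->] _ /= hl.
  have -> : node_pos a = (0 < r) by case: (node_pos a) hp => /= [->//|/negP/negbTE ->].
  rewrite eqxx /=; case: ifP hl => _; first by case: ifP.
  by case: ifP => // /andP[-> ->].
apply: measurableI; first apply: measurableI.
- by case: ifP.
- by case: ifP => _; [|apply: measurableC]; exact: measurable_pos.
- case: ifP => _; first by case: ifP.
  by case: ifP => // _; exact: measurable_ln_norm_in.
Qed.

Let gt_set (t : R) := [set r : R | t < ln `|r|].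
Let mgt t : measurable (gt_set t). Proof. exact: measurable_ln_norm_gt. Qed.

Let mX k (B : set R) : measurable B -> measurable (X k @^-1` B).
Proof. exact: measurable_RV. Qed.

Definition bad_zero : set T := \big[setU/set0]_(0 <= k < n.+1) (X k @^-1` [set 0 : R]).

Definition bad_end : set T :=
  (X 0%N @^-1` [set r : R | r = 0 \/ h / 4 * s < `|ln `|r| |]) `|`
  (X n @^-1` [set r : R | r = 0 \/ h / 4 * s < `|ln `|r| |]).

Definition bad_low : set T :=
  \bigcap_(k in [set` index_iota 1 n]) X k @^-1` (~` gt_set (h * A)).

Definition bad_left : set T :=
  \big[setU/set0]_(1 <= k < n | k%:R < kappa * n%:R) (X k @^-1` gt_set (h / 2 * s * k%:R)).

Definition bad_right : set T :=
  \big[setU/set0]_(1 <= k < n | (n - k)%:R < kappa * n%:R)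
    (X k @^-1` gt_set (h / 2 * s * (n - k)%:R)).

Definition bad_top : set T :=
  \big[setU/set0]_(1 <= k < n) (X k @^-1` gt_set (L%:R * eta * A)).

Definition bad_sep : set T :=
  \big[setU/set0]_(1 <= i < n) \big[setU/set0]_(i.+1 <= j < n | (j - i)%:R < lambda * n%:R)
    (X i @^-1` gt_set (b * A) `&` X j @^-1` gt_set (b * A)).

(* Ordinate of the line through the nodes [a] and [c] above the column of [j]. *)
Let line_at (a c : node M L) (j : nat) : R :=
  ((nodeu c - (column M n j)%:R / M%:R) * nodev a +
   ((column M n j)%:R / M%:R - nodeu a) * nodev c) / (nodeu c - nodeu a).

(** If the node of [j] is within [w0] of the line, its height is in the window: the lower end is
    lowered by [w0], and the width [3 w0] leaves room for the rounding [eta <= w0]. The maximum with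
    [b] keeps the window where tails are controlled uniformly. *)
Let window (a c : node M L) (j : nat) : set R :=
  let t := Num.max b (line_at a c j - w0) in
  [set r : R | t * A < ln `|r| <= (t + 3 * w0) * A].

Definition bad_generic : set T :=
  \big[setU/set0]_(p : 'I_n.+1 * node M L) \big[setU/set0]_(q : 'I_n.+1 * node M L)
  \big[setU/set0]_(1 <= j < n | [&& (p.1 < j)%N, (j < q.1)%N & lambda / 2 <= nodeu q.2 - nodeu p.2])
    (X p.1 @^-1` cls p.1 p.2 `&` X j @^-1` window p.2 q.2 j `&` X q.1 @^-1` cls q.1 q.2).

Let mwindow a c j : measurable (window a c j). Proof. exact: measurable_ln_norm_in. Qed.

Let mend (t : R) : measurable [set r : R | r = 0 \/ t < `|ln `|r| |].
Proof. exact: measurable_ln_norm_large. Qed.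

Let m3 (p q : 'I_n.+1 * node M L) (j : nat) : measurable
  (X p.1 @^-1` cls p.1 p.2 `&` X j @^-1` window p.2 q.2 j `&` X q.1 @^-1` cls q.1 q.2).
Proof. by apply: measurableI; [apply: measurableI|]; apply: mX => //; exact: measurable_cls. Qed.

Definition bad : set T :=
  bad_zero `|` bad_end `|` bad_low `|` bad_left `|` bad_right `|` bad_top `|` bad_sep `|`
  bad_generic.

Let mbad : [/\ measurable bad_zero, measurable bad_end, measurable bad_low,
  measurable bad_left & measurable bad_right] /\
  [/\ measurable bad_top, measurable bad_sep & measurable bad_generic].
Proof.
split; split.
- by apply: bigsetU_measurable => k _; apply: mX; exact: measurable_set1.
- by apply: measurableU; apply: mX; exact: mend.
- apply: fin_bigcap_measurable; first exact: finite_seq.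
  by move=> k _; apply: mX; exact: measurableC.
- by apply: bigsetU_measurable => k _; exact: mX.
- by apply: bigsetU_measurable => k _; exact: mX.
- by apply: bigsetU_measurable => k _; exact: mX.
- apply: bigsetU_measurable => i _; apply: bigsetU_measurable => j _.
  by apply: measurableI; exact: mX.
- apply: bigsetU_measurable => p _; apply: bigsetU_measurable => q _.
  by apply: bigsetU_measurable => j _; exact: m3.
Qed.

Lemma measurable_bad : measurable bad.
Proof.
have [[m1 m2 m4 m5 m6] [m7 m8 m9]] := mbad.
by do 7?apply: measurableU.
Qed.

Lemma prob_bad_le : prob P bad <= prob P bad_zero + prob P bad_end + prob P bad_low +
  prob P bad_left + prob P bad_right + prob P bad_top + prob P bad_sep + prob P bad_generic.
Proof.
have [[m1 m2 m4 m5 m6] [m7 m8 m9]] := mbad; rewrite /bad.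
have U (A1 A2 : set T) a : measurable A1 -> measurable A2 -> prob P A1 <= a ->
    prob P (A1 `|` A2) <= a + prob P A2.
  by move=> mA1 mA2 ha; apply: le_trans (prob_setU_le _ _ _) _ => //; rewrite lerD2r.
have mU (A1 A2 : set T) : measurable A1 -> measurable A2 -> measurable (A1 `|` A2).
  exact: measurableU.
have u2 := U _ _ _ m1 m2 (lexx (prob P bad_zero)); have v2 := mU _ _ m1 m2.
have u4 := U _ _ _ v2 m4 u2; have v4 := mU _ _ v2 m4.
have u5 := U _ _ _ v4 m5 u4; have v5 := mU _ _ v4 m5.
have u6 := U _ _ _ v5 m6 u5; have v6 := mU _ _ v5 m6.
have u7 := U _ _ _ v6 m7 u6; have v7 := mU _ _ v6 m7.
have u8 := U _ _ _ v7 m8 u7; have v8 := mU _ _ v7 m8.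
exact: (U _ _ _ v8 m9 u8).
Qed.

Lemma prob_bad_zero : prob P bad_zero = 0.
Proof.
apply/eqP; rewrite eq_le prob_ge0 andbT.
apply: le_trans (prob_bigsetU_le _ _ _ _) _ => [k|].
  by apply: mX; exact: measurable_set1.
by rewrite big1 // => k _; rewrite (prob_common_law iidX) //; exact: measurable_set1.
Qed.

Lemma prob_bad_end : prob P bad_end <= 2 * law [set r : R | r = 0 \/ h / 4 * s < `|ln `|r| |].
Proof.
apply: le_trans (prob_setU_le _ _ _) _; [apply: mX; exact: mend..|].
by rewrite !(prob_common_law iidX) //; lra.
Qed.

Lemma prob_bad_low : prob P bad_low <= expR (- ((n.-1)%:R * F (h * A))).
Proof.
rewrite /bad_low (prob_bigcap_law iidX) ?iota_uniq //; last first.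
  by move=> _; apply: measurableC.
rewrite big_const_seq count_predT size_iota subn1 iter_mulr_1.
rewrite common_law_setC // -mulrN expRM_natl.
apply: lerXn2r; rewrite ?nnegrE ?expR_ge0 //.
  by rewrite subr_ge0; apply: common_law_le1.
exact: expR_ge1Dx.
Qed.

Lemma prob_bad_left : prob P bad_left <=
  \sum_(1 <= k < n | k%:R < kappa * n%:R) F (h / 2 * s * k%:R).
Proof.
apply: le_trans (prob_bigsetU_le _ _ _ _) _ => [k|]; first exact: mX.
by apply: ler_sum => k _; rewrite (prob_common_law iidX).
Qed.

Lemma prob_bad_right : prob P bad_right <=
  \sum_(1 <= k < n | k%:R < kappa * n%:R) F (h / 2 * s * k%:R).
Proof.
apply: le_trans (prob_bigsetU_le _ _ _ _) _ => [k|]; first exact: mX.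
rewrite big_nat_rev /= add1n.
rewrite big_nat_cond [leRHS]big_nat_cond.
rewrite le_eqVlt; apply/orP; left; apply/eqP; apply: eq_big => [k|k /andP[/andP[k1 kn] _]].
  case: (boolP (1 <= k < n)%N) => //= /andP[k1 kn].
  by rewrite subSS (subKn (ltnW kn)).
by rewrite subSS (subKn (ltnW kn)) (prob_common_law iidX).
Qed.

Lemma prob_bad_top : prob P bad_top <= n%:R * F (L%:R * eta * A).
Proof.
apply: le_trans (prob_bigsetU_le _ _ _ _) _ => [k|]; first exact: mX.
under eq_bigr do rewrite (prob_common_law iidX) //.
rewrite sumr_const_nat -[leLHS]mulr_natl ler_wpM2r ?common_law_ge0 // ler_nat leq_subr //.
Qed.

(** There are at most [n] choices of [i], then at most [lambda n] of [j], and each pair costs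
    [F (b A) ^ 2] by independence. *)
Lemma prob_bad_sep : 0 <= lambda ->
  prob P bad_sep <= n%:R * (lambda * n%:R) * F (b * A) ^+ 2.
Proof.
move=> l0; have m2 i j : measurable (X i @^-1` gt_set (b * A) `&` X j @^-1` gt_set (b * A)).
  by apply: measurableI; exact: mX.
apply: le_trans (prob_bigsetU_le _ _ _ _) _ => [i|]; first exact: bigsetU_measurable.
apply: (@le_trans _ _ (\sum_(1 <= i < n) (lambda * n%:R) * F (b * A) ^+ 2)).
  rewrite big_nat [leRHS]big_nat; apply: ler_sum => i /andP[i1 i_n].
  apply: le_trans (prob_bigsetU_le _ _ _ _) _ => [j|]; first exact: m2.
  apply: (@le_trans _ _ (\sum_(i.+1 <= j < n | (j - i)%:R < lambda * n%:R) F (b * A) ^+ 2)).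
    rewrite big_nat_cond [leRHS]big_nat_cond; apply: ler_sum => j /andP[/andP[ij _] _].
    by rewrite (prob_indep2 iidX) ?expr2 // ltn_eqF.
  have -> : i.+1 = (1 + i)%N by [].
  rewrite big_addn; under eq_bigl do rewrite addnK.
  apply: (@le_trans _ _ ((\sum_(1 <= m < n - i | m%:R < lambda * n%:R) 1) * F (b * A) ^+ 2)).
    by rewrite mulr_suml; apply: ler_sum => j _; rewrite mul1r.
  by rewrite ler_wpM2r ?exprn_ge0 // count_lt_le // mulr_ge0.
rewrite sumr_const_nat -[leLHS]mulr_natl -[leRHS]mulrA ler_wpM2r ?mulr_ge0 ?exprn_ge0 //.
by rewrite ler_nat leq_subr.
Qed.

Let sum_cls k : (k <= n)%N -> \sum_(a : node M L) law (cls k a) <=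
  if (k == 0%N) || (k == n) then 1 else F (b * A).
Proof.
move=> kn; have -> : \sum_(a : node M L) law (cls k a) =
    \sum_(a <- enum (node M L)) prob P (X k @^-1` cls k a).
  by rewrite big_enum; apply: eq_bigr => a _; rewrite (prob_common_law iidX) //; exact: measurable_cls.
have mc a : measurable (X k @^-1` cls k a) by apply: mX; exact: measurable_cls.
case: ifP => hk.
  rewrite -(prob_setT P); apply: prob_disjoint_le => //; first exact: enum_uniq.
  by move=> a a' w; exact: in_class_unique.
rewrite /log_tail -(prob_common_law iidX k (mgt _)).
apply: prob_disjoint_le => //; [exact: enum_uniq|by apply: mX; exact: mgt| |].
  move=> a _ w /=; rewrite /in_class /level hk => /and4P[_ _ _ /and3P[_ lba /andP[h1 _]]].
  apply: le_lt_trans h1; rewrite /b ler_pM2r // ler_pM2r // ler_nat //.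
by move=> a a' w; exact: in_class_unique.
Qed.

(** The window depends on the two outer nodes only, so that the three events are independent;
    summing over [j] costs at most [e]. The classes of one index are disjoint, hence the outer nodes
    contribute the square of an expected number of classified indices, in which 2 stands for the two
    ends. *)
Lemma prob_bad_generic (e : R) : 0 <= e -> 0 < w0 ->
  (forall t, b <= t -> n%:R * (F (t * A) - F ((t + 3 * w0) * A)) <= e) ->
  prob P bad_generic <= e * (2 + n.+1%:R * F (b * A)) ^+ 2.
Proof.
move=> e_ge0 w00 he.
have mc k a : measurable (cls k a) by exact: measurable_cls.
pose g (p : 'I_n.+1 * node M L) := law (cls p.1 p.2).
have g0 p : 0 <= g p by exact: common_law_ge0.
apply: (@le_trans _ _ (\sum_(p : 'I_n.+1 * node M L) \sum_(q : 'I_n.+1 * node M L) e * (g p * g q))).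
  apply: le_trans (prob_bigsetU_le _ _ _ _) _ => [p|].
    by apply: bigsetU_measurable => q _; exact: bigsetU_measurable.
  apply: ler_sum => p _.
  apply: le_trans (prob_bigsetU_le _ _ _ _) _ => [q|]; first exact: bigsetU_measurable.
  apply: ler_sum => q _.
  apply: le_trans (prob_bigsetU_le _ _ _ _) _ => [j|]; first exact: m3.
  apply: (@le_trans _ _ (\sum_(1 <= j < n | [&& (p.1 < j)%N, (j < q.1)%N & lambda / 2 <= nodeu q.2 - nodeu p.2]) (e / n%:R) * (g p * g q))).
    apply: ler_sum => j /and3P[pj jq _].
    rewrite (prob_indep3 iidX) // -/(g p) -/(g q) mulrAC [leRHS]mulrC ler_wpM2l ?mulr_ge0 //.
    rewrite law_ln_norm_in; last by rewrite ler_pM2r // lerDl mulr_ge0 // ltW.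
    by rewrite ler_pdivlMr ?ltr0n // mulrC; apply: he; rewrite le_max lexx.
  rewrite -mulr_suml ler_wpM2r ?mulr_ge0 // big_mkcond /=.
  apply: (@le_trans _ _ (\sum_(1 <= j < n) e / n%:R)).
    by apply: ler_sum => j _; case: ifP => // _; rewrite divr_ge0.
  rewrite sumr_const_nat -[leLHS]mulr_natl mulrCA -[leRHS]mulr1 ler_wpM2l //.
  by rewrite ler_pdivrMr ?ltr0n // mul1r ler_nat leq_subr.
have -> : \sum_(p : 'I_n.+1 * node M L) \sum_(q : 'I_n.+1 * node M L) e * (g p * g q) =
    e * (\sum_p g p) ^+ 2.
  rewrite expr2 mulr_suml mulr_sumr; apply: eq_bigr => p _.
  by rewrite mulr_sumr mulr_sumr.
rewrite ler_wpM2l // lerXn2r ?nnegrE ?sumr_ge0 ?addr_ge0 ?mulr_ge0 //.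
rewrite -(pair_bigA _ (fun (k : 'I_n.+1) a => law (cls k a))) /=.
apply: (@le_trans _ _ (\sum_(k < n.+1) ((k == 0%N :> nat)%:R + (k == n :> nat)%:R + F (b * A)))).
  apply: ler_sum => k _; apply: le_trans (sum_cls _) _; first by rewrite -ltnS.
  have := F0 (b * A); case: (k == 0%N :> nat); case: (k == n :> nat) => /= FF; lra.
rewrite !big_split /= sumr_const card_ord mulr_natl lerD2r.
rewrite big_ord_recl /= big1 // addr0 lerD //.
rewrite big_ord_recr /= eqxx big1 ?add0r // => k _.
by rewrite ltn_eqF.
Qed.

Hypotheses (lambda0 : 0 < lambda)
  (deltaE : delta = lambda / 2 * w0) (w0eta : eta <= w0).

Lemma good_outside_bad w : ~ bad w ->
  good_configuration M L lb n eta A h kappa lambda delta (fun k => X k w).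
Proof.
move=> nb.
have [[[[[[[n1 n2] n3] n4] n5] n6] n7] n8] : ((((((( ~ bad_zero w /\ ~ bad_end w) /\
  ~ bad_low w) /\ ~ bad_left w) /\ ~ bad_right w) /\ ~ bad_top w) /\ ~ bad_sep w) /\ ~ bad_generic w).
  do 7?split; apply: contra_not nb; rewrite /bad => hb; do ?[by right|left]; exact: hb.
split.
- move=> k kn; apply/eqP => Xk; apply: n1.
  by apply: (@mem_bigsetU _ _ _ _ _ k) => //; rewrite mem_index_iota ltnS.
- rewrite /log_abs; split; rewrite leNgt; apply/negP => hX; apply: n2; [left|right]; right; exact: hX.
- apply: contrapT => hX; apply: n3 => k; rewrite /= mem_index_iota => kn hk.
  by apply: hX; exists k.
- move=> k kn kk; rewrite leNgt; apply/negP => hX; apply: n4.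
  by apply: (@mem_bigsetU _ _ _ _ _ k) => //; rewrite mem_index_iota.
- move=> k kn kk; rewrite leNgt; apply/negP => hX; apply: n5.
  by apply: (@mem_bigsetU _ _ _ _ _ k) => //; rewrite mem_index_iota.
- move=> k kn; rewrite leNgt; apply/negP => hX; apply: n6.
  by apply: (@mem_bigsetU _ _ _ _ _ k) => //; rewrite mem_index_iota.
- move=> i j i0 /andP[ij jn] hi hj; rewrite leNgt; apply/negP => hX; apply: n7.
  apply: (@mem_bigsetU _ _ _ _ _ i) => //.
    by rewrite mem_index_iota i0 (ltn_trans ij).
  by apply: (@mem_bigsetU _ _ _ _ _ j) => //; rewrite mem_index_iota ij.
- move=> i j k a1 a2 a3 ij jk kn c1 c2 c3 sep; rewrite leNgt; apply/negP => hX; apply: n8.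
  have i_n : (i < n.+1)%N by rewrite ltnS ltnW // (ltn_trans ij) // (leq_trans jk).
  have kn1 : (k < n.+1)%N by rewrite ltnS.
  apply: (@mem_bigsetU _ _ _ _ _ (Ordinal i_n, a1)) => //; first exact: mem_index_enum.
  apply: (@mem_bigsetU _ _ _ _ _ (Ordinal kn1, a3)) => //; first exact: mem_index_enum.
  apply: (@mem_bigsetU _ _ _ _ _ j) => /=.
  + by rewrite mem_index_iota (leq_ltn_trans (leq0n i) ij) (leq_trans jk).
  + by rewrite ij jk sep.
  split => //; split => //=; rewrite /window /=.
  have j0 : (j == 0%N) = false by rewrite gtn_eqF // (leq_ltn_trans (leq0n i) ij).
  have jn : (j == n) = false by rewrite ltn_eqF // (leq_trans jk).
  move: c2 => /and4P[_ _ /eqP cj]; rewrite /level j0 jn /= => /and3P[_ lba /andP[l1 l2]].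
  have uc : 0 < nodeu a3 - nodeu a1 by move: lambda0 sep; lra.
  set t := line_at a1 a3 j.
  (* The orientation is the width times the vertical distance from the line to the middle node; the
     width being at least [lambda / 2], an orientation below [delta] puts the node within [w0] of
     the line. *)
  have tE : node_orient eta a1 a2 a3 = (nodeu a3 - nodeu a1) * (t - nodev a2).
    rewrite /t /line_at -cj -/(nodeu a2) /node_orient /orient; field; rewrite gt_eqF //.
  have ht : `|t - nodev a2| < w0.
    rewrite tE normrM (gtr0_norm uc) deltaE in hX.
    have : lambda / 2 * `|t - nodev a2| <= (nodeu a3 - nodeu a1) * `|t - nodev a2|.
      by rewrite ler_wpM2r.
    have l20 : 0 < lambda / 2 by move: lambda0; lra.
    by move=> /le_lt_trans /(_ hX); rewrite (ltr_pM2l l20).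
  have v2 : (node_lev a2)%:R * eta = nodev a2 by [].
  have v3 : (node_lev a2).+1%:R * eta = nodev a2 + eta by rewrite -natr1 mulrDl mul1r.
  move: ht; rewrite ltr_norml => /andP[t1 t2].
  rewrite v2 in l1; rewrite v3 in l2.
  have bv : b <= nodev a2 by rewrite /b /node_v ler_pM2r // ler_nat.
  have [tb|tb] := leP b (t - w0).
    apply/andP; split.
      by apply: le_lt_trans l1; rewrite ler_pM2r //; lra.
    by apply: le_trans l2 _; rewrite ler_pM2r //; move: w0eta; lra.
  apply/andP; split.
    by apply: le_lt_trans l1; rewrite ler_pM2r.
  by apply: le_trans l2 _; rewrite ler_pM2r //; move: w0eta; lra.
Qed.

End BadEvents.

(* Each of the last five fields bounds the limiting probability of one family of bad events; the
   parameters can be chosen in the order [h], [kappa], [lambda], [w0], [lb], [L], [M]. *)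
Record scheme (R : realType) (alpha e : R) (M L lb : nat) (eta h kappa lambda w0 : R) : Prop :=
  Scheme {
  sc_M : (0 < M)%N;
  sc_L : (0 < L)%N;
  sc_lb : (0 < lb)%N;
  sc_eta : 0 < eta;
  sc_h : 0 < h;
  sc_kappa : 0 < kappa < 1;
  sc_lambda : 0 < lambda <= kappa;
  sc_w0 : 0 < w0;
  sc_eta_w0 : eta <= w0;
  sc_b : lb%:R * eta = h / 2 * kappa;
  sc_M_lambda : 4 / M%:R <= lambda;
  sc_pert : 4 * M%:R^-1 * ((L%:R + 1) * eta) + 4 * eta <= lambda / 2 * w0 / 2;
  sc_low : exists2 K, expR (- K) <= e & K + 1 < h `^ (- alpha);
  sc_start : potter_const alpha / (2 - potter_const alpha) * (2 * kappa) *
    (h / 2 * kappa) `^ (- alpha) < e;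
  sc_top : (L%:R * eta) `^ (- alpha) < e;
  sc_sep : lambda * ((lb%:R * eta) `^ (- alpha) + 1) ^+ 2 <= e;
  sc_window : exists2 e', 0 < e' /\ e' * (3 + (lb%:R * eta) `^ (- alpha) + 1) ^+ 2 <= e &
    (lb%:R * eta) `^ (- alpha) * (4 * w0 / (lb%:R * eta)) < e'
}.

Lemma scheme_exists (R : realType) (alpha e : R) : 0 < alpha < 1 -> 0 < e ->
  exists M L lb eta h kappa lambda w0, @scheme R alpha e M L lb eta h kappa lambda w0.
Proof.
move=> alpha01 e0; have /andP[alpha0 alpha1] := alpha01.
have c0 : 0 < potter_const alpha by rewrite /potter_const powR_gt0.
have c2 := potter_const_lt2 alpha01.
set C := potter_const alpha / (2 - potter_const alpha).
have C0 : 0 < C by rewrite divr_gt0 // subr_gt0.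
(* Chosen so that [h^(- alpha) = e^-1 + 2]: the limiting mean number of points above [h] exceeds
   [K + 1] for [K = e^-1], and [exp (- K) <= e]. *)
pose h : R := (e^-1 + 2) `^ (- alpha^-1).
have K0 : 0 < e^-1 + 2 by rewrite addr_gt0 // invr_gt0.
have h0 : 0 < h by rewrite powR_gt0.
have hE : h `^ (- alpha) = e^-1 + 2.
  by rewrite /h -powRrM mulrN mulNr opprK mulVf ?gt_eqF // powRr1 // ltW.
have h20 : 0 < h / 2 by rewrite divr_gt0.
have [kappa k01 hkappa] : exists2 k, 0 < k < 1 & C * (2 * k) * (h / 2 * k) `^ (- alpha) < e.
  have CC0 : 0 < C * 2 * (h / 2) `^ (- alpha) by rewrite mulr_gt0 ?powR_gt0 // mulr_gt0.
  have [k k01 hk] := powRN_steep alpha01 CC0 (divr_gt0 e0 (ltr0Sn R 1)).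
  exists k => //; have /andP[k0 _] := k01.
  rewrite powRM ?(ltW h20) ?(ltW k0) //.
  have -> : C * (2 * k) * ((h / 2) `^ (- alpha) * k `^ (- alpha)) =
    C * 2 * (h / 2) `^ (- alpha) * k * k `^ (- alpha) by ring.
  by apply: le_lt_trans hk _; lra.
have /andP[k0 k1] := k01.
pose b := h / 2 * kappa; have b0 : 0 < b by rewrite mulr_gt0.
pose B := b `^ (- alpha); have B0 : 0 < B by rewrite powR_gt0.
pose lambda := Num.min kappa (e / (B + 1) ^+ 2).
have l0 : 0 < lambda by rewrite lt_min k0 divr_gt0 // exprn_gt0 // addr_gt0.
have lB : lambda * (B + 1) ^+ 2 <= e.
  by rewrite -ler_pdivlMr ?exprn_gt0 ?addr_gt0 // ge_min lexx orbT.
pose e' := e / (3 + B + 1) ^+ 2.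
have e'0 : 0 < e' by rewrite divr_gt0 // exprn_gt0 // !addr_gt0.
(* Makes the limiting mass of a window equal to [e' / 2]. *)
pose w0 := e' * b / (8 * B).
have w00 : 0 < w0 by rewrite divr_gt0 // mulr_gt0.
pose delta := lambda / 2 * w0.
have d0 : 0 < delta by rewrite mulr_gt0 // divr_gt0.
(* [eta] is [b] divided by an integer, so that [b] is exactly a level of the grid; the two summands
   ensure [eta <= w0] and [16 eta <= delta]. *)
pose lb := (Num.truncn (b / w0 + 16 * b / delta)).+1.
have hlb : b / w0 + 16 * b / delta < lb%:R by exact: truncnS_gt.
pose eta := b / lb%:R; have lb0 : 0 < lb%:R :> R by rewrite ltr0n.
have eta0 : 0 < eta by rewrite divr_gt0.
have bE : lb%:R * eta = b by rewrite mulrC divfK // gt_eqF.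
have t1 : 0 < b / w0 by rewrite divr_gt0.
have t2 : 0 < 16 * b / delta by rewrite divr_gt0 // mulr_gt0.
have etaw : eta <= w0.
  by rewrite ler_pdivrMr // mulrC -ler_pdivrMr //; move: hlb t2; lra.
have etad : 16 * eta <= delta.
  by rewrite mulrA ler_pdivrMr // [leRHS]mulrC -ler_pdivrMr //; move: hlb t1; lra.
have [H H0 hH] := powRN_small alpha01 (divr_gt0 e0 (ltr0Sn R 1)).
pose L := (Num.truncn (H / eta)).+1.
have hL : H < L%:R * eta by rewrite -ltr_pdivrMr // truncnS_gt.
have L0 : 0 < L%:R :> R by rewrite ltr0n.
(* With this lower bound on [M], the errors from the columns and from the levels each use at most
   [delta / 4]. *)
pose q := 16 * ((L%:R + 1) * eta) / delta.
have q0 : 0 < q by rewrite divr_gt0 // mulr_gt0 // mulr_gt0 // addr_gt0.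
pose M := (Num.truncn (4 / lambda + q)).+1.
have hM : 4 / lambda + q < M%:R by exact: truncnS_gt.
have M0 : 0 < M%:R :> R by rewrite ltr0n.
have l40 : 0 < 4 / lambda by rewrite divr_gt0.
exists M, L, lb, eta, h, kappa, lambda, w0; split => //.
- by rewrite l0 ge_min lexx.
- by rewrite ler_pdivrMr // [leRHS]mulrC -ler_pdivrMr //; move: hM q0; lra.
- have : 4 * M%:R^-1 * ((L%:R + 1) * eta) <= delta / 4.
    rewrite -(@ler_pM2r _ M%:R) //.
    have -> : 4 * M%:R^-1 * ((L%:R + 1) * eta) * M%:R = 4 * ((L%:R + 1) * eta).
      by field; rewrite gt_eqF.
    have : q <= M%:R by move: hM l40; lra.
    by rewrite /q ler_pdivrMr // mulrC; lra.
  by move: etad; rewrite -/delta; lra.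
- exists e^-1; last by rewrite hE; lra.
  rewrite expRN invf_ple ?posrE ?expR_gt0 //.
  by apply: le_trans (expR_ge1Dx _); rewrite lerDr.
- apply: le_lt_trans (_ : e / 2 < e); last by lra.
  by apply: le_trans hH; apply: (powRN_le alpha01) => //; exact: ltW.
- by rewrite bE.
- exists e'; first by rewrite bE /e' divfK ?gt_eqF // exprn_gt0 // !addr_gt0.
  rewrite bE -/B /w0.
  have -> : B * (4 * (e' * b / (8 * B)) / b) = e' / 2 by field; rewrite !gt_eqF.
  by lra.
Qed.

Record log_heavy (d : measure_display) (T : measurableType d) (R : realType)
    (P : probability T R) (X : nat -> {RV P >-> R}) (alpha : R) : Prop := LogHeavy {
  lh_alpha : 0 < alpha < 1;
  lh_iid : iid X;
  lh_zero : common_law X [set 0 : R] = 0;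
  lh_pos : forall t : R, 0 < log_tail X t;
  lh_rv : forall l : R, 0 < l ->
    log_tail X (l * t) / log_tail X t @[t --> +oo] --> l `^ (- alpha)
}.

(** * Bad configurations are rare for large degrees *)

Section BadProbability.
Variables (d : measure_display) (T : measurableType d) (R : realType).
Variables (P : probability T R) (X : nat -> {RV P >-> R}) (alpha : R).
Hypothesis hX : log_heavy X alpha.
Let F := log_tail X.
Let a := tail_quantile F.
Let alpha01 := lh_alpha hX.
Let F0 := lh_pos hX.
Let Fni : forall s t : R, s <= t -> F t <= F s := log_tail_ni X.
Let Frv := lh_rv hX.

Let tail_le (t e : R) : 0 < t -> t `^ (- alpha) < e ->
  \forall n \near \oo, n%:R * F (t * a n) <= e.
Proof.
move=> t0 te; have := cvgr_lt _ (tail_quantile_rv alpha01 F0 Fni Frv t0) _ te.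
by move=> h; near=> n; apply: ltW; near: n; exact: h.
Unshelve. all: by end_near.
Qed.

Let tail_ge (t e : R) : 0 < t -> e < t `^ (- alpha) ->
  \forall n \near \oo, e <= n%:R * F (t * a n).
Proof.
move=> t0 te; have := cvgr_gt _ (tail_quantile_rv alpha01 F0 Fni Frv t0) _ te.
by move=> h; near=> n; apply: ltW; near: n; exact: h.
Unshelve. all: by end_near.
Qed.

Variables (e : R) (M L lb : nat) (eta h kappa lambda w0 : R).
Hypothesis sc : scheme alpha e M L lb eta h kappa lambda w0.

Let F1 t : F t <= 1. Proof. exact: common_law_le1 (measurable_ln_norm_gt t). Qed.

Let sup_an : \forall n \near \oo, 0 < a n.
Proof.
have := tail_quantile_cvgy alpha01 F0 Fni Frv.
by move=> /cvgryPgt /(_ 0).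
Qed.

Lemma near_prob_bad_le : 0 < e ->
  \forall n \near \oo, prob P (bad X M L lb n eta (a n) h kappa lambda w0) <= 7 * e.
Proof.
move=> e0.
have [K eK hK] := sc_low sc.
have [e' [e'0 he'] hw] := sc_window sc.
have b0 : 0 < lb%:R * eta by rewrite mulr_gt0 ?(sc_eta sc) // ltr0n (sc_lb sc).
have L0 : 0 < L%:R * eta by rewrite mulr_gt0 ?(sc_eta sc) // ltr0n (sc_L sc).
have h0 := sc_h sc; have h40 : 0 < h / 4 by rewrite divr_gt0.
have h20 : 0 < h / 2 by rewrite divr_gt0.
have /andP[k0 _] := sc_kappa sc.
have /andP[l0 _] := sc_lambda sc.
set B := (lb%:R * eta) `^ (- alpha) in he' hw.
have Bsep := sc_sep sc; rewrite -/B in Bsep.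
have [t0 ht0] := law_ends_small (lh_zero hX) (divr_gt0 e0 (ltr0Sn R 1)).
have nbot := tail_le L0 (sc_top sc).
have B1 : B < B + 1 by rewrite ltrDl.
have nB := tail_le b0 B1.
have nlow := tail_ge h0 hK.
have nstart := rv_start_sum alpha01 F0 Fni Frv h20 k0 (sc_start sc).
have nwin := rv_window alpha01 F0 Fni Frv b0 e'0 (sc_w0 sc) hw.
have nslope := tail_quantile_slope_large alpha01 F0 Fni Frv (t0 / (h / 4)).
near=> n.
have an0 : 0 < a n by near: n.
have n0 : (0 < n)%N by near: n; exact: nbhs_infty_ge.
have bB : n%:R * F (lb%:R * eta * a n) <= B + 1.
  by near: n.
apply: le_trans (prob_bad_le X M L lb n eta (a n) h kappa lambda w0) _.
rewrite (prob_bad_zero (lh_iid hX) (lh_zero hX)) add0r.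
suff [[q1 q2 q3] [q4 q5 q6 q7]] :
  [/\ prob P (bad_end X n (a n) h) <= e, prob P (bad_low X n (a n) h) <= e &
      prob P (bad_left X n (a n) h kappa) <= e] /\
  [/\ prob P (bad_right X n (a n) h kappa) <= e, prob P (bad_top X L n eta (a n)) <= e,
      prob P (bad_sep X lb n eta (a n) lambda) <= e &
      prob P (bad_generic X M L lb n eta (a n) lambda w0) <= e].
  by move: q1 q2 q3 q4 q5 q6 q7; lra.
split; split.
- apply: le_trans (prob_bad_end (lh_iid hX) _ _ _) _.
  rewrite mulrC -ler_pdivlMr //; apply: ht0.
  by rewrite mulrC -ler_pdivrMr //; near: n.
- apply: le_trans (prob_bad_low (lh_iid hX) _ _ _) _; apply: le_trans eK.
  rewrite ler_expR lerN2.
  (* There are [n - 1] interior indices, and the missing [F <= 1] is paid by the additional 1 in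
     [K + 1]. *)
  have : K + 1 <= n%:R * F (h * a n) by near: n.
  have := F1 (h * a n).
  by rewrite -[X in X%:R * _](prednK n0) -natr1 mulrDl mul1r -/F; lra.
- by apply: le_trans (prob_bad_left (lh_iid hX) _ _ _ _) _; near: n.
- by apply: le_trans (prob_bad_right (lh_iid hX) _ _ _ _) _; near: n.
- by apply: le_trans (prob_bad_top (lh_iid hX) _ _ _ _) _; near: n.
- apply: le_trans (prob_bad_sep (lh_iid hX) _ _ _ _ (ltW l0)) _.
  apply: le_trans Bsep; rewrite -/F.
  have -> : n%:R * (lambda * n%:R) * F (lb%:R * eta * a n) ^+ 2 =
    lambda * (n%:R * F (lb%:R * eta * a n)) ^+ 2 by ring.
  rewrite ler_pM2l // lerXn2r ?nnegrE ?mulr_ge0 ?(ltW (F0 _)) //.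
  by rewrite addr_ge0 // powR_ge0.
- apply: le_trans (prob_bad_generic (lh_iid hX) _ _ _ an0 n0 (sc_eta sc) (ltW e'0) (sc_w0 sc) _) _.
    by near: n.
  apply: le_trans he'; rewrite ler_pM2l //.
  have u0 : 0 <= 2 + n.+1%:R * F (lb%:R * eta * a n).
    by rewrite addr_ge0 // mulr_ge0 // (ltW (F0 _)).
  (* The two ends, then [n F <= B + 1], then one more [F <= 1]: hence the constant [3 + B + 1] in
     the scheme. *)
  have u1 : 2 + n.+1%:R * F (lb%:R * eta * a n) <= 3 + B + 1.
    have := F1 (lb%:R * eta * a n).
    by move: bB; rewrite -[n.+1%:R]natr1 mulrDl mul1r; lra.
  have u2 := le_trans u0 u1.
  by rewrite lerXn2r // nnegrE.
Unshelve. all: by end_near. Qed.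

Lemma near_good_scale : \forall n \near \oo, exists D,
  good_scale M L lb n eta (a n) D h kappa lambda (lambda / 2 * w0).
Proof.
have /andP[k0 k1] := sc_kappa sc; have /andP[l0 _] := sc_lambda sc.
have h40 : 0 < h / 4 by rewrite divr_gt0 ?(sc_h sc).
pose del := lambda / 2 * w0; have d0 : 0 < del by rewrite !mulr_gt0 // ?divr_gt0 ?(sc_w0 sc).
have d20 : 0 < del / 2 by rewrite divr_gt0.
pose m := Num.min (h / 4) (del / 2); have m0 : 0 < m by rewrite lt_min h40.
have nexp := tail_quantile_slope_exp alpha01 F0 Fni Frv (divr_gt0 m0 (ltr0Sn R 1)).
near=> n.
have an0 : 0 < a n by near: n.
have n0 : (0 < n)%N by near: n; exact: nbhs_infty_ge.
have n0R : 0 < n%:R :> R by rewrite ltr0n.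
have nn (z : R) : (Num.truncn z < n)%N -> z <= n%:R.
  by move=> zn; apply: le_trans (ltW (truncnS_gt z)) _; rewrite ler_nat.
(* The smaller of the two margins: the distance [h / 4 s] of low points, and the margin
   [delta / 2 a n] of peaks, weakened here by the factor [1 / n]. *)
exists (m * (a n / n%:R)); split => //.
- exact: sc_eta sc.
- exact: sc_M sc.
- exact: sc_L sc.
- exact: sc_h sc.
- exact: sc_kappa sc.
- exact: sc_b sc.
- exact: sc_lambda sc.
- exact: sc_M_lambda sc.
- by apply: nn; near: n; exact: nbhs_infty_ge.
- by rewrite [leRHS]mulrC -ler_pdivrMr //; apply: nn; near: n; exact: nbhs_infty_ge.
- by rewrite ler_pdivrMr // [leRHS]mulrC -ler_pdivrMr ?(sc_eta sc) //; apply: nn; near: n; exact: nbhs_infty_ge.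
- exact: sc_pert sc.
- by rewrite mulr_gt0 // divr_gt0.
- by rewrite ler_pM2r ?divr_gt0 // ge_min lexx.
- apply: (@le_trans _ _ (del / 2 * (a n / n%:R))).
    by rewrite ler_pM2r ?divr_gt0 // ge_min lexx orbT.
  by rewrite ler_pM2l // ler_pdivrMr // ler_peMr ?ler1n // ltW.
- by rewrite mulrAC; near: n.
Unshelve. all: by end_near. Qed.

Lemma roots_pattern_outside_bad : \forall n \near \oo, forall w,
  ~ bad X M L lb n eta (a n) h kappa lambda w0 w ->
  nb_real_roots (random_poly X n w) =
  pattern_roots eta (pattern M L eta lb n (a n) (fun k => X k w)).
Proof.
have /andP[l0 _] := sc_lambda sc.
near=> n => w hw.
have an0 : 0 < a n by near: n.
have [D gs] : exists D, good_scale M L lb n eta (a n) D h kappa lambda (lambda / 2 * w0).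
  by near: n; exact: near_good_scale.
apply: nb_real_roots_pattern gs _.
by apply: (good_outside_bad an0 (sc_eta sc) l0 _ (sc_eta_w0 sc) hw).
Unshelve. all: by end_near. Qed.

End BadProbability.

(** * Limit law of the grid configuration *)

Lemma prob_bigsetU (d : measure_display) (T : measurableType d) (R : realType)
    (P : probability T R) (I : eqType) (s : seq I) (Q : pred I) (A : I -> set T) :
  uniq s -> (forall i, measurable (A i)) ->
  (forall i j w, A i w -> A j w -> i = j) ->
  prob P (\big[setU/set0]_(i <- s | Q i) A i) = \sum_(i <- s | Q i) prob P (A i).
Proof.
move=> + mA Adis; elim: s => [|i s IH] /=; first by rewrite !big_nil prob_set0.
move=> /andP[is_ us]; rewrite !big_cons; case: ifP => Qi; last exact: IH.
have mU : measurable (\big[setU/set0]_(j <- s | Q j) A j) by exact: bigsetU_measurable.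
rewrite -(IH us) (prob_setDI P (measurableU _ _ (mA i) mU) (mA i)).
congr (prob P _ + prob P _); apply/seteqP; split => w //=.
- by move=> [_ ].
- by move=> Aiw; split => //; left.
- by move=> [[//|]].
- move=> hw; split; first by right.
  move=> Aiw; move: hw; rewrite -big_filter => hw.
  have [j js Ajw] : exists2 j, j \in s & A j w.
    move: hw; rewrite big_filter; elim: (s) => [|j s' IH']; first by rewrite big_nil.
    rewrite big_cons; case: ifP => _; last first.
      by move=> /IH'[l ls Al]; exists l => //; rewrite inE ls orbT.
    move=> [Aj|/IH'[l ls Al]]; first by exists j => //; exact: mem_head.
    by exists l => //; rewrite inE ls orbT.
  by rewrite (Adis _ _ _ Aiw Ajw) js in is_.
Qed.

(** * The law of a random finite set from its void probabilities *)

Section Sieve.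
Variables (R : realType) (I : finType).
Implicit Types (V : {set I} -> R) (U : seq I) (S Z : {set I}).

(* Inclusion-exclusion: recovers the law of a random set from its void probabilities [V]. *)
Fixpoint sieve V U S : R :=
  if U is a :: U' then sieve V U' S - sieve V U' (a |: S) else V S.

Lemma sieve_cvg (V_ : nat -> {set I} -> R) V U S :
  (forall S', V_ n S' @[n --> \oo] --> V S') ->
  sieve (V_ n) U S @[n --> \oo] --> sieve V U S.
Proof.
by move=> hV; elim: U S => [|a U IH] S /=; [exact: hV|apply: cvgB; exact: IH].
Qed.

Lemma subset_setCU1 (Y : {set I}) a S :
  (Y \subset ~: (a |: S)) = (a \notin Y) && (Y \subset ~: S).
Proof. by rewrite finset.setCU finset.subsetI [X in X && _]finset.subsetC finset.sub1set inE. Qed.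

Variables (d : measure_display) (T : measurableType d) (P : probability T R).
Variable Y : T -> {set I}.
Hypothesis measurable_void : forall S, measurable [set w | Y w \subset ~: S].

(** [Y] contains [U] and avoids [S]. Removing the case where [Y] also avoids [a] leaves the case
    where it contains [a]: this is the recursion of [sieve]. *)
Let event U S := [set w | all [in Y w] U && (Y w \subset ~: S)].

Let eventS a U S : event U S `&` event U (a |: S) = event U (a |: S) /\
  event U S `\` event U (a |: S) = event (a :: U) S.
Proof.
split; apply/seteqP; split => w; rewrite /event /= subset_setCU1.
- by move=> [].
- by move=> /and3P[-> -> ->].
- by move=> [/andP[-> ->] /negP]; rewrite /= !andbT negbK.
- by move=> /andP[/andP[-> ->] ->]; split.
Qed.

Lemma measurable_event U S : measurable (event U S).
Proof.
elim: U S => [|a U IH] S; first exact: measurable_void.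
by have [_ <-] := eventS a U S; exact: measurableD.
Qed.

Lemma prob_event U S :
  prob P (event U S) = sieve (fun S' => prob P [set w | Y w \subset ~: S']) U S.
Proof.
elim: U S => [//|a U IH] S /=; have [h1 h2] := eventS a U S.
rewrite -!IH (prob_setDI P (measurable_event U S) (measurable_event U (a |: S))).
by rewrite h1 h2 addrC addKr.
Qed.

Lemma set_eventE Z : [set w | Y w = Z] = event (enum Z) (~: Z).
Proof.
apply/seteqP; split => w; rewrite /event /= finset.setCK.
  by move=> ->; rewrite subxx andbT; apply/allP => a; rewrite mem_enum.
move=> /andP[/allP ZY YZ].
apply/eqP; rewrite finset.eqEsubset YZ /=; apply/fintype.subsetP => a aZ.
by apply: ZY; rewrite mem_enum.
Qed.

Lemma random_set_inE (Q : pred {set I}) :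
  [set w | Q (Y w)] = \big[setU/set0]_(Z <- index_enum {set I} | Q Z) [set w | Y w = Z].
Proof.
apply/seteqP; split => w /=.
  by move=> QY; apply: (@mem_bigsetU _ _ _ _ _ (Y w)) => //; exact: mem_index_enum.
elim/big_rec: _ => [//|Z x QZ IH [/= ->//|]]; exact: IH.
Qed.

Lemma measurable_random_set_in (Q : pred {set I}) : measurable [set w | Q (Y w)].
Proof.
rewrite random_set_inE; apply: bigsetU_measurable => Z _; rewrite set_eventE.
exact: measurable_event.
Qed.

Lemma prob_random_set_in (Q : pred {set I}) : prob P [set w | Q (Y w)] =
  \sum_(Z | Q Z) sieve (fun S => prob P [set w | Y w \subset ~: S]) (enum Z) (~: Z).
Proof.
rewrite random_set_inE prob_bigsetU ?index_enum_uniq //.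
- by apply: eq_bigr => Z _; rewrite set_eventE prob_event.
- by move=> Z; rewrite set_eventE; exact: measurable_event.
- by move=> Z Z' w /= <-.
Qed.

End Sieve.

(** * Poisson limit of products *)

Section PoissonLimit.
Variable R : realType.

(** Factor by factor, [1 - x] is at most [exp (- x)] and at least [exp (- x / (1 - x))]. *)
Lemma prod_onem_bounds (I : Type) (s : seq I) (Q : pred I) (x : I -> R) (del : R) :
  del < 1 -> (forall i, Q i -> 0 <= x i <= del) ->
  expR (- ((\sum_(i <- s | Q i) x i) / (1 - del))) <= \prod_(i <- s | Q i) (1 - x i)
    <= expR (- \sum_(i <- s | Q i) x i).
Proof.
move=> d1 hx; have d0 : 0 < 1 - del by rewrite subr_gt0.
apply/andP; split.
  rewrite mulr_suml -sumrN expR_sum; apply: ler_prod => i Qi; rewrite expR_ge0 /=.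
  have /andP[x0 xd] := hx i Qi; have x1 : 0 < 1 - x i by lra.
  have : x i / (1 - x i) <= x i / (1 - del).
    by rewrite ler_wpM2l // lef_pV2 ?posrE //; lra.
  rewrite expRN invf_ple ?posrE ?expR_gt0 // => h.
  apply: le_trans (expR_ge1Dx _); apply: le_trans (lerD (lexx 1) h).
  by rewrite le_eqVlt; apply/orP; left; apply/eqP; field; rewrite gt_eqF.
rewrite -sumrN expR_sum; apply: ler_prod => i Qi.
have /andP[x0 xd] := hx i Qi.
by rewrite subr_ge0 (le_trans xd (ltW d1)) expR_ge1Dx.
Qed.

(** Poisson approximation: independent events that are uniformly rare, of total mean tending to [s],
    all fail with probability tending to [exp (- s)]. *)
Lemma prod_onem_cvg (x : nat -> nat -> R) (del : nat -> R) (s : R) :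
  (\forall n \near \oo, forall k, (0 < k < n)%N -> 0 <= x n k <= del n) ->
  del n @[n --> \oo] --> 0 ->
  \sum_(1 <= k < n) x n k @[n --> \oo] --> s ->
  \prod_(1 <= k < n) (1 - x n k) @[n --> \oo] --> expR (- s).
Proof.
move=> hx hd hs.
apply: (@squeeze_cvgr _ _ _ _ (fun n => expR (- ((\sum_(1 <= k < n) x n k) / (1 - del n))))
  (fun n => expR (- \sum_(1 <= k < n) x n k))).
- have h1 := cvgr_lt _ hd _ (ltr01 : 0 < 1 :> R).
  near=> n; rewrite !big_nat; apply: prod_onem_bounds.
    by near: n; exact: h1.
  by near: n.
- apply: continuous_cvg; first exact: continuous_expR.
  rewrite -[X in _ --> - X]divr1; apply: cvgN; apply: cvgM => //.
  apply: cvgV; first by rewrite oner_neq0.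
  rewrite -[X in _ --> X](subr0 (1 : R)).
  by apply: cvgB => //; exact: cvg_cst.
- by apply: continuous_cvg; [exact: continuous_expR|exact: cvgN].
Unshelve. all: by end_near. Qed.

End PoissonLimit.

Lemma cvg_near_eq (R : realType) (u v : nat -> R) (l : R) :
  (\forall n \near \oo, u n = v n) -> u n @[n --> \oo] --> l -> v n @[n --> \oo] --> l.
Proof. by move=> uv; apply: cvg_trans; apply: near_eq_cvg. Qed.

Lemma near_parity (o : bool) (Q : nat -> Prop) :
  (\forall n \near \oo, Q n) -> \forall j \near \oo, Q (2 * j + o)%N.
Proof.
move=> [N _ NQ]; exists N => // j /= Nj; apply: NQ => /=.
by apply: leq_trans Nj _; rewrite mul2n -addnn -addnA leq_addr.
Qed.

Lemma cvg_sum_seq (R : realType) (I : Type) (r : seq I) (Q : pred I) (f : nat -> I -> R) (g : I -> R) :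
  (forall i, Q i -> f n i @[n --> \oo] --> g i) ->
  \sum_(i <- r | Q i) f n i @[n --> \oo] --> \sum_(i <- r | Q i) g i.
Proof. by move=> h; apply: cvg_big => //; exact: add_continuous. Qed.

(** * The limit law of the pattern *)

Section PatternLaw.
Variables (R : realType) (M L lb : nat) (eta alpha c p : R).
Hypotheses (M0 : (0 < M)%N) (lb0 : (0 < lb)%N) (eta0 : 0 < eta).
Implicit Types (S Z : {set node M L}) (a : node M L).

(** The mass of a level under the measure with tail [t^(- alpha)], shared between the signs
    according to [c]: it will be the limit of [n] times the probability of this sign and level. *)
Definition level_weight (s : bool) (l : nat) : R :=
  (if s then c else 1 - c) * ((l%:R * eta) `^ (- alpha) - (l.+1%:R * eta) `^ (- alpha)).

(** A column holds about [n / M] indices, half of them of each parity, whence the divisor [2 M]. *)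
Definition node_weight a : R :=
  if (0 < node_col a < M)%N && (lb <= node_lev a)%N then
    level_weight (node_pos a) (node_lev a) / (2 * M)%:R else 0.

Definition end_weight (i : nat) (o : bool) a : R :=
  if [&& node_odd a == o, node_col a == i & node_lev a == 0%N] then
    (if node_pos a then p else 1 - p) else 0.

(** The two ends keep their exact laws, the interior gives a Poisson void probability. Weights are
    added within one end because the nodes of a given index exclude each other. *)
Definition void_limit (o : bool) S : R :=
  (1 - \sum_(a in S) end_weight 0 false a) * (1 - \sum_(a in S) end_weight M o a) *
  expR (- \sum_(a in S) node_weight a).

Definition pattern_law (o : bool) (Q : pred {set node M L}) : R :=
  \sum_(Z | Q Z) sieve (void_limit o) (enum Z) (~: Z).

Variables (d : measure_display) (T : measurableType d).
Variables (P : probability T R) (X : nat -> {RV P >-> R}).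
Hypothesis hX : log_heavy X alpha.
Let law := common_law X.
Let F := log_tail X.
Let A n := tail_quantile F n.
Let alpha01 := lh_alpha hX.
Let F0 := lh_pos hX.
Let Fni : forall s t : R, s <= t -> F t <= F s := log_tail_ni X.
Let Frv := lh_rv hX.
Let iidX := lh_iid hX.

Definition pos_tail (t : R) : R := law [set r | 0 < r /\ t < ln `|r|].

Hypothesis balance : pos_tail t / F t @[t --> +oo] --> c.
Hypothesis lawp : law [set r | 0 < r] = p.

Let mpos_gt (t : R) : measurable [set r : R | 0 < r /\ t < ln `|r|].
Proof.
exact: (measurableI _ _ (@measurable_pos R) (measurable_ln_norm_gt t)).
Qed.

Let A0 : \forall n \near \oo, 0 < A n.
Proof.
have := tail_quantile_cvgy alpha01 F0 Fni Frv.
by move=> /cvgryPgt /(_ 0).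
Qed.

Lemma pos_tail_rv (t : R) : 0 < t -> n%:R * pos_tail (t * A n) @[n --> \oo] --> c * t `^ (- alpha).
Proof.
move=> t0; have h1 := tail_quantile_rv alpha01 F0 Fni Frv t0.
have h2 : t * A n @[n --> \oo] --> +oo.
  apply/cvgryPgt => K; have := tail_quantile_cvgy alpha01 F0 Fni Frv.
  move=> /cvgryPgt /(_ (K / t)) h; near=> n.
  by rewrite mulrC -ltr_pdivrMr //; near: n; exact: h.
have h3 : pos_tail (t * A n) / F (t * A n) @[n --> \oo] --> c.
  exact: (cvg_comp _ _ h2 balance).
apply: (@cvg_near_eq _ (fun n => pos_tail (t * A n) / F (t * A n) * (n%:R * F (t * A n)))).
  by near=> n; field; rewrite gt_eqF.
exact: cvgM h3 h1.
Unshelve. all: by end_near. Qed.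

Definition level_mass (n : nat) (s : bool) (l : nat) : R :=
  law [set r | s == (0 < r) /\ l%:R * eta * A n < ln `|r| <= l.+1%:R * eta * A n].

Let law_split (B C : set R) : measurable B -> measurable C ->
  law B = law (B `&` C) + law (B `\` C).
Proof.
move=> mB mC; rewrite /law /common_law.
by rewrite (prob_setDI P (measurable_RV X 0 mB) (measurable_RV X 0 mC)).
Qed.

(** The positive sign comes from [pos_tail_rv], the negative one by subtraction from the whole
    level. *)
Lemma level_mass_cvg (s : bool) (l : nat) : (0 < l)%N ->
  n%:R * level_mass n s l @[n --> \oo] --> level_weight s l.
Proof.
move=> l0.
have u0 : 0 < l%:R * eta by rewrite mulr_gt0 // ltr0n.
have v0 : 0 < l.+1%:R * eta by rewrite mulr_gt0 // ltr0n.
have uv : l%:R * eta <= l.+1%:R * eta by rewrite ler_pM2r // ler_nat.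
have hpos : \forall n \near \oo, level_mass n true l = pos_tail (l%:R * eta * A n) - pos_tail (l.+1%:R * eta * A n).
  near=> n; have an0 : 0 < A n by near: n; exact: A0.
  rewrite /pos_tail (law_split (mpos_gt (l%:R * eta * A n)) (mpos_gt (l.+1%:R * eta * A n))).
  rewrite (_ : _ `&` _ = [set r | 0 < r /\ l.+1%:R * eta * A n < ln `|r|]); last first.
    apply/seteqP; split => r /=; first by move=> [].
    move=> [-> h]; split => //; split => //; apply: le_lt_trans h.
    by rewrite ler_pM2r.
  rewrite [X in X - _]addrC addrK; congr law; apply/seteqP; split => r /=.
    move=> [/eqP rp /andP[h1 h2]]; rewrite -rp; split => //.
    by move=> [_]; rewrite ltNge h2.
  move=> [[r0 h1] h2]; rewrite r0 h1; split => //=.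
  by rewrite leNgt; apply/negP => h3; apply: h2.
have hneg : \forall n \near \oo, level_mass n false l =
    F (l%:R * eta * A n) - F (l.+1%:R * eta * A n) - level_mass n true l.
  near=> n; have an0 : 0 < A n by near: n; exact: A0.
  rewrite -law_ln_norm_in; last by rewrite ler_pM2r.
  rewrite -/law (law_split (measurable_ln_norm_in _ _) (@measurable_pos R)).
  rewrite (_ : _ `&` _ = [set r | true == (0 < r) /\ l%:R * eta * A n < ln `|r| <= l.+1%:R * eta * A n]); last first.
    apply/seteqP; split => r /=; first by move=> [-> ->].
    by move=> [/eqP <- ->].
  rewrite [X in X - _]addrC addrK; congr law; apply/seteqP; split => r /=.
    by move=> [/eqP rp ->]; split => //; rewrite -rp.
  by move=> [-> /negP/negbTE ->].
have q1 := pos_tail_rv u0; have q2 := pos_tail_rv v0.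
have q3 : n%:R * level_mass n true l @[n --> \oo] --> level_weight true l.
  rewrite /level_weight mulrBr; apply: cvg_trans (cvgB q1 q2).
  apply: near_eq_cvg; near=> n; rewrite /= -mulrBr; congr (_ * _).
  by apply/esym; near: n; exact: hpos.
case: s => //.
have q4 := tail_quantile_rv alpha01 F0 Fni Frv u0.
have q5 := tail_quantile_rv alpha01 F0 Fni Frv v0.
have -> : level_weight false l = (l%:R * eta) `^ (- alpha) - (l.+1%:R * eta) `^ (- alpha) - level_weight true l.
  by rewrite /level_weight; ring.
apply: cvg_trans (cvgB (cvgB q4 q5) q3).
apply: near_eq_cvg; near=> n; rewrite /= -!mulrBr; congr (_ * _).
by apply/esym; near: n; exact: hneg.
Unshelve. all: by end_near. Qed.

Local Notation cls n k a := [set r : R | @in_class R M L eta lb n (A n) k a r].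

Let law_sign (s : bool) : law [set r | s == (0 < r)] = if s then p else 1 - p.
Proof.
rewrite -lawp; case: s.
  by congr law; apply/seteqP; split => r /= => [/eqP <-|->].
rewrite -(common_law_setC X (@measurable_pos R)); congr law; apply/seteqP; split => r /=.
  by move=> /eqP <-.
by move=> /negP/negbTE ->.
Qed.

Lemma law_class0 n a : (0 < n)%N -> law (cls n 0 a) = end_weight 0 false a.
Proof.
move=> n0; rewrite /end_weight /in_class /level /column /=.
case: ifP => h.
  rewrite -law_sign; congr law; apply/seteqP; split => r /=.
    by move=> /and4P[_ -> _ _].
  by move=> ->; case/and3P: h => -> -> ->.
rewrite (_ : [set _ | _] = set0) ?/law ?/common_law ?preimage_set0 ?prob_set0 //.
apply/seteqP; split => r //= /and4P[h1 _ h2 h3].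
by rewrite h1 h2 h3 in h.
Qed.

Lemma law_classn n a : (0 < n)%N -> law (cls n n a) = end_weight M (odd n) a.
Proof.
move=> n0; rewrite /end_weight /in_class /level /column /= eqxx orbT.
rewrite (negbTE (lt0n_neq0 n0)).
case: ifP => h.
  rewrite -law_sign; congr law; apply/seteqP; split => r /=.
    by move=> /and4P[_ -> _ _].
  by move=> ->; case/and3P: h => -> -> ->.
rewrite (_ : [set _ | _] = set0) ?/law ?/common_law ?preimage_set0 ?prob_set0 //.
apply/seteqP; split => r //= /and4P[h1 _ h2 h3].
by rewrite h1 h2 h3 in h.
Qed.

Local Notation half n := (column_half M n).

Lemma law_class n k a : (0 < k < n)%N -> law (cls n k a) =
  if [&& node_odd a == odd k, node_col a == k %/ (2 * half n),
         2 * half n <= k < 2 * half n * M & lb <= node_lev a]%N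
  then level_mass n (node_pos a) (node_lev a) else 0.
Proof.
move=> /andP[k0 kn].
have k00 : (k == 0%N) = false by rewrite gtn_eqF.
have kn0 : (k == n) = false by rewrite ltn_eqF.
rewrite /in_class /level /column k00 kn0 /=.
case: ifP => h.
  congr law; apply/seteqP; split => r /=.
    by move=> /and4P[_ -> _ /and3P[_ _ ->]].
  by move=> [-> ->]; case/and4P: h => -> -> -> ->.
rewrite (_ : [set _ | _] = set0) ?/law ?/common_law ?preimage_set0 ?prob_set0 //.
apply/seteqP; split => r //= /and4P[h1 _ h2 /and3P[h3 h4 _]].
by rewrite h1 h2 h3 h4 in h.
Qed.

Lemma count_parity (h : nat) (o : bool) : (\sum_(0 <= r < 2 * h) (o == odd r) = h)%N.
Proof.
elim: h => [|h IH]; first by rewrite big_nil.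
have -> : (2 * h.+1 = (2 * h).+2)%N by lia.
rewrite big_nat_recr //= big_nat_recr //= IH mul2n odd_double /=.
by case: (o); rewrite /= ?addn0 ?addn1.
Qed.

(** The even block length makes the count exact, with no boundary term: [half n] indices of each
    parity. For [i = 0] and [i = M] the range condition leaves no index. *)
Lemma count_column n (i : nat) (o : bool) : (0 < half n)%N -> (i <= M)%N ->
  (\sum_(1 <= k < n) [&& o == odd k, i == k %/ (2 * half n) &
    2 * half n <= k < 2 * half n * M] = if 0 < i < M then half n else 0)%N.
Proof.
move=> h0 iM; set h := half n; have h20 : (0 < 2 * h)%N by rewrite muln_gt0.
have hMn : (2 * h * M <= n)%N.
  by rewrite /h /column_half -mulnA [(_ * M)%N]mulnC mulnA mulnC leq_divM.
case: ifP => [/andP[i0 i_M]|hi]; last first.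
  rewrite big_nat big1 // => k _; apply/eqP; rewrite eqb0; apply/negP => /and4P[_ /eqP ik k2 k3].
  move: hi; rewrite ik divn_gt0 // k2 /= ltn_divLR // mulnC k3 //.
have e1 : (2 * h * i < n)%N.
  apply: leq_trans hMn; rewrite ltn_pmul2l //.
have e2 : (2 * h * i.+1 <= n)%N.
  by apply: leq_trans hMn; rewrite leq_pmul2l.
have e3 : (2 * h * i <= 2 * h * i.+1)%N by rewrite leq_pmul2l.
have e0 : (1 <= 2 * h * i)%N by rewrite muln_gt0 h20.
pose g k := [&& o == odd k, i == (k %/ (2 * h))%N & (2 * h <= k < 2 * h * M)%N].
have E1 : (\sum_(1 <= k < 2 * h * i) g k = 0)%N.
  rewrite big_nat big1 // => k /andP[k1 k2]; apply/eqP; rewrite eqb0; apply/negP => /and3P[_ /eqP ik _].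
  by move: k2; rewrite mulnC ltnNge ik leq_divM.
have E2 : (\sum_(2 * h * i.+1 <= k < n) g k = 0)%N.
  rewrite big_nat big1 // => k /andP[k1 k2]; apply/eqP; rewrite eqb0; apply/negP => /and3P[_ /eqP ik _].
  by move: k1; rewrite leqNgt ik mulnC ltn_ceil.
rewrite (big_cat_nat e0 (ltnW e1)) /= E1 add0n (big_cat_nat e3 e2) /= E2 addn0.
rewrite -{1}[(2 * h * i)%N]add0n big_addn -mulnBr subSn // subnn muln1.
rewrite -[RHS](count_parity h o) big_nat [RHS]big_nat; apply: eq_bigr => r /andP[_ rh].
have -> : odd (r + 2 * h * i) = odd r by rewrite oddD -mulnA mul2n odd_double addbF.
have -> : ((r + 2 * h * i) %/ (2 * h) = i)%N by rewrite mulnC divnDMl // divn_small.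
rewrite eqxx /=; congr nat_of_bool.
have -> : (2 * h <= r + 2 * h * i)%N.
  by apply: leq_trans (leq_addl _ _); rewrite leq_pmulr.
have -> : (r + 2 * h * i < 2 * h * M)%N.
  apply: leq_trans (_ : 2 * h * i.+1 <= _)%N; last by rewrite leq_pmul2l.
  by rewrite mulnS ltn_add2r.
by rewrite !andbT.
Qed.

Lemma column_half_cvg : (half n)%:R / n%:R @[n --> \oo] --> ((2 * M)%:R^-1 : R).
Proof.
have M20 : (0 < 2 * M)%N by rewrite muln_gt0.
have M20R : 0 < (2 * M)%:R :> R by rewrite ltr0n.
have inv0 : (n%:R^-1 : R) @[n --> \oo] --> (0 : R).
  apply/cvgrPdist_le => e e0; near=> n.
  rewrite sub0r normrN ger0_norm ?invr_ge0 // invf_ple ?posrE //.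
    apply: le_trans (ltW (truncnS_gt _)) _; rewrite ler_nat; near: n; exact: nbhs_infty_ge.
  by rewrite ltr0n; near: n; exact: nbhs_infty_ge.
apply: (@squeeze_cvgr _ _ _ _ (fun n => (2 * M)%:R^-1 - n%:R^-1) (fun=> (2 * M)%:R^-1)).
- near=> n; have n0 : 0 < n%:R :> R by rewrite ltr0n; near: n; exact: nbhs_infty_ge.
  have e : n%:R = (half n)%:R * (2 * M)%:R + (n %% (2 * M))%:R :> R.
    by rewrite -natrM -natrD -divn_eq.
  set m := half n in e *; set r := (n %% (2 * M))%:R in e.
  have r0 : 0 <= r / (2 * M)%:R <= 1.
    by rewrite divr_ge0 //= ler_pdivrMr // mul1r ler_nat ltnW // ltn_mod.
  have -> : m%:R / n%:R = (2 * M)%:R^-1 - r / (2 * M)%:R / n%:R.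
    have -> : m%:R = (n%:R - r) / (2 * M)%:R by rewrite e addrK mulfK // gt_eqF.
    by rewrite !mulrBl; congr (_ - _); rewrite mulrAC mulfV ?mul1r // gt_eqF.
  have /andP[r1 r2] := r0; apply/andP; split.
    by rewrite lerD2l lerN2 ler_pdivrMr // mulVf // gt_eqF.
  by rewrite gerBl divr_ge0.
- rewrite -[X in _ --> X]subr0; apply: cvgB => //; exact: cvg_cst.
- exact: cvg_cst.
Unshelve. all: by end_near. Qed.

Let invn_cvg : (n%:R^-1 : R) @[n --> \oo] --> (0 : R).
Proof.
apply/cvgrPdist_le => e e0; near=> n.
rewrite sub0r normrN ger0_norm ?invr_ge0 // invf_ple ?posrE //.
  apply: le_trans (ltW (truncnS_gt _)) _; rewrite ler_nat; near: n; exact: nbhs_infty_ge.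
by rewrite ltr0n; near: n; exact: nbhs_infty_ge.
Unshelve. all: by end_near. Qed.

Definition hit n S (k : nat) : set R := \big[setU/set0]_(a <- index_enum (node M L) | a \in S) cls n k a.

Lemma measurable_hit n S k : measurable (hit n S k).
Proof. by apply: bigsetU_measurable => a _; exact: measurable_cls. Qed.

Lemma hitP n S k r : hit n S k r <-> exists2 a, a \in S & @in_class R M L eta lb n (A n) k a r.
Proof.
split; last first.
  by move=> [a aS h]; apply: (@mem_bigsetU _ _ _ _ _ a) => //; exact: mem_index_enum.
rewrite /hit; elim/big_rec: _ => [//|a x aS IH [/= h|/IH//]].
by exists a.
Qed.

Lemma law_hit n S k : 0 < A n -> law (hit n S k) = \sum_(a in S) law (cls n k a).
Proof.
move=> An0; rewrite /law /common_law /hit.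
rewrite (_ : _ @^-1` _ = \big[setU/set0]_(a <- index_enum (node M L) | a \in S) (X 0%N @^-1` cls n k a)).
  rewrite prob_bigsetU ?index_enum_uniq // => [a|a a' w].
    by apply: measurable_RV; exact: measurable_cls.
  exact: (in_class_unique eta0 An0).
by elim/big_rec2: _ => [|a x y _ <-]; rewrite ?preimage_set0 ?preimage_setU.
Qed.

Let bnd n := F (lb%:R * eta * A n).

Lemma law_hit_le n S k : 0 < A n -> (0 < k < n)%N -> law (hit n S k) <= bnd n.
Proof.
move=> An0 /andP[k0 kn]; apply: le_common_law => //; first exact: measurable_hit.
  exact: measurable_ln_norm_gt.
have k00 : (k == 0%N) = false by rewrite gtn_eqF.
have kn0 : (k == n) = false by rewrite ltn_eqF.
move=> r /hitP[a _]; rewrite /in_class /level k00 kn0 /=.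
move=> /and4P[_ _ _ /and3P[_ lba /andP[h _]]]; apply: le_lt_trans h.
by rewrite ler_pM2r // ler_pM2r // ler_nat.
Qed.

(** A node of an interior column and relevant level is the class of [half n] indices with the same
    probability, and [half n / n] tends to the inverse of [2 M]. *)
Lemma interior_hits_cvg S :
  \sum_(1 <= k < n) law (hit n S k) @[n --> \oo] --> \sum_(a in S) node_weight a.
Proof.
apply: (@cvg_near_eq _ (fun n => \sum_(a in S) (if (0 < node_col a < M)%N && (lb <= node_lev a)%N then
    (n%:R * level_mass n (node_pos a) (node_lev a)) * ((half n)%:R / n%:R) else 0))).
  near=> n; have An0 : 0 < A n by near: n; exact: A0.
  have n0 : (0 < n)%N by near: n; exact: nbhs_infty_ge.
  have h0 : (0 < half n)%N by rewrite divn_gt0 ?muln_gt0 ?M0 //; near: n; exact: nbhs_infty_ge.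
  under [RHS]eq_bigr do rewrite law_hit //.
  rewrite [RHS]exchange_big /=; apply: eq_bigr => a _.
  rewrite big_nat; under eq_bigr => k kn do rewrite (law_class _ kn).
  rewrite -big_nat.
  have cM : (node_col a <= M)%N by rewrite -ltnS; exact: ltn_ord.
  have := @count_column n (node_col a) (node_odd a) h0 cM.
  set m := level_mass _ _ _.
  have -> : n%:R * m * ((half n)%:R / n%:R) = (half n)%:R * m.
    by field; rewrite pnatr_eq0 -lt0n.
  case: (leqP lb (node_lev a)) => hl; last first.
    by move=> _; rewrite andbF big1 // => k _; rewrite !andbF.
  rewrite andbT => hc.
  transitivity ((\sum_(1 <= k < n) [&& node_odd a == odd k, node_col a == k %/ (2 * half n) &
    2 * half n <= k < 2 * half n * M])%N%:R * m); last first.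
    rewrite natr_sum mulr_suml; apply: eq_bigr => k _.
    by rewrite andbT; case: ifP => _; rewrite ?mul1r ?mul0r.
  by rewrite hc; case: ifP => _; rewrite ?mul0r.
apply: cvg_sum_seq => a _; rewrite /node_weight; case: ifP => h; last exact: cvg_cst.
apply: cvgM; last exact: column_half_cvg.
by apply: level_mass_cvg; case/andP: h => _; exact: leq_trans.
Unshelve. all: by end_near. Qed.

Let pat n w : {set node M L} := pattern M L eta lb n (A n) (fun k => X k w).

Let void_eventE n S : [set w | pat n w \subset ~: S] =
  \bigcap_(j in [set` index_iota 0 n.+1]) X j @^-1` (~` hit n S j).
Proof.
apply/seteqP; split => w /=.
  move=> /fintype.subsetP h j; rewrite /= mem_index_iota ltnS => jn /hitP[a aS ha].
  have : a \in pat n w.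
    by rewrite inE; apply/existsP; exists (Ordinal (jn : (j < n.+1)%N)).
  by move=> /h; rewrite inE aS.
move=> h; apply/fintype.subsetP => a; rewrite !inE => /existsP[k hk]; apply/negP => aS.
by apply: (h k); [rewrite /= mem_index_iota ltn_ord|apply/hitP; exists a].
Qed.

Lemma measurable_void_event n S : measurable [set w | pat n w \subset ~: S].
Proof.
rewrite void_eventE; apply: fin_bigcap_measurable; first exact: finite_seq.
by move=> k _; apply: measurable_RV; apply: measurableC; exact: measurable_hit.
Qed.

(** Hits at distinct indices are independent, so that the void probability is a product. Its two end
    factors are already those of the limit, as [n] has parity [o]; the interior hits are uniformly
    rare, because each requires a coefficient above the level [lb]. *)
Lemma void_cvg (o : bool) S :
  prob P [set w | pat (2 * j + o)%N w \subset ~: S] @[j --> \oo] --> void_limit o S.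
Proof.
have jy : (2 * j + o)%N @[j --> \oo] --> \oo by move=> B; exact: near_parity.
apply: (@cvg_near_eq _ (fun j => (1 - \sum_(a in S) end_weight 0 false a) *
   (1 - \sum_(a in S) end_weight M o a) * (\prod_(1 <= k < (2 * j + o)%N) (1 - law (hit (2 * j + o)%N S k))))).
  have hA : \forall j \near \oo, 0 < A (2 * j + o)%N := jy _ A0.
  near=> j; have An0 : 0 < A (2 * j + o)%N by near: j.
  have n0 : (0 < 2 * j + o)%N.
    by apply: leq_trans (leq_addr _ _); rewrite muln_gt0 /=; near: j; exact: nbhs_infty_ge.
  have on : odd (2 * j + o) = o by rewrite oddD mul2n odd_double /=; case: (o).
  set n := (2 * j + o)%N in An0 n0 on *.
  rewrite void_eventE (prob_bigcap_law iidX) ?iota_uniq //; last first.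
    by move=> k; apply: measurableC; exact: measurable_hit.
  under [RHS]eq_bigr do rewrite (common_law_setC X (measurable_hit _ _ _)).
  have l0 : common_law X (hit n S 0) = _ := law_hit S 0 An0.
  have ln : common_law X (hit n S n) = _ := law_hit S n An0.
  rewrite (eq_bigr _ (fun a _ => law_class0 a n0)) in l0.
  rewrite (eq_bigr _ (fun a _ => law_classn a n0)) on in ln.
  rewrite [RHS]big_nat_recr //= [X in _ = X * _]big_ltn // l0 ln.
  by rewrite mulrAC.
apply: cvgM; first exact: cvg_cst.
suff main : \prod_(1 <= k < n) (1 - law (hit n S k)) @[n --> \oo] -->
    expR (- \sum_(a in S) node_weight a) by exact: (cvg_comp _ _ jy main).
apply: (prod_onem_cvg (del := bnd)).
- near=> n; have An0 : 0 < A n by near: n; exact: A0.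
  by move=> k kn; rewrite law_hit_le // common_law_ge0.
- have b0 : 0 < lb%:R * eta by rewrite mulr_gt0 // ltr0n.
  apply: (@cvg_near_eq _ (fun n => (n%:R * bnd n) * n%:R^-1)).
    near=> n; have n0 : (0 < n)%N by near: n; exact: nbhs_infty_ge.
    by field; rewrite pnatr_eq0 -lt0n.
  rewrite -[X in _ --> X](mulr0 ((lb%:R * eta) `^ (- alpha))).
  exact: (cvgM (tail_quantile_rv alpha01 F0 Fni Frv b0) invn_cvg).
- exact: interior_hits_cvg.
Unshelve. all: by end_near. Qed.

Lemma measurable_pattern_in n (Q : pred {set node M L}) : measurable [set w | Q (pat n w)].
Proof. apply: measurable_random_set_in => S; exact: measurable_void_event. Qed.

Lemma pattern_law_cvg (o : bool) (Q : pred {set node M L}) :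
  prob P [set w | Q (pat (2 * j + o)%N w)] @[j --> \oo] --> pattern_law o Q.
Proof.
under eq_fun => j do rewrite (prob_random_set_in P (measurable_void_event (2 * j + o)%N)).
by apply: cvg_sum_seq => Z _; apply: sieve_cvg => S; exact: void_cvg.
Qed.

End PatternLaw.

(** * Convergence in distribution *)

Section Atoms.
Variables (d : measure_display) (T : measurableType d) (R : realType).

(** Outside the first [K] atoms, [g] is bounded by [C] and the mass left is 1 minus their sum. [N]
    is not supposed to be integer-valued: the lemma also serves for the identity under the limit
    law, of which only the atoms are known. *)
Lemma expectation_atoms (Q : probability T R) (N : T -> R) (g : R -> R) (C : R) :
  measurable_fun [set: T] N -> measurable_fun [set: R] g -> (forall x, `|g x| <= C) ->
  exists2 r : R, ('E_Q[g \o N] = r%:E)%E & forall K : nat,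
    `|r - \sum_(m < K) g m%:R * prob Q [set w | N w = m%:R]| <=
      C * (1 - \sum_(m < K) prob Q [set w | N w = m%:R]).
Proof.
move=> mN mg gC.
pose A (m : nat) := [set w | N w = m%:R].
have mA m : measurable (A m).
  by have := mN measurableT _ (measurable_set1 (m%:R : R)); rewrite setTI.
pose D (K : nat) := [set w | forall m, (m < K)%N -> N w <> m%:R].
have DS K : D K = A K `|` D K.+1.
  apply/seteqP; split => w /=.
    move=> h; have [NK|NK] := pselect (N w = K%:R); [by left|right => m].
    by rewrite ltnS leq_eqVlt => /predU1P[->//|]; exact: h.
  move=> [h m mK|h m mK]; last by apply: h; rewrite ltnS ltnW.
  by rewrite h => /eqP; rewrite eqr_nat gtn_eqF.
have dis K : A K `&` D K.+1 = set0.
  by apply/seteqP; split => w // [/= h1 h2]; apply: (h2 K).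
have D0 : D 0%N = setT by apply/seteqP; split.
have mD K : measurable (D K).
  rewrite (_ : D K = \bigcap_(m in [set m | (m < K)%N]) ~` A m) //.
  by apply: bigcap_measurableType => m _; exact: measurableC.
have mf : measurable_fun [set: T] (g \o N) by exact: measurableT_comp.
have int B : measurable B -> Q.-integrable B (EFin \o (g \o N)).
  move=> mB; apply: measurable_bounded_integrable => //.
  - exact: le_lt_trans (probability_le1 Q mB) (ltry 1).
  - exact: measurable_funS mf.
  - exists C; split; first exact: num_real.
    by move=> x Cx w _ /=; apply: le_trans (ltW Cx).
pose I B := (\int[Q]_(w in B) (g \o N) w)%R.
have IS K : I (D K) = g K%:R * prob Q (A K) + I (D K.+1).
  rewrite /I [in LHS]DS Rintegral_setU //; last 2 first.
  - by apply: int; exact: measurableU.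
  - by apply/eqP; exact: dis.
  congr (_ + _); rewrite -[RHS](Rintegral_cst Q (mA K)).
  by apply: eq_Rintegral => w; rewrite inE /= => ->.
have PS K : prob Q (D K) = prob Q (A K) + prob Q (D K.+1).
  rewrite (prob_setDI Q (mD K) (mA K)); congr (prob Q _ + prob Q _).
    by apply/setIidPr; rewrite DS => w; left.
  rewrite DS setDUl setDv set0U; apply/setDidPl.
  by rewrite setIC; exact: dis.
have IK K : I setT = \sum_(m < K) g m%:R * prob Q (A m) + I (D K).
  elim: K => [|K IH]; first by rewrite big_ord0 add0r D0.
  by rewrite big_ord_recr /= -addrA -IS.
have PK K : 1 = \sum_(m < K) prob Q (A m) + prob Q (D K).
  elim: K => [|K IH]; first by rewrite big_ord0 add0r D0 prob_setT.
  by rewrite big_ord_recr /= -addrA -PS.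
exists (I setT).
  rewrite unlock /I /Rintegral fineK //.
  exact: integrable_fin_num (int _ measurableT).
move=> K.
have -> : I setT - \sum_(m < K) g m%:R * prob Q (A m) = I (D K) by rewrite (IK K) addrC addKr.
have -> : 1 - \sum_(m < K) prob Q (A m) = prob Q (D K) by rewrite {1}(PK K) addrC addKr.
apply: le_trans (le_normr_Rintegral (mD K) (int _ (mD K))) _.
rewrite -(Rintegral_cst Q (mD K)); apply: le_Rintegral => //.
- by have := integrable_abse (int _ (mD K)); apply: eq_integrable.
- apply: measurable_bounded_integrable => //; last exact: bounded_cst.
  exact: le_lt_trans (probability_le1 Q (mD K)) (ltry 1).
- by move=> w _; exact: gC.
Qed.

End Atoms.

Section AtomicLaw.
Variables (R : realType) (l : nat -> R).
Hypothesis l0 : forall m, 0 <= l m.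
Hypothesis l1 : \sum_(0 <= m < n) l m @[n --> \oo] --> (1 : R).

Lemma atomic_law_exists : exists mu : probability R R, forall m, prob mu [set m%:R] = l m.
Proof.
pose nu : {measure set R -> \bar R} :=
  mseries (fun m => mscale (NngNum (l0 m)) (dirac (m%:R : R))) 0.
have nuT : nu setT = 1%E.
  rewrite /nu /= /mseries; apply/cvg_lim => //.
  apply: (@cvg_trans _ ((\sum_(0 <= m < n) l m)%:E @[n --> \oo])).
    apply: near_eq_cvg; near=> n; rewrite -sumEFin; apply: eq_bigr => m _.
    apply/esym; transitivity ((l m)%:E * dirac (m%:R : R) setT)%E; first by [].
    by rewrite diracT mule1.
  by apply: cvg_EFin => //; near=> n.
have nu1 m : nu [set m%:R] = (l m)%:E.
  rewrite /nu /= /mseries; apply/cvg_lim => //.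
  apply: cvg_near_cst; near=> n.
  have mn : (m < n)%N by near: n; exact: nbhs_infty_ge.
  rewrite (bigD1_seq m) ?mem_index_iota ?iota_uniq //= big1 ?adde0.
    transitivity ((l m)%:E * dirac (m%:R : R) [set m%:R])%E; first by [].
    by rewrite diracE mem_set // mule1.
  move=> k km.
  transitivity ((l k)%:E * dirac (k%:R : R) [set m%:R])%E; first by [].
  rewrite diracE memNset ?mule0 //.
  by move=> /eqP; rewrite eqr_nat (negbTE km).
(* The total mass is already 1; normalizing does not change the measure and makes it a
   probability. *)
have e (U : set R) : mnormalize nu (dirac (0 : R)) U = nu U.
  by rewrite /mnormalize nuT onee_eq0 /= invr1 mule1.
exists (mnormalize nu (dirac (0 : R))) => m.
exact: (congr1 fine (etrans (e _) (nu1 m))).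
Unshelve. all: by end_near. Qed.

End AtomicLaw.

(** Convergence of the atoms is enough because the limits sum to 1: finitely many integers carry
    almost all the mass of the limit, hence eventually of each law. *)
Lemma expectation_cvg (R : realType) (d : measure_display) (T : measurableType d)
    (P : probability T R) (N : nat -> T -> nat) (mu : probability R R) (l : nat -> R) :
  (forall j, measurable_fun [set: T] (fun w => (N j w)%:R : R)) ->
  (forall m, prob P [set w | N j w = m] @[j --> \oo] --> l m) ->
  (forall m, prob mu [set m%:R] = l m) ->
  (forall e : R, 0 < e -> exists K, 1 - e <= \sum_(m < K) l m) ->
  cvg_in_distribution P (fun j w => (N j w)%:R) mu.
Proof.
move=> mN Nl mul lK; split => // f fc [B [Breal hB]].
pose C := `|B| + 1; have C0 : 0 < C by rewrite ltr_wpDl.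
have fC x : `|f x| <= C.
  by apply: hB => //; rewrite /C; apply: le_lt_trans (ler_norm B) _; rewrite ltrDl.
have mf : measurable_fun [set: R] f by exact: continuous_measurable_fun.
have [y yE hy] := expectation_atoms mu (@measurable_id _ R setT) mf fC.
have hx j := expectation_atoms P (mN j) mf fC.
have /choice[x xh] : forall j, exists r : R, ('E_P[f \o (fun w => (N j w)%:R)] = r%:E)%E /\
  forall K : nat, `|r - \sum_(m < K) f m%:R * prob P [set w | (N j w)%:R = m%:R :> R]| <=
      C * (1 - \sum_(m < K) prob P [set w | (N j w)%:R = m%:R :> R]).
  by move=> j; have [r r1 r2] := hx j; exists r.
have -> : ('E_mu[f] = y%:E)%E by rewrite -yE.
apply: (@cvg_trans _ ((x j)%:E @[j --> \oo])).
  by apply: near_eq_cvg; near=> j; rewrite (xh j).1.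
apply: cvg_EFin; first by near=> j.
have NE j (m : nat) : [set w | (N j w)%:R = m%:R :> R] = [set w | N j w = m].
  by apply/seteqP; split => w /= => [/eqP|->//]; rewrite eqr_nat => /eqP.
apply/cvgrPdist_le => e e0.
have e40 : 0 < e / 4 / C by rewrite !divr_gt0.
have [K hK] := lK _ e40.
have c1 : \sum_(m < K) f m%:R * prob P [set w | N j w = m] @[j --> \oo] -->
    \sum_(m < K) f m%:R * l m.
  by apply: cvg_sum_seq => m _; apply: cvgM; [exact: cvg_cst|exact: Nl].
have c2 : \sum_(m < K) prob P [set w | N j w = m] @[j --> \oo] --> \sum_(m < K) l m.
  by apply: cvg_sum_seq => m _; exact: Nl.
have h1 := (@cvgrPdist_le _ _ _ _ _ _ _).1 c1 (e / 4) (divr_gt0 e0 (ltr0Sn R 3)).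
have h2 := (@cvgrPdist_le _ _ _ _ _ _ _).1 c2 (e / 4 / C) e40.
near=> j.
have g1 : `|\sum_(m < K) f m%:R * l m - \sum_(m < K) f m%:R * prob P [set w | N j w = m]| <= e / 4.
  by near: j; exact: h1.
have g2 : `|\sum_(m < K) l m - \sum_(m < K) prob P [set w | N j w = m]| <= e / 4 / C.
  by near: j; exact: h2.
have g3 : `|x j - \sum_(m < K) f m%:R * prob P [set w | N j w = m]| <=
    C * (1 - \sum_(m < K) prob P [set w | N j w = m]).
  have := (xh j).2 K; under eq_bigr do rewrite NE.
  by under [X in _ <= C * (1 - X)]eq_bigr do rewrite NE.
have g4 : `|y - \sum_(m < K) f m%:R * l m| <= C * (1 - \sum_(m < K) l m).
  have := hy K; under eq_bigr do rewrite mul.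
  by under [X in _ <= C * (1 - X)]eq_bigr do rewrite mul.
have {}g4 : `|y - \sum_(m < K) f m%:R * l m| <= e / 4.
  apply: le_trans g4 _; rewrite mulrC -ler_pdivlMr //; move: hK; lra.
have {}g3 : `|x j - \sum_(m < K) f m%:R * prob P [set w | N j w = m]| <= e / 2.
  apply: le_trans g3 _; rewrite mulrC -ler_pdivlMr //.
  have -> : e / 2 / C = e / 4 / C + e / 4 / C by field; rewrite gt_eqF.
  by move: g2; rewrite ler_norml; move: hK => ? /andP[? ?]; lra.
move: g1 g3 g4.
set u := \sum_(m < K) f m%:R * l m; set v := \sum_(m < K) _.
rewrite /= !ler_norml => /andP[? ?] /andP[? ?] /andP[? ?]; apply/andP; split; lra.
Unshelve. all: by end_near. Qed.

Record root_system (d : measure_display) (T : measurableType d) (R : realType)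
    (P : probability T R) (X : nat -> {RV P >-> R}) (alpha c p : R) : Prop := RootSystem {
  rs_heavy : log_heavy X alpha;
  rs_balance : pos_tail X t / log_tail X t @[t --> +oo] --> c;
  rs_pos : common_law X [set r : R | 0 < r] = p
}.

Section RootCount.
Variables (R : realType) (d : measure_display) (T : measurableType d).
Variables (P : probability T R) (X : nat -> {RV P >-> R}).

Definition root_count (n : nat) (w : T) : nat := nb_real_roots (random_poly X n w).

Definition root_prob (n m : nat) : R := prob P [set w | root_count n w = m].

Lemma measurable_root_count n : measurable_fun [set: T] (fun w => (root_count n w)%:R : R).
Proof.
apply: measurable_nb_real_roots => k.
exact: measurable_funPT.
Qed.

Lemma measurable_root_count_eq n m : measurable [set w | root_count n w = m].
Proof.
have := measurable_root_count n measurableT (measurable_set1 (m%:R : R)).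
rewrite setTI; congr measurable; apply/seteqP; split => w /= => [/eqP|->//].
by rewrite eqr_nat => /eqP.
Qed.

Lemma measurable_root_count_lt n k : measurable [set w | (root_count n w < k)%N].
Proof.
have := measurable_root_count n measurableT (measurable_itv `]-oo, (k%:R : R)[).
by rewrite setTI; congr measurable; apply/seteqP; split => w /=; rewrite in_itv /= ltr_nat.
Qed.

Lemma sum_root_prob n K :
  \sum_(m < K) root_prob n m = prob P [set w | (root_count n w < K)%N].
Proof.
elim: K => [|K IH]; first by rewrite big_ord0 -(prob_set0 P); congr (prob P _); apply/seteqP; split.
rewrite big_ord_recr /= IH (prob_setDI P (measurable_root_count_lt n K.+1) (measurable_root_count_lt n K)).
congr (prob P _ + prob P _); apply/seteqP; split => w /=.
- by move=> h; split => //; rewrite ltnW.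
- by move=> [].
- by move=> ->; split => //; rewrite ltnn.
- by move=> [+ /negP]; rewrite ltnS -leqNgt => h1 h2; apply/eqP; rewrite eqn_leq h1.
Qed.

End RootCount.

Lemma prob_close (d : measure_display) (T : measurableType d) (R : realType)
    (P : probability T R) (A A' B : set T) :
  measurable A -> measurable A' -> measurable B ->
  (forall w, ~ B w -> (A w <-> A' w)) -> `|prob P A - prob P A'| <= prob P B.
Proof.
move=> mA mA' mB h.
have le (C D : set T) : measurable C -> measurable D -> (forall w, ~ B w -> C w -> D w) ->
    prob P C <= prob P D + prob P B.
  move=> mC mD CD; apply: le_trans (prob_setU_le P mD mB).
  apply: le_prob => //; first exact: measurableU.
  by move=> w Cw; have [Bw|Bw] := pselect (B w); [right|left; exact: CD].
rewrite ler_distlC lerBlDr; apply/andP; split.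
  by apply: le => // w /h[].
by apply: le => // w /h[].
Qed.

(** The order of the quantifiers matters: [K] and [ell] are fixed before the probability space and
    the coefficients, so that all systems with the same parameters share them. The error is split
    into eight parts, seven for the families of bad events and one for the convergence of the
    pattern. There are finitely many patterns on a grid, so that their values are bounded: this is
    where [K] comes from. *)
Lemma root_prob_approx (R : realType) (alpha c p e : R) : 0 < alpha < 1 -> 0 < e ->
  exists (K : nat) (ell : bool -> nat -> R),
  forall (d : measure_display) (T : measurableType d) (P : probability T R)
    (X : nat -> {RV P >-> R}), root_system X alpha c p -> forall o : bool,
  (forall m, \forall j \near \oo, `|root_prob X (2 * j + o)%N m - ell o m| <= e) /\
  (\forall j \near \oo, 1 - e <= \sum_(m < K) root_prob X (2 * j + o)%N m).
Proof.
move=> alpha01 e0; have e80 : 0 < e / 8 by rewrite divr_gt0.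
have [M [L [lb [eta [h [kappa [lambda [w0 sc]]]]]]]] := scheme_exists alpha01 e80.
exists (\max_(Z : {set node M L}) pattern_roots eta Z).+1.
exists (fun o m => pattern_law lb eta alpha c p o (fun Z => @pattern_roots R M L eta Z == m)).
move=> d T P X [hX bal pos] o.
pose a n := tail_quantile (log_tail X) n.
pose B n := bad X M L lb n eta (a n) h kappa lambda w0.
pose pat n w := pattern M L eta lb n (a n) (fun k => X k w).
have hB : \forall n \near \oo, prob P (B n) <= 7 * (e / 8) := near_prob_bad_le hX sc e80.
have hN : \forall n \near \oo, forall w, ~ B n w -> root_count X n w = pattern_roots eta (pat n w)
  := roots_pattern_outside_bad hX sc.
have mB n : measurable (B n) by exact: measurable_bad.
split=> [m|].
  have lim : prob P [set w | @pattern_roots R M L eta (pat (2 * j + o)%N w) == m] @[j --> \oo] -->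
      pattern_law lb eta alpha c p o (fun Z => @pattern_roots R M L eta Z == m).
    exact: (pattern_law_cvg (sc_M sc) (sc_lb sc) (sc_eta sc) hX bal pos).
  have h1 := (@cvgrPdist_le _ _ _ _ _ _ _).1 lim (e / 8) e80.
  near=> j.
  have g1 : prob P (B (2 * j + o)%N) <= 7 * (e / 8) by near: j; exact: near_parity hB.
  have g2 : forall w, ~ B (2 * j + o)%N w -> root_count X (2 * j + o)%N w = pattern_roots eta (pat (2 * j + o)%N w).
    by near: j; exact: near_parity hN.
  have g3 : `|pattern_law lb eta alpha c p o (fun Z => @pattern_roots R M L eta Z == m) -
    prob P [set w | @pattern_roots R M L eta (pat (2 * j + o)%N w) == m]| <= e / 8.
    by near: j; exact: h1.
  have g4 : `|root_prob X (2 * j + o)%N m - prob P [set w | @pattern_roots R M L eta (pat (2 * j + o)%N w) == m]|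
      <= prob P (B (2 * j + o)%N).
    apply: prob_close => //; first exact: measurable_root_count_eq.
      exact: (measurable_pattern_in lb eta X (2 * j + o)%N (fun Z => @pattern_roots R M L eta Z == m)).
    by move=> w /g2 /= ->; split => [->|/eqP].
  move: g1 g3 g4; rewrite !ler_norml => g1 /andP[? ?] /andP[? ?]; apply/andP; split; lra.
near=> j.
have g1 : prob P (B (2 * j + o)%N) <= 7 * (e / 8) by near: j; exact: near_parity hB.
have g2 : forall w, ~ B (2 * j + o)%N w -> root_count X (2 * j + o)%N w = pattern_roots eta (pat (2 * j + o)%N w).
  by near: j; exact: near_parity hN.
rewrite sum_root_prob.
apply: (@le_trans _ _ (prob P (~` B (2 * j + o)%N))); first by rewrite prob_setC //; lra.
apply: le_prob; [exact: measurableC|exact: measurable_root_count_lt|].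
move=> w /g2 /= ->; rewrite ltnS.
exact: (@leq_bigmax _ (fun Z : {set node M L} => pattern_roots eta Z)).
Unshelve. all: by end_near. Qed.

(* The approximating law depends on [alpha], [c], [p] only, so the limit can be read off any
   single system with these parameters; without such a system there is nothing to prove. *)
Lemma root_law_exists (R : realType) (alpha c p : R) (o : bool) :
  exists mu : probability R R,
  forall (d : measure_display) (T : measurableType d) (P : probability T R)
    (X : nat -> {RV P >-> R}), root_system X alpha c p ->
  cvg_in_distribution P (fun j w => (root_count X (2 * j + o)%N w)%:R : R) mu.
Proof.
have [[d [T [P [X hX]]]]|none] := pselect (exists (d : measure_display) (T : measurableType d)
    (P : probability T R) (X : nat -> {RV P >-> R}), root_system X alpha c p); last first.
  by exists (dirac (0 : R)) => d T P X hX; case: none; exists d, T, P, X.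
have alpha01 := lh_alpha (rs_heavy hX).
have cvX m : cvgn (fun j => root_prob X (2 * j + o)%N m).
  (* The approximation [ell] varies with [e], but for each [e] it is the centre of a ball that
     eventually contains the sequence. *)
  apply/cauchy_cvgP; apply: cauchy_exP => e e0.
  have e20 : 0 < e / 2 by rewrite divr_gt0.
  have [K [ell hell]] := root_prob_approx c p alpha01 e20.
  exists (ell o m).
  have := (hell _ _ _ _ hX o).1 m; apply: filterS => j hj.
  by rewrite /ball /= distrC; apply: le_lt_trans hj _; lra.
pose l m := limn (fun j => root_prob X (2 * j + o)%N m).
have lX m : root_prob X (2 * j + o)%N m @[j --> \oo] --> l m by exact: cvX.
have lY d' (T' : measurableType d') (P' : probability T' R) (Y : nat -> {RV P' >-> R}) m :
    root_system Y alpha c p -> root_prob Y (2 * j + o)%N m @[j --> \oo] --> l m.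
  (* The same [ell] approximates both systems, so that their limits agree. *)
  move=> hY; apply/cvgrPdist_le => e e0.
  have e30 : 0 < e / 3 by rewrite divr_gt0.
  have [K [ell hell]] := root_prob_approx c p alpha01 e30.
  have h1 := (hell _ _ _ _ hX o).1 m; have h2 := (hell _ _ _ _ hY o).1 m.
  have h3 := (@cvgrPdist_le _ _ _ _ _ _ _).1 (lX m) (e / 3) e30.
  near=> j.
  have g1 : `|root_prob X (2 * j + o)%N m - ell o m| <= e / 3 by near: j.
  have g2 : `|root_prob Y (2 * j + o)%N m - ell o m| <= e / 3 by near: j.
  have g3 : `|l m - root_prob X (2 * j + o)%N m| <= e / 3 by near: j; exact: h3.
  move: g1 g2 g3; rewrite !ler_norml => /andP[? ?] /andP[? ?] /andP[? ?].
  by apply/andP; split; lra.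
have l0 m : 0 <= l m by apply: limr_ge (cvX m) _; near=> j; exact: prob_ge0.
have lsum K : \sum_(m < K) root_prob X (2 * j + o)%N m @[j --> \oo] --> \sum_(m < K) l m.
  by apply: cvg_sum_seq => m _; exact: lX.
have lle K : \sum_(m < K) l m <= 1.
  apply: (ler_cvg_to (lsum K) (cvg_cst (1 : R))); near=> j.
  by rewrite sum_root_prob; apply: prob_le1; exact: measurable_root_count_lt.
(* No mass escapes to infinity: for each [e] the integers below [K] eventually carry at least
   [1 - e], and this passes to the limit since the sum is finite. *)
have lge e : 0 < e -> exists K, 1 - e <= \sum_(m < K) l m.
  move=> e0; have [K [ell hell]] := root_prob_approx c p alpha01 e0.
  exists K; apply: (ler_cvg_to (cvg_cst (1 - e)) (lsum K)).
  exact: (hell _ _ _ _ hX o).2.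
have l1 : \sum_(0 <= m < n) l m @[n --> \oo] --> (1 : R).
  apply/cvgrPdist_le => e e0; have [K hK] := lge e e0; near=> n.
  have Kn : (K <= n)%N by near: n; exact: nbhs_infty_ge.
  rewrite ger0_norm; last by rewrite subr_ge0 big_mkord.
  rewrite lerBlDr addrC -lerBlDr; apply: le_trans hK _.
  rewrite -(big_mkord predT l) (big_cat_nat (leq0n K) Kn) /= lerDl sumr_ge0 //.
have [mu hmu] := atomic_law_exists l0 l1.
exists mu => d' T' P' Y hY.
apply: (@expectation_cvg _ _ _ P' (fun j => root_count Y (2 * j + o)%N) mu l) => //.
- by move=> j; exact: measurable_root_count.
- by move=> m; exact: lY.
Unshelve. all: by end_near. Qed.

Lemma root_system_intro (R : realType) (alpha c p : R) (d : measure_display)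
    (T : measurableType d) (P : probability T R) (xi : nat -> {RV P >-> R}) :
  0 < alpha < 1 -> iid xi ->
  regularly_varying (fun t => prob P [set w | t < ln `|xi 0%N w|]) (- alpha) ->
  prob P [set w | t < xi 0%N w] / prob P [set w | t < `|xi 0%N w|]
    @[t --> +oo] --> c ->
  {ae P, forall w, xi 0%N w <> 0} ->
  p = prob P [set w | 0 < xi 0%N w] ->
  root_system xi alpha c p.
Proof.
move=> alpha01 iidxi [[t0 [_ ft0]] rv] bal ae0 pE; split => //.
  split => //.
  - case: ae0 => N [mN PN0 hN]; apply/eqP; rewrite eq_le common_law_ge0 andbT.
    apply: le_trans (_ : prob P N <= 0); last by rewrite /prob PN0.
    apply: le_prob; [by apply: measurable_RV; exact: measurable_set1|exact: mN|].
    by move=> w /= xi0; apply: hN => /=; rewrite xi0.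
  (* Regular variation gives positivity beyond [t0] only; monotonicity extends it to all [t]. *)
  - move=> t; apply: lt_le_trans (ft0 (Num.max t t0) _) _; first by rewrite le_max lexx orbT.
    by apply: (log_tail_ni xi); rewrite le_max lexx.
(* The balance of the tails is stated for [xi 0], and is moved to the logarithmic scale by the
   substitution of [exp t] for [t]. *)
have expRy : @expR R t @[t --> +oo] --> +oo.
  apply/cvgryPgt => A; near=> t; apply: lt_le_trans (expR_ge1Dx t).
  by rewrite ltr_wpDl //; near: t; apply: nbhs_pinfty_gt; exact: num_real.
have h := cvg_comp _ _ expRy bal.
apply: cvg_trans h; apply: near_eq_cvg; near=> t.
have t0' : 0 < t by near: t; apply: nbhs_pinfty_gt; exact: num_real.
rewrite /=; congr (_ / _); rewrite /pos_tail /log_tail /common_law; congr (prob P _);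
  apply/seteqP; split => w /=.
- move=> h1; have x0 : 0 < xi 0%N w by apply: lt_trans h1; exact: expR_gt0.
  by rewrite gtr0_norm //; split => //; rewrite -ltr_expR lnK.
- by move=> [x0]; rewrite gtr0_norm // -ltr_expR lnK.
- move=> h1; have x0 : 0 < `|xi 0%N w| by apply: lt_trans h1; exact: expR_gt0.
  by rewrite -ltr_expR lnK.
(* Here [ln 0 = 0], whence the restriction to [t > 0]. *)
- have [->|x0] := eqVneq (xi 0%N w) 0.
    by rewrite normr0 ln0 // => /(lt_trans t0'); rewrite ltxx.
  by rewrite -ltr_expR lnK // posrE normr_gt0.
Unshelve. all: by end_near. Qed.

Theorem corollary1p11 (R : realType) :
  exists law_plus law_minus : R -> R -> R -> probability R R,
  forall (alpha : R), 0 < alpha < 1 ->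
  forall (d : measure_display) (T : measurableType d) (P : probability T R)
    (xi : nat -> {RV P >-> R}) (c p : R),
    iid xi ->
    nondegenerate (xi 0%N) ->
    regularly_varying (fun t => prob P [set w | t < ln `|xi 0%N w|]) (- alpha) ->
    prob P [set w | t < xi 0%N w] / prob P [set w | t < `|xi 0%N w|]
      @[t --> +oo] --> c ->
    {ae P, forall w, xi 0%N w <> 0} ->
    p = prob P [set w | 0 < xi 0%N w] ->
    let N (n : nat) (w : T) : R := (nb_real_roots (random_poly xi n w))%:R in
    cvg_in_distribution P (fun n => N (2 * n)%N) (law_plus alpha c p) /\
    cvg_in_distribution P (fun n => N (2 * n + 1)%N) (law_minus alpha c p).
Proof.
(* The limit law is chosen for each triple of parameters and each parity, before any probability
   space is given. *)
have /choice[law hlaw] : forall q : R * R * R * bool, exists mu : probability R R,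
  forall (d : measure_display) (T : measurableType d) (P : probability T R)
    (X : nat -> {RV P >-> R}), root_system X q.1.1.1 q.1.1.2 q.1.2 ->
  cvg_in_distribution P (fun j w => (root_count X (2 * j + q.2)%N w)%:R : R) mu.
  by move=> [[[alpha c] p] o]; exact: root_law_exists.
exists (fun alpha c p => law (alpha, c, p, false)), (fun alpha c p => law (alpha, c, p, true)).
move=> alpha alpha01 d T P xi c p iidxi _ rv bal ae0 pE N.
have hxi := root_system_intro alpha01 iidxi rv bal ae0 pE.
split; last exact: (hlaw (alpha, c, p, true) d T P xi hxi).
have -> : (fun n => N (2 * n)%N) = fun n => N (2 * n + false)%N.
  by apply/funext => n; rewrite addn0.
exact: (hlaw (alpha, c, p, false) d T P xi hxi).
Qed.
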